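(* Let $(M,g,J_1,J_2,J_3)$ be a pseudo-hyper-Kähler manifold of signature $(4k,4\ell)$ endowed with a Killing vector field $Z$ such that $g(Z,Z)$ is nowhere zero and $\mathcal{L}_ZJ_2=-2J_3$, let $f$ be a nowhere vanishing function on $M$ with $df=-\omega_1(Z,\cdot)$ and such that $f_1:=f-h$ is nowhere vanishing, where $h:=\frac12 g(Z,Z)$. Let $(\hat M,\hat g,\hat J_1,\hat J_2,\hat J_3,\xi)$ be the conical pseudo-hyper-Kähler manifold constructed from these data (and an $S^1$-bundle with connection $(P,\eta)$) as described in the context, and let $(\bar M,\bar g,Q)$ be the (at least locally defined) quaternionic pseudo-Kähler manifold associated with it. Then the signature of $(\bar M,\bar g,Q)$ depends only on the signature $(4k,4\ell)$ of $g$ and on the signs of $f$ and $f_1$. It is - $(4k,4\ell)$ if $f_1f>0$, - $(4k-4,4\ell+4)$ if $f>0$ and $f_1<0$, - $(4k+4,4\ell-4)$ if $f<0$ and $f_1>0$.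
   Context: A pseudo-hyper-Kähler manifold $(M,g,J_1,J_2,J_3)$ is a pseudo-Riemannian manifold $(M,g)$ with three $g$-skew-symmetric almost complex structures, parallel for the Levi-Civita connection, with $J_1J_2=J_3=-J_2J_1$; its Kähler forms are $\omega_\alpha:=g(J_\alpha\cdot,\cdot)$. A conical pseudo-hyper-Kähler manifold $(N,g,J_1,J_2,J_3,\xi)$ is a pseudo-hyper-Kähler manifold with a vector field $\xi$ such that $g(\xi,\xi)$ is nowhere zero and $D\xi=\mathrm{Id}$, $D$ the Levi-Civita connection. Signature $(a,b)$ means $a$ positive and $b$ negative directions. Construction of $\hat M$. Let $\pi:P\to M$ be an $S^1$-principal bundle with principal connection $\eta$ of curvature $d\eta=\pi^*\big(\omega_1-\frac12 d(g(Z,\cdot))\big)$; $\eta$ is a real-valued $S^1$-invariant one-form on $P$ with $\eta(X_P)=1$, where $X_P$ is the fundamental vector field of the principal action. Functions and forms on $M$ are identified with their pullbacks. Let $\tilde Z$ be the horizontal lift of $Z$ to $P$ and $Z_1:=\tilde Z+f_1X_P$. Define on $P$ the one-forms $\theta_1^P:=\eta+\frac12 g(Z,\cdot)$, $\theta_2^P:=\frac12\omega_3(Z,\cdot)$, $\theta_3^P:=-\frac12\omega_2(Z,\cdot)$, put $\theta_\alpha:=f^{-1}\theta_\alpha^P$ and $\theta:=\sum_{\alpha=1}^3\theta_\alpha i_\alpha$, where $(i_1,i_2,i_3)=(i,j,k)$. On $\tilde M:=\mathbb{H}^*\times P$ put $\tilde\theta_\alpha(q,p):=\varphi_\alpha(q)+(\mathrm{Ad}_q\theta(p))_\alpha$,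 where $\varphi=\varphi_0+\sum_\alpha\varphi_\alpha i_\alpha=dq\,q^{-1}$ is the right-invariant Maurer–Cartan form of $\mathbb{H}^*$ and $\mathrm{Ad}_qx=qxq^{-1}$, and $\tilde\omega_\alpha:=d(\rho^2f\,\tilde\theta_\alpha)$ with $\rho:=|q|$. Let $e_1^L$ be the left-invariant vector field on $\mathbb{H}^*$ equal to $i$ at $q=1$, $V_1:=e_1^L-Z_1$, $\hat M$ the space of integral curves of $V_1$, and $\tilde\pi:\tilde M\to\hat M$ the quotient map, assumed to be a submersion onto a Hausdorff manifold. There is a pseudo-hyper-Kähler structure $(\hat g,\hat J_1,\hat J_2,\hat J_3)$ on $\hat M$ whose Kähler forms $\hat\omega_\alpha=\hat g(\hat J_\alpha\cdot,\cdot)$ are determined by $\tilde\pi^*\hat\omega_\alpha=\tilde\omega_\alpha$, and it is conical with respect to the vector field $\xi$ which is the projection of the radial vector field $\rho\,\partial_\rho$ of $\mathbb{H}^*$. The quotient $\bar M$. The vector fields $\xi,\hat J_1\xi,\hat J_2\xi,\hat J_3\xi$ span a four-dimensional integrable distribution on $\hat M$. The space of leaves $\bar M$ (after restricting the foliation to a suitable open subset of $\hat M$, if necessary) inherits a quaternionic pseudo-Kähler structure $(\bar g,Q)$: the pullback of $\bar g$ to the $\hat g$-orthogonal complement of this distribution is, up to a positive constant factor, $|\hat g(\xi,\xi)|^{-1}\hat g$, and $Q$ is induced by $\mathrm{span}\{\hat J_1,\hat J_2,\hat J_3\}$. Manifolds are taken to be connected. *)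

(* Defs.v *)
From HB Require Import structures.
From mathcomp Require Import all_boot all_order all_algebra.
From mathcomp Require Import all_classical all_reals all_analysis.

Set Implicit Arguments.
Unset Strict Implicit.
Unset Printing Implicit Defensive.

Import Order.TTheory GRing.Theory Num.Theory numFieldNormedType.Exports.
Local Open Scope classical_set_scope.
Local Open Scope ring_scope.

(* Tangent vectors are row vectors: T_a M is 'rV[R]_n through the preferred
   chart [chart a] at a.  Hence an endomorphism field J takes values in 'M_n
   and acts by u |-> u *m J a, so that the composite "J1 after J2" is
   J2 a *m J1 a; a field of bilinear forms takes values in 'M_n and is
   evaluated by [bil]. *)

Fixpoint Ck (R : realType) (V W : normedModType R) (k : nat)
    (U : set V) (f : V -> W) : Prop :=
  if k is k'.+1 then
    (forall x, U x -> differentiable f x)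
    /\ (forall v, Ck k' U (fun x => 'D_v f x))
  else forall x, U x -> {for x, continuous f}.

Definition smooth_on (R : realType) (V W : normedModType R)
    (U : set V) (f : V -> W) : Prop := forall k, Ck k U f.

Record charted (R : realType) (n : nat) := Charted {
  pt :> topologicalType;
  chart : pt -> pt -> 'rV[R]_n;
  param : pt -> 'rV[R]_n -> pt;
  cdom : pt -> set pt }.

(* [param a] inverts [chart a] : cdom a -> R^n; its values outside of the
   image of the chart are irrelevant. *)
Record is_manifold (R : realType) (n : nat) (M : charted R n) : Prop := {
  manifold_hausdorff : hausdorff_space M;
  manifold_countable : @second_countable M;
  manifold_connected : connected [set: M];
  cdom_refl : forall a : M, cdom a a;
  cdom_open : forall a : M, open (cdom a);
  chart_open : forall a : M, open (chart a @` cdom a);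
  chartK : forall a x : M, cdom a x -> param a (chart a x) = x;
  chart_continuous : forall a x : M, cdom a x ->
    {for x, continuous (chart a)};
  param_continuous : forall a x : M, cdom a x ->
    {for chart a x, continuous (param a)};
  transition_smooth : forall a b : M,
    smooth_on (chart a @` (cdom a `&` cdom b)) (chart b \o param a) }.

Definition prod_charted (R : realType) (n m : nat)
    (M : charted R n) (N : charted R m) : charted R (n + m) :=
  @Charted R (n + m) (M * N)%type
    (fun a x => row_mx (chart a.1 x.1) (chart a.2 x.2))
    (fun a v => (param a.1 (lsubmx v), param a.2 (rsubmx v)))
    (fun a => cdom a.1 `*` cdom a.2).

Definition line (R : realType) : charted R 1 :=
  @Charted R 1 R^o (fun _ x => const_mx x) (fun _ v => v ord0 ord0)
    (fun _ => setT).

Definition punctured (R : realType) (n : nat) : charted R n :=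
  @Charted R n [set q : 'rV[R]_n | q != 0]
    (fun _ x => set_val x)
    (fun a v => if pselect ([set q : 'rV[R]_n | q != 0] v) is left vP
                then SigSub (mem_set vP) else a)
    (fun _ => setT).

Definition smooth_map_on (R : realType) (n m : nat)
    (M : charted R n) (N : charted R m) (U : set M) (F : M -> N) : Prop :=
  (forall x, U x -> {for x, continuous F})
  /\ forall (a : M) (b : N),
       smooth_on (chart a @` (cdom a `&` U `&` F @^-1` cdom b))
         (chart b \o F \o param a).

(* The differential of F at a is u |-> u *m tangent F a. *)
Definition tangent (R : realType) (n m : nat)
    (M : charted R n) (N : charted R m) (F : M -> N) (a : M) : 'M[R]_(n, m) :=
  'J (chart (F a) \o F \o param a) (chart a a).

(* The points x and y are joined by a curve lying in U, defined on an open
   interval, all of whose velocities satisfy W. *)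
Definition joined (R : realType) (n : nat) (M : charted R n)
    (U : set M) (W : M -> set 'rV[R]_n) (x y : M) : Prop :=
  exists (c : R^o -> M) (a b s t : R),
    [/\ a < s < b, a < t < b, c s = x, c t = y
      & forall r : R, a < r < b ->
        [/\ U (c r), {for r : R^o, continuous c}
          & exists2 w, W (c r) w
            & is_derive (r : R^o) (1 : R^o)
                (fun r' : R^o => chart (c r) (c r') : 'rV[R]_n) w]].

(* F exhibits N as the quotient manifold of U by the relation E. *)
Definition is_quotient_map (R : realType) (n m : nat)
    (M : charted R n) (N : charted R m)
    (U : set M) (E : M -> M -> Prop) (F : M -> N) : Prop :=
  [/\ smooth_map_on U F,
      forall x, U x -> row_full (tangent F x),
      forall y, exists2 x, U x & F x = y
    & forall x y, U x -> U y -> (F x = F y <-> E x y)].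

Definition bil (R : realType) (n : nat) (B : 'M[R]_n) (u v : 'rV[R]_n) : R :=
  (u *m B *m v^T) ord0 ord0.

(* u |-> u *m frame a x maps coordinate vectors of the chart at a to tangent
   vectors at the point param a x. *)
Definition frame (R : realType) (n : nat) (M : charted R n)
    (a : M) (x : 'rV[R]_n) : 'M[R]_n :=
  'J (chart (param a x) \o param a) x.

(* Coordinate expressions, in the chart at a, of functions, vector fields,
   one-forms, fields of bilinear forms and fields of endomorphisms. *)
Definition loc_fun (R : realType) (n : nat) (M : charted R n)
    (f : M -> R) (a : M) (x : 'rV[R]_n) : R^o := f (param a x).

Definition loc_vec (R : realType) (n : nat) (M : charted R n)
    (X : M -> 'rV[R]_n) (a : M) (x : 'rV[R]_n) : 'rV[R]_n :=
  X (param a x) *m invmx (frame a x).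

Definition loc_form (R : realType) (n : nat) (M : charted R n)
    (eta : M -> 'rV[R]_n -> R) (v : 'rV[R]_n) (a : M) (x : 'rV[R]_n) : R^o :=
  eta (param a x) (v *m frame a x).

Definition loc_bil (R : realType) (n : nat) (M : charted R n)
    (g : M -> 'M[R]_n) (a : M) (x : 'rV[R]_n) : 'M[R]_n :=
  frame a x *m g (param a x) *m (frame a x)^T.

Definition loc_end (R : realType) (n : nat) (M : charted R n)
    (J : M -> 'M[R]_n) (a : M) (x : 'rV[R]_n) : 'M[R]_n :=
  frame a x *m J (param a x) *m invmx (frame a x).

Definition smooth_field_on (R : realType) (n : nat) (M : charted R n)
    (W : normedModType R) (U : set M) (L : M -> 'rV[R]_n -> W) : Prop :=
  forall a : M, smooth_on (chart a @` (cdom a `&` U)) (L a).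

Definition one_form (R : realType) (n : nat) (M : charted R n)
    (eta : M -> 'rV[R]_n -> R) : Prop :=
  (forall (a : M) (c : R) (u v : 'rV[R]_n),
     eta a (c *: u + v) = c * eta a u + eta a v)
  /\ forall v, smooth_field_on setT (loc_form eta v).

Definition fun_d (R : realType) (n : nat) (M : charted R n)
    (f : M -> R) (a : M) (u : 'rV[R]_n) : R :=
  'D_u (loc_fun f a) (chart a a).

(* d eta (u, v) = u (eta v) - v (eta u) - eta [u, v], where u and v are
   extended with constant coefficients in the chart at a; no factor 1/2. *)
Definition ext_d (R : realType) (n : nat) (M : charted R n)
    (eta : M -> 'rV[R]_n -> R) (a : M) (u v : 'rV[R]_n) : R :=
  'D_u (loc_form eta v a) (chart a a) - 'D_v (loc_form eta u a) (chart a a).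

(* Lie derivatives in the direction of Z, of a field of bilinear forms and of
   a field of endomorphisms (the latter acting on the vector v). *)
Definition lie_bil (R : realType) (n : nat) (M : charted R n)
    (Z : M -> 'rV[R]_n) (g : M -> 'M[R]_n) (a : M) (u v : 'rV[R]_n) : R :=
  bil ('D_(Z a) (loc_bil g a) (chart a a)) u v
  + bil (g a) ('D_u (loc_vec Z a) (chart a a)) v
  + bil (g a) u ('D_v (loc_vec Z a) (chart a a)).

Definition lie_end (R : realType) (n : nat) (M : charted R n)
    (Z : M -> 'rV[R]_n) (J : M -> 'M[R]_n) (a : M) (v : 'rV[R]_n) : 'rV[R]_n :=
  v *m 'D_(Z a) (loc_end J a) (chart a a)
  - 'D_(v *m J a) (loc_vec Z a) (chart a a)
  + 'D_v (loc_vec Z a) (chart a a) *m J a.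

Record pseudo_riemannian (R : realType) (n : nat) (M : charted R n)
    (g : M -> 'M[R]_n) : Prop := {
  metric_sym : forall a, (g a)^T = g a;
  metric_nondeg : forall a, g a \in unitmx;
  metric_smooth : smooth_field_on setT (loc_bil g) }.

(* There is an orthonormal basis (the rows of B) with p positive and q
   negative vectors. *)
Definition has_signature (R : realType) (n : nat) (G : 'M[R]_n) (p q : nat)
    : Prop :=
  (p + q)%N = n
  /\ exists2 B : 'M[R]_n, B \in unitmx
       & B *m G *m B^T = diag_mx (\row_i (if (i < p)%N then 1 else -1)).

(* For the Christoffel symbols Gamma of the metric G on R^n, this is the
   matrix C with v *m C = Gamma (u, v), i.e.
   2 G (Gamma (u, v), w) =
     (D_u G) (v, w) + (D_v G) (u, w) - (D_w G) (u, v). *)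
Definition christoffel (R : realType) (n : nat) (G : 'rV[R]_n -> 'M[R]_n)
    (u x : 'rV[R]_n) : 'M[R]_n :=
  2^-1 *: ('D_u G x
           + \matrix_(i, j) ((u *m 'D_(delta_mx ord0 i) G x) ord0 j
                             - (u *m 'D_(delta_mx ord0 j) G x) ord0 i))
  *m invmx (G x).

Definition nabla_vec (R : realType) (n : nat) (M : charted R n)
    (g : M -> 'M[R]_n) (X : M -> 'rV[R]_n) (a : M) (u : 'rV[R]_n)
    : 'rV[R]_n :=
  'D_u (loc_vec X a) (chart a a)
  + X a *m christoffel (loc_bil g a) u (chart a a).

Definition nabla_end (R : realType) (n : nat) (M : charted R n)
    (g : M -> 'M[R]_n) (J : M -> 'M[R]_n) (a : M) (u : 'rV[R]_n)
    : 'M[R]_n :=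
  let C := christoffel (loc_bil g a) u (chart a a) in
  'D_u (loc_end J a) (chart a a) + J a *m C - C *m J a.

(* The curvature operator of (u, v), acting on row vectors. *)
Definition curvature (R : realType) (n : nat) (M : charted R n)
    (g : M -> 'M[R]_n) (a : M) (u v : 'rV[R]_n) : 'M[R]_n :=
  let C := christoffel (loc_bil g a) in
  let x := chart a a in
  'D_u (C v) x - 'D_v (C u) x + C v x *m C u x - C u x *m C v x.

(* J1 J2 = J3 = - J2 J1, with all Ji almost complex and g-skew. *)
Record hermitian_triple (R : realType) (n : nat) (g J1 J2 J3 : 'M[R]_n)
    : Prop := {
  triple_sq1 : J1 *m J1 = - 1%:M;
  triple_sq2 : J2 *m J2 = - 1%:M;
  triple_sq3 : J3 *m J3 = - 1%:M;
  triple_12 : J2 *m J1 = J3;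
  triple_21 : J1 *m J2 = - J3;
  triple_skew1 : forall u v, bil g (u *m J1) v = - bil g u (v *m J1);
  triple_skew2 : forall u v, bil g (u *m J2) v = - bil g u (v *m J2);
  triple_skew3 : forall u v, bil g (u *m J3) v = - bil g u (v *m J3) }.

Record pseudo_hyper_kahler (R : realType) (n : nat) (M : charted R n)
    (g J1 J2 J3 : M -> 'M[R]_n) : Prop := {
  hk_metric : pseudo_riemannian g;
  hk_smooth1 : smooth_field_on setT (loc_end J1);
  hk_smooth2 : smooth_field_on setT (loc_end J2);
  hk_smooth3 : smooth_field_on setT (loc_end J3);
  hk_triple : forall a, hermitian_triple (g a) (J1 a) (J2 a) (J3 a);
  hk_parallel1 : forall a u, nabla_end g J1 a u = 0;
  hk_parallel2 : forall a u, nabla_end g J2 a u = 0;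
  hk_parallel3 : forall a u, nabla_end g J3 a u = 0 }.

Definition kahler_form (R : realType) (n : nat) (M : charted R n)
    (g J : M -> 'M[R]_n) (a : M) (u v : 'rV[R]_n) : R :=
  bil (g a) (u *m J a) v.

Record conical_pseudo_hyper_kahler (R : realType) (n : nat) (M : charted R n)
    (g J1 J2 J3 : M -> 'M[R]_n) (xi : M -> 'rV[R]_n) : Prop := {
  conical_hk : pseudo_hyper_kahler g J1 J2 J3;
  conical_smooth : smooth_field_on setT (loc_vec xi);
  conical_neq0 : forall a, bil (g a) (xi a) (xi a) != 0;
  conical_nabla : forall a u, nabla_vec g xi a u = u }.

Definition span3 (R : realType) (n : nat) (A1 A2 A3 : 'M[R]_n)
    : set 'M[R]_n :=
  [set A | exists c1 c2 c3 : R, A = c1 *: A1 + c2 *: A2 + c3 *: A3].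

(* In dimension 4, parallelism of Q is no restriction, and one requires
   instead that Q annihilates the curvature tensor. *)
Record quaternionic_pseudo_kahler (R : realType) (n : nat) (M : charted R n)
    (g : M -> 'M[R]_n) (Q : M -> set 'M[R]_n) : Prop := {
  qk_metric : pseudo_riemannian g;
  qk_local : forall a : M,
    exists (U : set M) (I1 I2 I3 : M -> 'M[R]_n),
      [/\ open U /\ U a,
          [/\ smooth_field_on U (loc_end I1), smooth_field_on U (loc_end I2)
            & smooth_field_on U (loc_end I3)]
        & forall x, U x ->
          [/\ hermitian_triple (g x) (I1 x) (I2 x) (I3 x),
              Q x = span3 (I1 x) (I2 x) (I3 x)
            & forall u, [/\ Q x (nabla_end g I1 x u),
                Q x (nabla_end g I2 x u) & Q x (nabla_end g I3 x u)]]];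
  qk_dim4 : n = 4%N -> forall (a : M) (A : 'M[R]_n), Q a A ->
    forall u v : 'rV[R]_n,
      curvature g a u v *m A - A *m curvature g a u v
      - curvature g a (u *m A) v - curvature g a u (v *m A) = 0 }.

(* The circle is R / 2 pi Z, with t acting as exp(i t). *)
Record circle_bundle (R : realType) (n m : nat)
    (P : charted R m) (M : charted R n) (proj : P -> M) (act : R -> P -> P)
    : Prop := {
  act0 : forall p, act 0 p = p;
  actD : forall s t p, act (s + t) p = act s (act t p);
  act_period_free : forall t p,
    act t p = p <-> exists k : int, t = k%:~R * (2 * pi);
  act_smooth : smooth_map_on setT
    (fun x : prod_charted (line R) P => act x.1 x.2 : P);
  proj_smooth : smooth_map_on setT proj;
  proj_surj : forall x, exists p, proj p = x;
  proj_fiber : forall p p', proj p = proj p' <-> exists t, p' = act t p;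
  (* the section sigma and the circle-valued map (c, s) give the equivariant
     diffeomorphism proj^-1 U = U x S^1 *)
  bundle_trivial : forall x, exists (U : set M) (sigma : M -> P) (c s : P -> R),
    [/\ open U /\ U x,
        smooth_map_on U sigma,
        smooth_field_on (proj @^-1` U) (loc_fun c),
        smooth_field_on (proj @^-1` U) (loc_fun s)
      & forall y, U y -> proj (sigma y) = y
          /\ forall t, c (act t (sigma y)) = cos t
                    /\ s (act t (sigma y)) = sin t] }.

Definition fundamental_field (R : realType) (m : nat) (P : charted R m)
    (act : R -> P -> P) (p : P) : 'rV[R]_m :=
  'D_(1 : R^o) (fun t : R^o => chart p (act t p) : 'rV[R]_m) (0 : R^o).

Record principal_connection (R : realType) (m : nat) (P : charted R m)
    (act : R -> P -> P) (eta : P -> 'rV[R]_m -> R) : Prop := {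
  connection_form : one_form eta;
  connection_invariant : forall t p v,
    eta (act t p) (v *m tangent (act t) p) = eta p v;
  connection_vertical : forall p, eta p (fundamental_field act p) = 1 }.

Definition quat (R : realType) (a b c d : R) : 'rV[R]_4 :=
  \row_(i < 4) [:: a; b; c; d]`_i.

Definition qc (R : realType) (k : nat) (x : 'rV[R]_4) : R := x ord0 (inord k).

Definition qmul (R : realType) (x y : 'rV[R]_4) : 'rV[R]_4 :=
  quat
    (qc 0 x * qc 0 y - qc 1 x * qc 1 y - qc 2 x * qc 2 y - qc 3 x * qc 3 y)
    (qc 0 x * qc 1 y + qc 1 x * qc 0 y + qc 2 x * qc 3 y - qc 3 x * qc 2 y)
    (qc 0 x * qc 2 y - qc 1 x * qc 3 y + qc 2 x * qc 0 y + qc 3 x * qc 1 y)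
    (qc 0 x * qc 3 y + qc 1 x * qc 2 y - qc 2 x * qc 1 y + qc 3 x * qc 0 y).

Definition qnorm2 (R : realType) (x : 'rV[R]_4) : R :=
  qc 0 x ^+ 2 + qc 1 x ^+ 2 + qc 2 x ^+ 2 + qc 3 x ^+ 2.

Definition qinv (R : realType) (x : 'rV[R]_4) : 'rV[R]_4 :=
  (qnorm2 x)^-1 *: quat (qc 0 x) (- qc 1 x) (- qc 2 x) (- qc 3 x).

Definition Hstar (R : realType) : charted R 4 := punctured R 4.

(* Tangent vectors of H^* x P are row_mx of a quaternion and of a tangent
   vector of P. *)

(* theta = f^-1 (theta_1^P i + theta_2^P j + theta_3^P k) *)
Definition theta (R : realType) (n m : nat) (M : charted R n) (P : charted R m)
    (g J2 J3 : M -> 'M[R]_n) (Z : M -> 'rV[R]_n) (f : M -> R)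
    (proj : P -> M) (eta : P -> 'rV[R]_m -> R)
    (p : P) (v : 'rV[R]_m) : 'rV[R]_4 :=
  let x := proj p in
  let w := v *m tangent proj p in
  (f x)^-1 *: quat 0
    (eta p v + 2^-1 * bil (g x) (Z x) w)
    (2^-1 * kahler_form g J3 x (Z x) w)
    (- (2^-1 * kahler_form g J2 x (Z x) w)).

(* The quaternion-valued one-form dq q^-1 + q theta q^-1, whose imaginary
   components are theta-tilde_1, theta-tilde_2 and theta-tilde_3. *)
Definition theta_tilde (R : realType) (m : nat) (P : charted R m)
    (th : P -> 'rV[R]_m -> 'rV[R]_4)
    (x : prod_charted (Hstar R) P) (w : 'rV[R]_(4 + m)) : 'rV[R]_4 :=
  let q : 'rV[R]_4 := set_val x.1 in
  qmul (lsubmx w) (qinv q) + qmul (qmul q (th x.2 (rsubmx w))) (qinv q).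

(* d (rho^2 f theta-tilde_k), where fP is the pullback of f to P *)
Definition omega_tilde (R : realType) (m : nat) (P : charted R m)
    (fP : P -> R) (th : P -> 'rV[R]_m -> 'rV[R]_4) (k : nat)
    (x : prod_charted (Hstar R) P) (u v : 'rV[R]_(4 + m)) : R :=
  ext_d (fun (y : prod_charted (Hstar R) P) w =>
           qnorm2 (set_val y.1) * fP y.2 * qc k (theta_tilde th y w)) x u v.

(* V_1 = e_1^L - Z_1 with Z_1 = Ztilde + f_1 X_P *)
Definition V1 (R : realType) (m : nat) (P : charted R m)
    (act : R -> P -> P) (Ztilde : P -> 'rV[R]_m) (f1P : P -> R)
    (x : prod_charted (Hstar R) P) : 'rV[R]_(4 + m) :=
  row_mx (qmul (set_val x.1) (quat 0 1 0 0))
    (- (Ztilde x.2 + f1P x.2 *: fundamental_field act x.2)).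

(* rho d/d rho on H^* *)
Definition radial (R : realType) (m : nat) (P : charted R m)
    (x : prod_charted (Hstar R) P) : 'rV[R]_(4 + m) :=
  row_mx (set_val x.1) 0.

Definition quat_distribution (R : realType) (n : nat) (N : charted R n)
    (J1 J2 J3 : N -> 'M[R]_n) (xi : N -> 'rV[R]_n) (x : N) : set 'rV[R]_n :=
  [set w | exists c0 c1 c2 c3 : R,
     w = c0 *: xi x + c1 *: (xi x *m J1 x) + c2 *: (xi x *m J2 x)
         + c3 *: (xi x *m J3 x)].

Definition orthogonal_to (R : realType) (n : nat) (G : 'M[R]_n)
    (D : set 'rV[R]_n) : set 'rV[R]_n :=
  [set u | forall w, D w -> bil G u w = 0].

(* (B, gB, Q), with projection pr : U -> B, is the space of leaves of the
   distribution spanned by xi, J1 xi, J2 xi, J3 xi on the open set U, together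
   with the induced quaternionic pseudo-Kähler structure. *)
Record quaternionic_quotient (R : realType) (n m : nat)
    (N : charted R n) (g J1 J2 J3 : N -> 'M[R]_n) (xi : N -> 'rV[R]_n)
    (B : charted R m) (gB : B -> 'M[R]_m) (Q : B -> set 'M[R]_m)
    (U : set N) (pr : N -> B) : Prop := {
  qq_open : open U;
  qq_leaves : is_quotient_map U
    (joined U (quat_distribution J1 J2 J3 xi)) pr;
  qq_kahler : quaternionic_pseudo_kahler gB Q;
  qq_metric : exists2 c : R, 0 < c & forall x, U x ->
    forall u v,
      orthogonal_to (g x) (quat_distribution J1 J2 J3 xi x) u ->
      orthogonal_to (g x) (quat_distribution J1 J2 J3 xi x) v ->
      bil (gB (pr x)) (u *m tangent pr x) (v *m tangent pr x)
      = c * (`|bil (g x) (xi x) (xi x)|^-1 * bil (g x) u v);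
  qq_structure : forall x, U x -> forall A : 'M[R]_m,
    Q (pr x) A <-> exists2 J, span3 (J1 x) (J2 x) (J3 x) J & forall u,
      orthogonal_to (g x) (quat_distribution J1 J2 J3 xi x) u ->
      u *m tangent pr x *m A = u *m J *m tangent pr x }.

(* Main.v *)
Require Import Defs.
From HB Require Import structures.
From mathcomp Require Import all_boot all_order all_algebra.
From mathcomp Require Import all_classical all_reals all_analysis.
From mathcomp Require Import ring lra.

Set Implicit Arguments.
Unset Strict Implicit.
Unset Printing Implicit Defensive.

Import Order.TTheory GRing.Theory Num.Theory numFieldNormedType.Exports.
Local Open Scope classical_set_scope.
Local Open Scope ring_scope.

(* At a point (q, p) of H^* x P over x in M, put theta^P = f theta. Since
   d theta_alpha^P = omega_alpha (for alpha = 2, 3 this is Cartan's formula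
   together with L_Z J_3 = 2 J_2, which follows from L_Z J_1 = 0, that is, from
   ddf = 0), the forms omega~ = d (f Im (dq qbar) + q theta^P qbar) are given by
   an explicit polynomial in q, and their common kernel is spanned by V_1.
   Modulo V_1 the tangent space splits into the quaternionic fibre, spanned by
   the projections to Mhat of vectors tangent to H^*, and a complement
   identified with T_x M; the three forms are block diagonal. A
   hyper-Hermitian metric is an algebraic function of its three Kähler forms,
   so ghat is block diagonal as well, and up to the factor |q|^2 its horizontal
   block is g on the orthogonal complement of the quaternionic line of Z and is
   multiplied by f / f_1 on Z and by f_1 / f on J_1 Z, J_2 Z, J_3 Z. Thus the
   signature changes exactly when f_1 f < 0, and then along four vectors of the
   same sign, that of g (Z, Z) = 2 (f - f_1). *)

(** * Schwarz's theorem *)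

(** The metric [ghat] is given only through its Kähler forms pulled back to [H^* x P], so its
    signature cannot be read off directly. Hence an explicit metric with an explicit triple is built
    on [R^4 x T_x M] whose forms are these pullbacks, and the identity [G = W2 W1^-1 W3] forces
    [ghat] to be this model. The quotient map and the projection to the model get the same kernel
    from nondegeneracy and equality of dimensions alone. In the left trivialisation of [H^*] the
    forms at [q] are mixed by [Ad_q], so the triples are compared after a rotation scaled by
    [|q|^2]. Since [Z], [J_1 Z], [J_2 Z], [J_3 Z] are orthogonal, the horizontal metric arises from
    [g] by four rank-one changes that do not interfere with each other. Schwarz's theorem enters
    twice: [d] commutes with pullbacks, and [ddf = 0]. A point of [Mbar] lies over some point of [M]
    that cannot be prescribed; connectedness of [M] carries the signs of [f] and [f_1] there. *)

Lemma derive_line (R : realType) (V W : normedModType R) (f : V -> W)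
    (y u : V) (s : R) :
  differentiable f (y + s *: u) ->
  is_derive (s : R^o) (1 : R^o) (fun r : R^o => f (y + r *: u))
    ('D_u f (y + s *: u)).
Proof.
move=> df.
have dl : is_diff (s : R^o) (fun r : R^o => y + r *: u) (fun r : R^o => r *: u).
  apply: is_diff_eq; rewrite -[X in X = _]/(0 + _); exact: add0r.
have dc : is_diff (s : R^o) (fun r : R^o => f (y + r *: u))
    (fun r : R^o => 'd f (y + s *: u) (r *: u)).
  exact: (is_diff_comp dl (differentiableP df)).
apply: DeriveDef; first by apply: diff_derivable.
by rewrite deriveE // diff_val scale1r deriveE.
Qed.

Lemma dir_MVT (R : realType) (V : normedModType R) (f : V -> R^o)
    (y u : V) (h : R) : 0 < h ->
  (forall s, 0 <= s <= h -> differentiable f (y + s *: u)) ->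
  exists2 c, 0 < c < h & f (y + h *: u) - f y = 'D_u f (y + c *: u) * h.
Proof.
move=> h0 df.
have := @MVT R (fun r => f (y + r *: u)) (fun s => 'D_u f (y + s *: u)) 0 h h0.
case.
- move=> s; rewrite in_itv /= => /andP[s0 sh].
  by apply: derive_line; apply: df; rewrite !ltW.
- apply: continuous_in_subspaceT => s; rewrite inE /= in_itv /= => sh.
  apply: differentiable_continuous; apply/derivable1_diffP.
  have := df _ sh; move/derive_line => H; exact: ex_derive.
- by move=> c; rewrite in_itv /= => ch; rewrite scale0r addr0 subr0; exists c.
Qed.

Lemma near_square (R : realType) (V : normedModType R) (x u v : V)
    (P : set V) : (\forall y \near x, P y) ->
  exists2 h : R, 0 < h &
    forall s t, 0 <= s <= h -> 0 <= t <= h -> P (x + s *: u + t *: v).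
Proof.
move=> /nbhs_normP[d /= d0 dP].
have k0 : 0 < `|u| + `|v| + 1 by rewrite ltr_wpDl // addr_ge0.
(* The summand 1 keeps the denominator positive when [u = v = 0]. *)
exists (d / 2 / (`|u| + `|v| + 1)); first by rewrite !divr_gt0.
move=> s t /andP[s0 sh] /andP[t0 th]; apply: dP => /=.
rewrite -addrA opprD addrA subrr add0r normrN.
apply: le_lt_trans (_ : d / 2 < d); last lra.
apply: le_trans (ler_normD _ _) _; rewrite !normrZ !ger0_norm //.
apply: le_trans (_ : d / 2 / (`|u| + `|v| + 1) * (`|u| + `|v|) <= _).
  by rewrite mulrDr lerD // ler_wpM2r.
rewrite -[leRHS](divfK (lt0r_neq0 k0)).
by rewrite ler_wpM2l ?divr_ge0 ?ltW // ltrDl.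
Qed.

Lemma second_difference (R : realType) (V : normedModType R) (f : V -> R^o)
    (x u v : V) (h : R) : 0 < h ->
  (forall s t, 0 <= s <= h -> 0 <= t <= h ->
     differentiable f (x + s *: u + t *: v)) ->
  (forall s t, 0 <= s <= h -> 0 <= t <= h ->
     differentiable (fun z => 'D_u f z : R^o) (x + s *: u + t *: v)) ->
  exists c d, [/\ 0 <= c <= h, 0 <= d <= h &
    f (x + h *: u + h *: v) - f (x + h *: u) - (f (x + h *: v) - f x)
    = 'D_v (fun z => 'D_u f z : R^o) (x + c *: u + d *: v) * h * h].
Proof.
move=> h0 df dfu.
have hh : 0 <= h <= h by rewrite lexx ltW.
have z0 : 0 <= (0 : R) <= h by rewrite lexx ltW.
(* The second difference of [f] is a first difference of [g] along [u]; the mean value theorem is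
   then used again, for ['D_u f] along [v]. *)
pose g := fun y => f (y + h *: v) - f y : R^o.
have dg s : 0 <= s <= h -> is_diff (x + s *: u) g
   (fun w => 'd f (x + s *: u + h *: v) w - 'd f (x + s *: u) w).
  move=> sh; apply: is_diffB; last first.
    by apply: differentiableP; have := df s 0 sh z0; rewrite scale0r addr0.
  have dsh : is_diff (x + s *: u) (fun y => y + h *: v) id.
    by apply: is_diff_eq; rewrite addr0.
  exact: (is_diff_comp dsh (differentiableP (df s h sh hh))).
have [c /andP[c0 ch] Ec] :=
  @dir_MVT _ _ g x u h h0 (fun s sh => @ex_diff _ _ _ _ _ _ _ (dg s sh)).
have cb : 0 <= c <= h by rewrite !ltW.
have Dg : 'D_u g (x + c *: u) =
   'D_u f (x + c *: u + h *: v) - 'D_u f (x + c *: u).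
  rewrite deriveE; last by have := dg _ cb; move/@ex_diff.
  rewrite (@diff_val _ _ _ _ _ _ _ (dg _ cb)) !deriveE //.
    by have := df c 0 cb z0; rewrite scale0r addr0.
  exact: df.
have [d /andP[d0 dh] Ed] := dir_MVT h0 (fun s sh => dfu c s cb sh).
exists c, d; split => //; first by rewrite !ltW.
by rewrite -Ed -Dg -Ec.
Qed.

Lemma dist_lt_double (R : realType) (e x y z : R) :
  `|x - z| < e -> `|y - z| < e -> `|x - y| < e + e.
Proof.
by move=> xz yz; rewrite (le_lt_trans (ler_distD z x y)) // ltrD // distrC.
Qed.

(* Schwarz: both mixed derivatives are limits of the second difference
   quotient over the parallelogram with sides [h u] and [h v]. *)
Lemma derive_comm (R : realType) (V : normedModType R) (f : V -> R^o)
    (x u v : V) :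
  (\forall y \near x, differentiable f y) ->
  (\forall y \near x, differentiable (fun z => 'D_u f z : R^o) y) ->
  (\forall y \near x, differentiable (fun z => 'D_v f z : R^o) y) ->
  {for x, continuous (fun y => 'D_v (fun z => 'D_u f z : R^o) y : R^o)} ->
  {for x, continuous (fun y => 'D_u (fun z => 'D_v f z : R^o) y : R^o)} ->
  'D_v (fun z => 'D_u f z : R^o) x = 'D_u (fun z => 'D_v f z : R^o) x.
Proof.
move=> df dfu dfv cA cB.
set A := fun y => 'D_v _ y : R^o in cA *.
set B := fun y => 'D_u _ y : R^o in cB *.
rewrite -[LHS]/(A x) -[RHS]/(B x).
apply/eqP; rewrite -subr_eq0 -normr_le0 leNgt; apply/negP => AB.
set e := `|A x - B x| / 2; have e0 : 0 < e by rewrite divr_gt0.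
have nA : \forall y \near x, `|A x - A y| < e.
  by move/cvgrPdist_lt : cA; apply.
have nB : \forall y \near x, `|B x - B y| < e.
  by move/cvgrPdist_lt : cB; apply.
have [h h0 H] :=
  near_square u v (filterI (filterI df (filterI dfu dfv)) (filterI nA nB)).
have [c [d [cb db EA]]] : exists c d, [/\ 0 <= c <= h, 0 <= d <= h &
    f (x + h *: u + h *: v) - f (x + h *: u) - (f (x + h *: v) - f x)
    = A (x + c *: u + d *: v) * h * h].
  apply: second_difference => // s t sh th; first by have [[]] := H s t sh th.
  by have [[_ []]] := H s t sh th.
have [d' [c' [db' cb' EB]]] : exists d' c', [/\ 0 <= d' <= h, 0 <= c' <= h &
    f (x + h *: v + h *: u) - f (x + h *: v) - (f (x + h *: u) - f x)
    = B (x + d' *: v + c' *: u) * h * h].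
  apply: second_difference => // s t sh th; rewrite addrAC.
    by have [[]] := H t s th sh.
  by have [[_ []]] := H t s th sh.
have yA : `|A x - A (x + c *: u + d *: v)| < e by have [_ []] := H c d cb db.
have zB : `|B x - B (x + d' *: v + c' *: u)| < e.
  by rewrite [x + _ + _]addrAC; have [_ []] := H c' d' cb' db'.
(* The second difference is symmetric in [u] and [v], so the two mean values agree once [h] has been
   cancelled twice. *)
have hAB : A (x + c *: u + d *: v) = B (x + d' *: v + c' *: u).
  move: EA EB; rewrite [x + h *: v + _]addrAC.
  move: (A _) (B _) (f _) (f _) (f _) (f _) => a b p q r s Ea Eb.
  apply: (@mulIf R h); first exact: lt0r_neq0.
  apply: (@mulIf R h); first exact: lt0r_neq0.
  apply: etrans (esym Ea) _; apply: etrans _ Eb.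
  by rewrite !opprD [LHS]addrACA.
rewrite hAB in yA.
have := dist_lt_double yA zB.
by rewrite /e -splitr ltxx.
Qed.

(** * Smooth maps and matrix-valued derivatives *)

Section smooth.
Context {R : realType}.

(** Near [x] both maps have the same remainder, so ['d f x] also approximates [g]; uniqueness of the
    differential identifies it with ['d g x], which is therefore continuous. *)
Lemma near_eq_differentiable (V W : normedModType R) (f g : V -> W) x :
  (\forall y \near x, f y = g y) -> differentiable f x -> differentiable g x.
Proof.
move=> fg df.
have key : g \o shift x = cst (g x) + 'd f x +o_ 0 id.
  apply/eqaddoP => e e0.
  have [_ /eqaddoP/(_ _ e0) H] := (diff_locallyP x f).1 df.
  have fg0 : \forall y \near 0, f (y + x) = g (y + x).
    by move: (fg); rewrite (near_shift 0 x) subr0.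
  near=> y.
  rewrite [X in `|X|](_ : _ = (f \o shift x - (cst (f x) + 'd f x)) y).
    by near: y.
  rewrite !fctE /= /cst (near fg0 y) //.
  by rewrite (nbhs_singleton fg).
have E := diff_unique (diff_continuous df) key.
apply/diff_locallyP; split; last by rewrite E.
by rewrite E; exact: diff_continuous.
Unshelve. all: by end_near. Qed.

(** Openness turns agreement on [U] into agreement near each of its points, which is what
    derivatives depend on. *)
Lemma Ck_ext (V W : normedModType R) k (U : set V) (f g : V -> W) :
  open U -> (forall x, U x -> f x = g x) -> Ck k U f -> Ck k U g.
Proof.
move=> oU; elim: k f g => [|k IH] f g fg /=.
  move=> cf x Ux; have := cf x Ux; rewrite /prop_for /continuous_at fg //.
  apply: cvg_trans; apply: near_eq_cvg.
  by near do apply: fg; exact: open_nbhs_nbhs.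
have nU x : U x -> \forall y \near x, f y = g y.
  by move=> Ux; near do apply: fg; exact: open_nbhs_nbhs.
move=> [df Df]; split=> [x Ux|v].
  by apply: near_eq_differentiable (df x Ux); exact: nU.
apply: IH (Df v) => x Ux; apply: near_eq_derive; exact: nU.
Unshelve. all: by end_near. Qed.

Lemma smooth_differentiable (V W : normedModType R) (U : set V) (f : V -> W) x :
  smooth_on U f -> U x -> differentiable f x.
Proof. by move=> /(_ 1%N)[df _]; exact: df. Qed.

Lemma smooth_derive (V W : normedModType R) (U : set V) (f : V -> W) v :
  smooth_on U f -> smooth_on U (fun x => 'D_v f x).
Proof. by move=> sf k; have [_ +] := sf k.+1; apply. Qed.

Lemma differentiable_mx (V : normedModType R) m n (A : V -> 'M[R]_(m, n)) x :
  (forall i j, differentiable (fun y => A y i j : R^o) x) ->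
  differentiable A x.
Proof.
move=> dA.
have -> : A = (\sum_(i < m) \sum_(j < n)
    (fun y => (A y i j : R^o) *: (delta_mx i j : 'M[R]_(m, n)))).
  apply/funext => y; rewrite {1}(matrix_sum_delta (A y)) fct_sumE.
  by apply: eq_bigr => i _; rewrite fct_sumE.
apply: differentiable_sum => i; apply: differentiable_sum => j.
exact: differentiableZl.
Qed.

Lemma differentiable_entry (V : normedModType R) m n (A : V -> 'M[R]_(m, n))
    x i j :
  differentiable A x -> differentiable (fun y => A y i j : R^o) x.
Proof.
move=> dA.
apply: (@differentiable_comp _ _ _ _ A (fun B : 'M[R]_(m, n) => B i j : R^o)) => //.
exact: differentiable_coord.
Qed.

Lemma derive_entry (V : normedModType R) m n (A : V -> 'M[R]_(m, n)) x v i j :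
  differentiable A x -> ('D_v A x) i j = 'D_v (fun y => A y i j : R^o) x.
Proof. by move=> dA; rewrite derive_mx ?mxE //; exact: diff_derivable. Qed.

Lemma smooth_entry (V : normedModType R) m n (A : V -> 'M[R]_(m, n))
    (U : set V) i j :
  open U -> smooth_on U A -> smooth_on U (fun y => A y i j : R^o).
Proof.
move=> oU sA k; elim: k A sA => [|k IH] A sA /=.
  move=> x Ux; apply: differentiable_continuous.
  exact: differentiable_entry (smooth_differentiable sA Ux).
split=> [x Ux|v].
  exact: differentiable_entry (smooth_differentiable sA Ux).
apply: Ck_ext (IH _ (smooth_derive v sA)) => // x Ux.
exact: derive_entry (smooth_differentiable sA Ux).
Qed.

Lemma smooth_derive_comm (V : normedModType R) (f : V -> R^o)
    (U : set V) x u v :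
  open U -> U x -> smooth_on U f ->
  'D_v (fun y => 'D_u f y : R^o) x = 'D_u (fun y => 'D_v f y : R^o) x.
Proof.
move=> oU Ux sf.
have nU : \forall y \near x, U y by exact: open_nbhs_nbhs.
apply: derive_comm.
- by near do apply: (smooth_differentiable sf).
- by near do apply: (smooth_differentiable (smooth_derive u sf)).
- by near do apply: (smooth_differentiable (smooth_derive v sf)).
- apply: differentiable_continuous; apply: smooth_differentiable Ux.
  exact: smooth_derive (smooth_derive u sf).
- apply: differentiable_continuous; apply: smooth_differentiable Ux.
  exact: smooth_derive (smooth_derive v sf).
Unshelve. all: by end_near. Qed.

Lemma smooth_derive_comm_mx (V : normedModType R) m n (A : V -> 'M[R]_(m, n))
    (U : set V) x u v :
  open U -> U x -> smooth_on U A ->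
  'D_v (fun y => 'D_u A y) x = 'D_u (fun y => 'D_v A y) x.
Proof.
move=> oU Ux sA.
have D w i j y : U y -> 'D_w A y i j = 'D_w (fun z => A z i j : R^o) y.
  by move=> Uy; exact: derive_entry (smooth_differentiable sA Uy).
have D2 w w' i j : 'D_w (fun z => 'D_w' A z i j : R^o) x =
    'D_w (fun z => 'D_w' (fun t => A t i j : R^o) z : R^o) x.
  by apply: near_eq_derive; near do apply: D; exact: open_nbhs_nbhs.
have dD w : differentiable (fun y => 'D_w A y) x.
  exact: smooth_differentiable (smooth_derive _ sA) Ux.
apply/matrixP => i j.
apply: etrans (derive_entry v i j (dD u)) _.
apply: etrans _ (esym (derive_entry u i j (dD v))).
apply: etrans (D2 v u i j) _; apply: etrans _ (esym (D2 u v i j)).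
exact: smooth_derive_comm (smooth_entry _ _ oU sA).
Unshelve. all: by end_near. Qed.

Lemma differentiable_mulmx (V : normedModType R) m n p
    (A : V -> 'M[R]_(m, n)) (B : V -> 'M[R]_(n, p)) x :
  differentiable A x -> differentiable B x ->
  differentiable (fun y => A y *m B y) x.
Proof.
move=> dA dB; apply: differentiable_mx => i j.
rewrite (_ : (fun _ => _) = \sum_k (fun y => A y i k * B y k j : R^o)).
  apply: differentiable_sum => k.
  by apply: differentiableM; exact: differentiable_entry.
by apply/funext => y; rewrite mxE fct_sumE.
Qed.

Lemma derive_mulmx (V : normedModType R) m n p
    (A : V -> 'M[R]_(m, n)) (B : V -> 'M[R]_(n, p)) x v :
  differentiable A x -> differentiable B x ->
  'D_v (fun y => A y *m B y) x = 'D_v A x *m B x + A x *m 'D_v B x.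
Proof.
move=> dA dB; apply/matrixP => i j.
rewrite derive_entry; last exact: differentiable_mulmx.
rewrite (_ : (fun _ => _) = \sum_k (fun y => A y i k * B y k j : R^o)); last first.
  by apply/funext => y; rewrite mxE fct_sumE.
rewrite derive_sum => [|k]; last first.
  apply: diff_derivable.
  by apply: differentiableM; exact: differentiable_entry.
rewrite !mxE -big_split /=; apply: eq_bigr => k _.
rewrite !derive_entry // deriveM; last 2 first.
- by apply: diff_derivable; exact: differentiable_entry.
- by apply: diff_derivable; exact: differentiable_entry.
by rewrite addrC /GRing.scale /= [B x k j * _]mulrC.
Qed.

Lemma differentiable_trmx (V : normedModType R) m n
    (A : V -> 'M[R]_(m, n)) x :
  differentiable A x -> differentiable (fun y => (A y)^T) x.
Proof.
move=> dA; apply: differentiable_mx => i j.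
rewrite (_ : (fun _ => _) = (fun y => A y j i : R^o)).
  exact: differentiable_entry.
by apply/funext => y; rewrite mxE.
Qed.

Lemma derive_trmx (V : normedModType R) m n (A : V -> 'M[R]_(m, n)) x v :
  differentiable A x -> 'D_v (fun y => (A y)^T) x = ('D_v A x)^T.
Proof.
move=> dA; apply/matrixP => i j.
rewrite derive_entry ?mxE ?derive_entry //; last exact: differentiable_trmx.
by congr ('D_v _ x); apply/funext => y; rewrite mxE.
Qed.

Lemma rV_mulmx_inj m n (A B : 'M[R]_(m, n)) :
  (forall v : 'rV_m, v *m A = v *m B) -> A = B.
Proof. by move=> AB; apply/row_matrixP => i; rewrite !rowE. Qed.

Lemma jacobian_comp n m p (f : 'rV[R]_n -> 'rV[R]_m)
    (h : 'rV[R]_m -> 'rV[R]_p) x :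
  differentiable f x -> differentiable h (f x) ->
  'J (h \o f) x = 'J f x *m 'J h (f x).
Proof.
move=> df dh; apply: rV_mulmx_inj => v; rewrite mulmxA.
by rewrite /jacobian !mul_rV_lin1 diff_comp.
Qed.

Lemma near_eq_jacobian n m (f h : 'rV[R]_n -> 'rV[R]_m) x :
  (\forall y \near x, f y = h y) -> differentiable f x -> 'J f x = 'J h x.
Proof.
move=> fh df; have dh := near_eq_differentiable fh df.
apply: rV_mulmx_inj => v.
apply: etrans (esym (deriveEjacobian _ df)) _.
apply: etrans _ (deriveEjacobian _ dh).
exact: near_eq_derive.
Qed.

Lemma jacobian_id n (x : 'rV[R]_n) : 'J id x = 1%:M.
Proof.
apply: rV_mulmx_inj => v; rewrite mulmx1.
by rewrite /jacobian mul_rV_lin1 diff_val.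
Qed.

Lemma derive_comp n (W : normedModType R) (V : normedModType R)
    (f : V -> 'rV[R]_n) (h : 'rV[R]_n -> W) x v :
  differentiable f x -> differentiable h (f x) ->
  'D_v (h \o f) x = 'D_('D_v f x) h (f x).
Proof.
move=> df dh; rewrite (deriveE _ df) (deriveE _ dh).
by rewrite (deriveE _ (differentiable_comp df dh)) diff_comp.
Qed.

End smooth.

(** * Charts and tangent maps *)

Section charts.
Context {R : realType}.

(** The source of all local arguments: identities of coordinate expressions hold near [chart a x],
    where [param a] is a genuine inverse. *)
Lemma near_chart n (M : charted R n) (a x : M) (U : set M) :
  is_manifold M -> cdom a x -> open U -> U x ->
  \forall y \near chart a x,
    [/\ cdom a (param a y), chart a (param a y) = y & U (param a y)].
Proof.
move=> hM ax oU Ux.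
have n1 : \forall y \near chart a x, (chart a @` cdom a) y.
  by apply: open_nbhs_nbhs; split; [exact: chart_open|exists x].
have n2 : \forall y \near chart a x, U (param a y).
  apply: (param_continuous hM ax); rewrite chartK //.
  exact: open_nbhs_nbhs.
near=> y.
have [z az zy] : (chart a @` cdom a) y by near: y.
split; last by near: y.
- by rewrite -zy chartK.
- by rewrite -zy chartK.
Unshelve. all: by end_near. Qed.

Lemma chart_image_open n (M : charted R n) (a : M) (U : set M) :
  is_manifold M -> open U -> open (chart a @` (cdom a `&` U)).
Proof.
move=> hM oU; rewrite openE => _ [x [ax Ux] <-].
have := near_chart hM ax oU Ux; apply: filterS => y [ay yK Uy].
by exists (param a y).
Qed.

Lemma transition_differentiable n (M : charted R n) (a b x : M) :
  is_manifold M -> cdom a x -> cdom b x ->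
  differentiable (chart b \o param a) (chart a x).
Proof.
move=> hM ax bx; apply: smooth_differentiable (transition_smooth hM a b) _.
by exists x.
Qed.

Lemma frame_chart n (M : charted R n) (a x : M) : is_manifold M -> cdom a x ->
  frame a (chart a x) = 'J (chart x \o param a) (chart a x).
Proof. by move=> hM ax; rewrite /frame chartK. Qed.

(** Tangent spaces are identified with row vectors through the preferred charts, so a tensor at [a]
    equals its expression in the chart at [a], without any change of basis. *)
Lemma frame_base n (M : charted R n) (a : M) : is_manifold M ->
  frame a (chart a a) = 1%:M.
Proof.
move=> hM; have aa := cdom_refl hM a.
rewrite frame_chart // -(jacobian_id (chart a a)).
apply: near_eq_jacobian; last exact: transition_differentiable.
by have := near_chart hM aa openT I; apply: filterS => y [].
Qed.

(** The inverse is the Jacobian of the opposite chart change. *)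
Lemma frame_unitmx n (M : charted R n) (a x : M) : is_manifold M ->
  cdom a x -> frame a (chart a x) \in unitmx.
Proof.
move=> hM ax; have xx := cdom_refl hM x.
suff H : frame a (chart a x) *m 'J (chart a \o param x) (chart x x) = 1%:M.
  by have [H1 _] := mulmx1_unit H; exact H1.
have E : (chart x \o param a) (chart a x) = chart x x by rewrite /= chartK.
rewrite frame_chart // -E -jacobian_comp; last 2 first.
- exact: transition_differentiable.
- by rewrite E; exact: transition_differentiable.
rewrite -(jacobian_id (chart a x)).
symmetry; apply: near_eq_jacobian => //.
have := near_chart hM ax (cdom_open hM x) xx.
by apply: filterS => y [ay yK xy] /=; rewrite chartK // yK.
Qed.

(** * Coordinate expressions of smooth maps *)

Section smooth_map.
Context n m (M : charted R n) (N : charted R m) (F : M -> N).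
Hypotheses (hM : is_manifold M) (hN : is_manifold N).
Hypothesis sF : smooth_map_on setT F.

Definition loc_map (a : M) (b : N) : 'rV[R]_n -> 'rV[R]_m :=
  chart b \o F \o param a.

Lemma near_loc_map (a x : M) (b : N) : cdom a x -> cdom b (F x) ->
  \forall y \near chart a x,
    [/\ cdom a (param a y), chart a (param a y) = y & cdom b (F (param a y))].
Proof.
move=> ax bFx.
have : nbhs x (fun z => cdom b (F z)).
  apply: (sF.1 x I); apply: open_nbhs_nbhs; split => //; exact: cdom_open.
rewrite nbhsE => -[U [oU Ux] Ub].
have := near_chart hM ax oU Ux; apply: filterS => y [? ? Uy]; split => //.
exact: Ub.
Qed.

Lemma loc_map_smooth (a : M) (b : N) (x : M) : cdom a x -> cdom b (F x) ->
  exists V, [/\ open V, V (chart a x) & smooth_on V (loc_map a b)].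
Proof.
move=> ax bFx; exists (chart a @` (cdom a `&` (setT `&` F @^-1` cdom b))).
split; last by have := sF.2 a b; rewrite -setIA.
- apply: chart_image_open => //; rewrite setTI.
  by apply: open_comp (cdom_open hN b) => z _; exact: sF.1.
- by exists x.
Qed.

Lemma loc_map_differentiable (a : M) (b : N) (x : M) :
  cdom a x -> cdom b (F x) -> differentiable (loc_map a b) (chart a x).
Proof.
move=> ax bFx; have [V [_ Vx sV]] := loc_map_smooth ax bFx.
exact: smooth_differentiable sV Vx.
Qed.

Lemma loc_map_chart (a : M) (b : N) (x : M) : cdom a x ->
  loc_map a b (chart a x) = chart b (F x).
Proof. by move=> ax; rewrite /loc_map /= chartK. Qed.

(** Both sides are the Jacobian of [loc_map a (F x)], factored through the chart at [x] on the left
    and through the chart at [b] on the right. *)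
Lemma frame_tangent (a : M) (b : N) (x : M) : cdom a x -> cdom b (F x) ->
  frame a (chart a x) *m tangent F x
  = 'J (loc_map a b) (chart a x) *m frame b (chart b (F x)).
Proof.
move=> ax bFx.
have xx := cdom_refl hM x; have FF := cdom_refl hN (F x).
transitivity ('J (loc_map a (F x)) (chart a x)).
  have E : (chart x \o param a) (chart a x) = chart x x by rewrite /= chartK.
  rewrite frame_chart // /tangent -E -jacobian_comp; last 2 first.
  - exact: transition_differentiable.
  - by rewrite E; exact: loc_map_differentiable.
  symmetry; apply: near_eq_jacobian; last exact: loc_map_differentiable.
  have := near_chart hM ax (cdom_open hM x) xx.
  by apply: filterS => y [ay yK xy]; rewrite /loc_map /= chartK.
rewrite frame_chart // -(loc_map_chart b ax) -jacobian_comp; last 2 first.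
- exact: loc_map_differentiable.
- by rewrite loc_map_chart //; exact: transition_differentiable.
apply: near_eq_jacobian; last exact: loc_map_differentiable.
have := near_loc_map ax bFx.
by apply: filterS => y [ay yK bF]; rewrite /loc_map /= chartK.
Qed.

End smooth_map.
End charts.

(** * One-forms and their pullbacks *)

Section forms.
Context {R : realType}.

Lemma derive_mulmx_cst (V : normedModType R) m n p (A : V -> 'M[R]_(m, n))
    (B : 'M[R]_(n, p)) x v :
  differentiable A x -> 'D_v (fun y => A y *m B) x = 'D_v A x *m B.
Proof.
move=> dA; have dB : differentiable (fun _ : V => B) x by [].
by rewrite (derive_mulmx v dA dB) (derive_cst B x v) mulmx0 addr0.
Qed.

(** Taking the identity as a smooth map lets the statements on pullbacks serve for changes of chart
    as well. *)
Lemma smooth_id n (M : charted R n) :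
  is_manifold M -> smooth_map_on setT (id : M -> M).
Proof.
move=> hM; split=> [x _|a b]; first by [].
by have := transition_smooth hM a b; rewrite -{1}[cdom a]setIT.
Qed.

Lemma tangent_id n (M : charted R n) (a : M) :
  is_manifold M -> tangent (id : M -> M) a = 1%:M.
Proof.
by move=> hM; rewrite -(frame_base a hM) frame_chart //; exact: cdom_refl.
Qed.

(** Forms given by covector rows become the single matrix-valued map [loc_row] in coordinates, to
    which the product rule for matrices applies. *)
Definition row_form n (M : charted R n) (A : M -> 'rV[R]_n) (x : M)
  (w : 'rV[R]_n) : R := (A x *m w^T) ord0 ord0.

Definition loc_row n (M : charted R n) (A : M -> 'rV[R]_n) (a : M)
  (y : 'rV[R]_n) : 'rV[R]_n := A (param a y) *m (frame a y)^T.

Lemma loc_row_base n (M : charted R n) (A : M -> 'rV[R]_n) (a : M) :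
  is_manifold M -> loc_row A a (chart a a) = A a.
Proof.
move=> hM; rewrite /loc_row frame_base // trmx1 mulmx1 chartK //.
exact: cdom_refl.
Qed.

Lemma loc_form_row n (M : charted R n) (A : M -> 'rV[R]_n) v (a : M) y :
  loc_form (row_form A) v a y = (loc_row A a y *m v^T) ord0 ord0.
Proof. by rewrite /loc_form /row_form /loc_row trmx_mul mulmxA. Qed.

Lemma derive_row (V : normedModType R) n (B : V -> 'rV[R]_n) x u (v : 'rV[R]_n) :
  differentiable B x ->
  'D_u (fun y => (B y *m v^T) ord0 ord0 : R^o) x
  = ('D_u B x *m v^T) ord0 ord0.
Proof.
move=> dB; rewrite -(derive_mulmx_cst (v^T) u dB) derive_entry //.
exact: differentiable_mulmx.
Qed.

Lemma loc_form_rowE n (M : charted R n) (A : M -> 'rV[R]_n) v (a : M) :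
  loc_form (row_form A) v a
  = (fun y => (loc_row A a y *m v^T) ord0 ord0 : R^o).
Proof. by apply/funext => y; exact: loc_form_row. Qed.

Lemma ext_d_row n (M : charted R n) (A : M -> 'rV[R]_n) (a : M) u v :
  differentiable (loc_row A a) (chart a a) ->
  ext_d (row_form A) a u v
  = ('D_u (loc_row A a) (chart a a) *m v^T) ord0 ord0
    - ('D_v (loc_row A a) (chart a a) *m u^T) ord0 ord0.
Proof. by move=> dA; rewrite /ext_d !loc_form_rowE !derive_row. Qed.

(** * Pullbacks and the exterior derivative *)

Section pullback.
Context n m (M : charted R n) (N : charted R m) (F : M -> N).
Hypotheses (hM : is_manifold M) (hN : is_manifold N).
Hypothesis sF : smooth_map_on setT F.

Lemma near_loc_fun (f : N -> R) (a p : M) (b : N) :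
  cdom a p -> cdom b (F p) ->
  \forall y \near chart a p,
    (loc_fun f b \o loc_map F a b) y = loc_fun (f \o F) a y.
Proof.
move=> ap bp; have := near_loc_map hM hN sF ap bp.
by apply: filterS => y [ay yK bF]; rewrite /loc_fun /loc_map /= chartK.
Qed.

Lemma loc_fun_comp_differentiable (f : N -> R) (a p : M) (b : N) :
  cdom a p -> cdom b (F p) ->
  differentiable (loc_fun f b) (chart b (F p)) ->
  differentiable (loc_fun (f \o F) a) (chart a p).
Proof.
move=> ap bp df; apply: near_eq_differentiable (near_loc_fun f ap bp) _.
apply: differentiable_comp; first exact: loc_map_differentiable.
by rewrite loc_map_chart.
Qed.

Lemma fun_d_comp (f : N -> R) (a p : M) u :
  cdom a p -> differentiable (loc_fun f (F p)) (chart (F p) (F p)) ->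
  'D_u (loc_fun (f \o F) a) (chart a p)
  = fun_d f (F p) (u *m frame a (chart a p) *m tangent F p).
Proof.
move=> ap df; have FF := cdom_refl hN (F p).
rewrite -mulmxA (frame_tangent hM hN sF ap FF) frame_base // mulmx1.
rewrite -(near_eq_derive _ (near_loc_fun f ap FF)).
rewrite derive_comp ?loc_map_chart //; last exact: loc_map_differentiable.
by rewrite deriveEjacobian //; exact: loc_map_differentiable.
Qed.

Definition pull_row (A : N -> 'rV[R]_m) (p : M) : 'rV[R]_n :=
  A (F p) *m (tangent F p)^T.

Lemma row_form_pull (A : N -> 'rV[R]_m) p w :
  row_form (pull_row A) p w = row_form A (F p) (w *m tangent F p).
Proof. by rewrite /row_form /pull_row trmx_mul mulmxA. Qed.

Lemma loc_form_pull (A : N -> 'rV[R]_m) (p z : M) (b : N) v :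
  cdom p z -> cdom b (F z) ->
  loc_form (row_form (pull_row A)) v p (chart p z)
  = (loc_row A b (loc_map F p b (chart p z))
      *m ('D_v (loc_map F p b) (chart p z))^T) ord0 ord0.
Proof.
move=> pz bF; rewrite /loc_form row_form_pull chartK // /row_form.
rewrite -mulmxA (frame_tangent hM hN sF pz bF) loc_map_chart //.
rewrite (deriveEjacobian _ (loc_map_differentiable hM hN sF pz bF)).
by rewrite /loc_row chartK // mulmxA [in LHS]trmx_mul mulmxA.
Qed.

Lemma near_loc_form_pull (A : N -> 'rV[R]_m) (p : M) v :
  \forall y \near chart p p,
    (fun y => (loc_row A (F p) (loc_map F p (F p) y)
      *m ('D_v (loc_map F p (F p)) y)^T) ord0 ord0 : R^o) y
    = loc_form (row_form (pull_row A)) v p y.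
Proof.
have pp := cdom_refl hM p; have FF := cdom_refl hN (F p).
have := near_loc_map hM hN sF pp FF; apply: filterS => y [py yK bF].
by have := loc_form_pull A v py bF; rewrite yK => ->.
Qed.

Section at_point.
Variables (A : N -> 'rV[R]_m) (p : M).
Hypothesis dA : differentiable (loc_row A (F p)) (chart (F p) (F p)).

Let pp : cdom p p := cdom_refl hM p.
Let FF : cdom (F p) (F p) := cdom_refl hN (F p).

Let dG : differentiable (loc_row A (F p) \o loc_map F p (F p)) (chart p p).
Proof.
apply: differentiable_comp; first exact: loc_map_differentiable.
by rewrite loc_map_chart.
Qed.

Let dD v :
  differentiable (fun y => ('D_v (loc_map F p (F p)) y)^T) (chart p p).
Proof.
have [V [_ Vx sV]] := loc_map_smooth hM hN sF pp FF.
apply: differentiable_trmx.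
exact: smooth_differentiable (smooth_derive v sV) Vx.
Qed.

Lemma loc_form_pull_differentiable v :
  differentiable (loc_form (row_form (pull_row A)) v p) (chart p p).
Proof.
apply: near_eq_differentiable (near_loc_form_pull A p v) _.
apply: differentiable_entry; apply: differentiable_mulmx (dD v).
exact: dG.
Qed.

(** The chain rule leaves a term with the second derivative of the map, which is symmetric by
    Schwarz's theorem and cancels. *)
Lemma ext_d_pull u v :
  ext_d (row_form (pull_row A)) p u v
  = ext_d (row_form A) (F p) (u *m tangent F p) (v *m tangent F p).
Proof.
have [V [oV Vx sV]] := loc_map_smooth hM hN sF pp FF.
have dL := loc_map_differentiable hM hN sF pp FF.
have E w : w *m tangent F p = 'D_w (loc_map F p (F p)) (chart p p).
  by rewrite (deriveEjacobian _ dL).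
have D u' v' : 'D_u' (loc_form (row_form (pull_row A)) v' p) (chart p p)
    = ('D_(u' *m tangent F p) (loc_row A (F p)) (chart (F p) (F p))
        *m (v' *m tangent F p)^T) ord0 ord0
      + (A (F p) *m ('D_u' (fun y => 'D_v' (loc_map F p (F p)) y) (chart p p))^T)
          ord0 ord0.
  rewrite -(near_eq_derive _ (near_loc_form_pull A p v')).
  rewrite -derive_entry; last exact: differentiable_mulmx dG (dD v').
  rewrite (derive_mulmx u' dG (dD v')) mxE.
  congr (_ + _).
    rewrite derive_comp ?loc_map_chart //.
    by rewrite -!E.
  rewrite /= loc_map_chart // loc_row_base // derive_trmx //.
  exact: smooth_differentiable (smooth_derive v' sV) Vx.
rewrite {1}/ext_d !D ext_d_row //.
rewrite (smooth_derive_comm_mx u v oV Vx sV).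
by rewrite opprD addrACA subrr addr0.
Qed.

End at_point.
End pullback.
End forms.

(** * Closedness of Kähler forms and Cartan's formula *)

Section bilinear.
Context {R : realType} {n : nat}.
Implicit Types (A B : 'M[R]_n) (u v w : 'rV[R]_n).

Lemma bilDm A B u v : bil (A + B) u v = bil A u v + bil B u v.
Proof. by rewrite /bil mulmxDr mulmxDl mxE. Qed.

Lemma bilNm A u v : bil (- A) u v = - bil A u v.
Proof. by rewrite /bil mulmxN mulNmx mxE. Qed.

Lemma bilZm c A u v : bil (c *: A) u v = c * bil A u v.
Proof. by rewrite /bil -scalemxAr -scalemxAl mxE. Qed.

Lemma bilDl A u v w : bil A (u + v) w = bil A u w + bil A v w.
Proof. by rewrite /bil !mulmxDl mxE. Qed.

Lemma bilDr A u v w : bil A w (u + v) = bil A w u + bil A w v.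
Proof. by rewrite /bil linearD mulmxDr mxE. Qed.

Lemma bilZl c A u v : bil A (c *: u) v = c * bil A u v.
Proof. by rewrite /bil -!scalemxAl mxE. Qed.

Lemma bilZr c A u v : bil A u (c *: v) = c * bil A u v.
Proof. by rewrite /bil linearZ -scalemxAr mxE. Qed.

Lemma bilNl A u v : bil A (- u) v = - bil A u v.
Proof. by rewrite /bil !mulNmx mxE. Qed.

Lemma bilNr A u v : bil A u (- v) = - bil A u v.
Proof. by rewrite /bil linearN mulmxN mxE. Qed.

Lemma bil_tr A u v : bil A^T u v = bil A v u.
Proof.
rewrite /bil -[in RHS](trmxK (v *m A *m u^T)) [RHS]mxE.
by rewrite !trmx_mul trmxK mulmxA.
Qed.

Lemma bil_mulmx A B u v : bil (A *m B) u v = bil B (u *m A) v.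
Proof. by rewrite /bil mulmxA. Qed.

Lemma bil_mulmxr A B u v : bil (A *m B) u v = bil A u (v *m B^T).
Proof. by rewrite /bil trmx_mul trmxK !mulmxA. Qed.

Lemma bil_inj A B : (forall u v, bil A u v = bil B u v) -> A = B.
Proof.
move=> AB; apply/matrixP => i j.
have E (C : 'M[R]_n) : bil C (delta_mx ord0 i) (delta_mx ord0 j) = C i j.
  by rewrite /bil -rowE trmx_delta -colE !mxE.
by rewrite -!E AB.
Qed.

(* The Kähler form of a parallel skew-symmetric endomorphism is closed: in
   terms of the first derivatives [DG], [DJ] of the metric and of the
   endomorphism, the cyclic sum of the derivatives of [J *m G] vanishes. *)
Lemma parallel_closed (G J : 'M[R]_n) (DG DJ : 'rV[R]_n -> 'M[R]_n) :
  G \in unitmx ->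
  (forall c u v, DG (c *: u + v) = c *: DG u + DG v) ->
  (forall u, (DG u)^T = DG u) ->
  J *m G = - (G *m J^T) ->
  (forall u, let C := 2^-1 *: (DG u
       + \matrix_(i, j) ((u *m DG (delta_mx ord0 i)) ord0 j
                         - (u *m DG (delta_mx ord0 j)) ord0 i)) *m invmx G in
     DJ u + J *m C - C *m J = 0) ->
  forall u v z, let DW w := DJ w *m G + J *m DG w in
    bil (DW u) z v - bil (DW v) z u = bil (DW z) u v.
Proof.
move=> uG linD symD skewJ par.
have linD0 : DG 0 = 0.
  by have := linD (-1) 0 0; rewrite scaler0 addr0 scaleN1r addNr.
have Dsum u : DG u = \sum_i u ord0 i *: DG (delta_mx ord0 i).
  have -> : DG u = DG (\sum_i u ord0 i *: delta_mx ord0 i).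
    by rewrite -row_sum_delta.
  elim/big_rec2: _ => [//|i x y _ <-]; exact: linD.
pose N u := \matrix_(i, j) ((u *m DG (delta_mx ord0 i)) ord0 j) : 'M[R]_n.
have bN u v w : bil (N u) v w = bil (DG v) u w.
  suff E : v *m N u = u *m DG v by rewrite /bil E.
  rewrite mulmx_sum_row Dsum mulmx_sumr; apply: eq_bigr => i _.
  by rewrite -scalemxAr; congr (_ *: _); apply/rowP => j; rewrite !mxE.
(* [K u] is twice the Christoffel matrix with its index lowered, and [bK] is the Koszul formula for
   fields with constant coefficients. *)
pose K u := DG u + (N u - (N u)^T).
have bK u v w : bil (K u) v w
    = bil (DG u) v w + bil (DG v) u w - bil (DG w) u v.
  by rewrite !bilDm bilNm bil_tr !bN addrA.
have bJ u v w : 2 * bil (DJ u *m G + J *m DG u) v w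
    = 2 * bil (DG u) (v *m J) w - bil (K u) (v *m J) w - bil (K u) v (w *m J).
  have := par u; set M := (\matrix_(i, j) _).
  have -> : M = N u - (N u)^T by apply/matrixP => i j; rewrite !mxE.
  rewrite -/(K u) /=; set C := _ *m invmx G => CE.
  have CG : C *m G = 2^-1 *: K u by rewrite mulmxKV.
  clearbody C.
  have DJE : DJ u = C *m J - J *m C.
    by apply/eqP; rewrite -subr_eq0 opprB addrA CE.
  rewrite bilDm DJE mulmxBl -!mulmxA skewJ mulmxN !mulmxA CG -mulmxA CG.
  rewrite bilDm !bilNm (bil_mulmxr _ J^T) trmxK !bil_mulmx !bilZm.
  by lra.
move=> u v z /=; apply: (mulfI (_ : 2 != 0 :> R)); first by [].
have sym w x y : bil (DG w) x y = bil (DG w) y x by rewrite -bil_tr symD.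
rewrite mulrBr !bJ !bK.
rewrite (sym u z (v *m J)) (sym v z (u *m J)) (sym z (u *m J) v).
rewrite (sym (z *m J) u v) (sym (u *m J) v z) (sym (v *m J) u z).
rewrite (sym u (z *m J) v) (sym v (z *m J) u).
lra.
Qed.

(** The pointwise content of Cartan's formula, with [N] the derivative of the vector field:
    closedness trades the derivatives along [u] and [v] for the one along [z], where the Killing
    equation eliminates [DG z]. *)
Lemma cartan_algebra (G J N L : 'M[R]_n) (DG DJ : 'rV[R]_n -> 'M[R]_n) z u v :
  G^T = G -> J *m G = - (G *m J^T) ->
  (let DW w := DJ w *m G + J *m DG w in
   bil (DW u) z v - bil (DW v) z u = bil (DW z) u v) ->
  DG z + N *m G + G *m N^T = 0 ->
  DJ z - J *m N + N *m J = L ->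
  bil (J *m G) (u *m N) v + bil (DJ u *m G + J *m DG u) z v
  - (bil (J *m G) (v *m N) u + bil (DJ v *m G + J *m DG v) z u)
  = bil (L *m G) u v.
Proof.
move=> symG skewJ /= closed killing <-.
rewrite opprD addrACA closed.
have -> : bil (J *m G) (v *m N) u = - bil (J *m G *m N^T) u v.
  rewrite -bil_mulmx -bil_tr !trmx_mul symG -[_ *m N^T]/(_ *m N^T).
  by rewrite skewJ mulNmx bilNm opprK.
have -> : DG z = - (N *m G + G *m N^T).
  by apply/eqP; rewrite -addr_eq0 addrA killing.
rewrite opprK -bil_mulmx -!bilDm mulmxN !mulmxDl mulNmx mulmxDr !mulmxA.
congr (bil _ _ _); move: (N *m J *m G) (J *m G *m N^T) (J *m N *m G).
move: (DJ z *m G) => x1 x2 x3 x4.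
apply/matrixP => i j; rewrite !mxE. ring.
Qed.

End bilinear.

Section lie.
Context {R : realType} {n : nat} (M : charted R n).
Hypothesis hM : is_manifold M.

Lemma smooth_field_differentiable (W : normedModType R)
    (L : M -> 'rV[R]_n -> W) (a : M) :
  smooth_field_on setT L -> differentiable (L a) (chart a a).
Proof.
move=> sL; apply: smooth_differentiable (sL a) _; exists a => //.
by split=> //; exact: cdom_refl.
Qed.

Lemma loc_vec_base (X : M -> 'rV[R]_n) a : loc_vec X a (chart a a) = X a.
Proof.
have aa := cdom_refl hM a.
by rewrite /loc_vec frame_base // invmx1 mulmx1 chartK.
Qed.

Lemma loc_end_base (J : M -> 'M[R]_n) a : loc_end J a (chart a a) = J a.
Proof.
have aa := cdom_refl hM a.
by rewrite /loc_end frame_base // invmx1 mulmx1 mul1mx chartK.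
Qed.

Lemma loc_bil_base (g : M -> 'M[R]_n) a : loc_bil g a (chart a a) = g a.
Proof.
have aa := cdom_refl hM a.
by rewrite /loc_bil frame_base // trmx1 mulmx1 mul1mx chartK.
Qed.

Lemma near_frame (a : M) :
  \forall y \near chart a a, frame a y \in unitmx.
Proof.
have aa := cdom_refl hM a.
have := near_chart hM aa openT I; apply: filterS => y [ay yK _].
by rewrite -yK; apply: frame_unitmx.
Qed.

Variables (g J : M -> 'M[R]_n) (Z : M -> 'rV[R]_n).
Hypotheses (sg : smooth_field_on setT (loc_bil g))
  (sJ : smooth_field_on setT (loc_end J))
  (sZ : smooth_field_on setT (loc_vec Z)).

Lemma near_loc_row_vec a : \forall y \near chart a a,
  loc_vec Z a y *m loc_bil g a y = loc_row (fun x => Z x *m g x) a y.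
Proof.
apply: filterS (near_frame a) => y fu.
by rewrite /loc_vec /loc_bil /loc_row -!mulmxA mulKmx.
Qed.

Lemma loc_row_vec_differentiable a :
  differentiable (loc_row (fun x => Z x *m g x) a) (chart a a).
Proof.
apply: near_eq_differentiable (near_loc_row_vec a) _.
by apply: differentiable_mulmx; exact: smooth_field_differentiable.
Qed.

Lemma near_loc_row a : \forall y \near chart a a,
  loc_vec Z a y *m (loc_end J a y *m loc_bil g a y)
  = loc_row (fun x => Z x *m J x *m g x) a y.
Proof.
apply: filterS (near_frame a) => y fu.
by rewrite /loc_vec /loc_bil /loc_row /loc_end -!mulmxA !mulKmx.
Qed.

Lemma loc_row_differentiable a :
  differentiable (loc_row (fun x => Z x *m J x *m g x) a) (chart a a).
Proof.
apply: near_eq_differentiable (near_loc_row a) _.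
apply: differentiable_mulmx (smooth_field_differentiable a sZ) _.
apply: differentiable_mulmx (smooth_field_differentiable a sJ) _.
exact: smooth_field_differentiable a sg.
Qed.

Hypothesis g_metric : pseudo_riemannian g.
Hypothesis J_skew : forall a u v, bil (g a) (u *m J a) v = - bil (g a) u (v *m J a).
Hypothesis J_parallel : forall a u, nabla_end g J a u = 0.
Hypothesis Z_killing : forall x u v, lie_bil Z g x u v = 0.

(* Cartan's formula, [d (i_Z omega) = L_Z omega] for closed [omega]. *)
Lemma ext_d_interior a u v :
  ext_d (row_form (fun x => Z x *m J x *m g x)) a u v
  = bil (g a) (lie_end Z J a u) v.
Proof.
have dg := smooth_field_differentiable a sg.
have dJ := smooth_field_differentiable a sJ.
have dZ := smooth_field_differentiable a sZ.
have dW := differentiable_mulmx dJ dg.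
set x0 := chart a a in dg dJ dZ dW *.
pose DG u := 'D_u (loc_bil g a) x0; pose DJ u := 'D_u (loc_end J a) x0.
pose N := 'J (loc_vec Z a) x0.
have NE w : 'D_w (loc_vec Z a) x0 = w *m N by rewrite (deriveEjacobian _ dZ).
have D w w' : ('D_w (loc_row (fun x => Z x *m J x *m g x) a) x0 *m w'^T) ord0 ord0
    = bil (J a *m g a) (w *m N) w'
      + bil (DJ w *m g a + J a *m DG w) (Z a) w'.
  rewrite -(near_eq_derive _ (near_loc_row a)) (derive_mulmx w dZ dW).
  rewrite (derive_mulmx w dJ dg) NE loc_vec_base loc_bil_base loc_end_base.
  by rewrite mulmxDl mxE.
rewrite ext_d_row; last exact: loc_row_differentiable.
rewrite !D.
have skew : J a *m g a = - (g a *m (J a)^T).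
  apply: bil_inj => p q; rewrite bilNm (bil_mulmxr _ (J a)^T) trmxK -J_skew.
  by rewrite bil_mulmx.
have symD w : (DG w)^T = DG w.
  rewrite /DG -(derive_trmx _ dg); apply: near_eq_derive; near=> y.
  by rewrite /loc_bil !trmx_mul trmxK (Defs.metric_sym g_metric) mulmxA.
rewrite (@cartan_algebra _ _ (g a) (J a) N
  (DJ (Z a) - J a *m N + N *m J a) DG DJ (Z a) u v) //.
- rewrite bil_mulmx; congr (bil _ _ _).
  by rewrite /lie_end !NE mulmxDr mulmxBr !mulmxA.
- exact: Defs.metric_sym.
- apply: parallel_closed => //.
  + exact: metric_nondeg.
  + by move=> c p q; rewrite /DG !deriveE // linearP.
  + move=> w; have := J_parallel a w.
    by rewrite /nabla_end /christoffel loc_bil_base.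
- apply: bil_inj => p q; rewrite !bilDm (bil_mulmx N) (bil_mulmxr _ N^T) trmxK.
  have := Z_killing a p q; rewrite /lie_bil !NE => ->.
  by rewrite /bil mulmx0 mul0mx mxE.
Unshelve. all: by end_near. Qed.

End lie.

(** * The Hamiltonian Killing field *)

Lemma bil_nondeg (R : realType) n (G : 'M[R]_n) (u : 'rV[R]_n) :
  G \in unitmx -> (forall v, bil G u v = 0) -> u = 0.
Proof.
move=> uG uv; suff H : u *m G = 0 by rewrite -(mulmxK uG u) H mul0mx.
apply/rowP => j; have := uv (delta_mx ord0 j).
by rewrite /bil trmx_delta -colE !mxE.
Qed.

Section hamiltonian.
Context {R : realType} {n : nat} (M : charted R n).
Variables (g J1 J2 J3 : M -> 'M[R]_n) (Z : M -> 'rV[R]_n) (f : M -> R).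
Hypotheses (hM : is_manifold M) (hk : pseudo_hyper_kahler g J1 J2 J3).
Hypothesis Z_smooth : smooth_field_on setT (loc_vec Z).
Hypothesis Z_killing : forall x u v, lie_bil Z g x u v = 0.
Hypothesis Z_J2 : forall x v, lie_end Z J2 x v = - 2 *: (v *m J3 x).
Hypothesis f_smooth : smooth_field_on setT (loc_fun f).
Hypothesis f_d : forall x u, fun_d f x u = - kahler_form g J1 x (Z x) u.

(** [f_d] speaks of each point in its own chart; differentiating [df] once more needs the equation
    in one fixed chart, at all points near the base point. *)
Lemma hamiltonian_loc (a x : M) u : cdom a x ->
  'D_u (loc_fun f a) (chart a x)
  = - loc_form (row_form (fun x => Z x *m J1 x *m g x)) u a (chart a x).
Proof.
move=> ax.
have := @fun_d_comp _ _ _ M M id hM hM (smooth_id hM) f a x u ax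
  (smooth_field_differentiable hM x f_smooth).
by rewrite tangent_id // mulmx1 f_d => ->; rewrite /loc_form chartK.
Qed.

Lemma lie_J1 a u : lie_end Z J1 a u = 0.
Proof.
have [gm s1 _ _ htr p1 _ _] := hk.
apply: (@bil_nondeg _ _ (g a)) => [|v]; first exact: metric_nondeg.
rewrite -ext_d_interior //; last 2 first.
- exact: metric_smooth.
- by move=> b p q; exact: triple_skew1 (htr b) p q.
have aa := cdom_refl hM a.
have E w w' : 'D_w (loc_form (row_form (fun x => Z x *m J1 x *m g x)) w' a)
     (chart a a) = - 'D_w (fun y => 'D_w' (loc_fun f a) y : R^o) (chart a a).
  have sf : smooth_on (chart a @` (cdom a `&` setT)) (loc_fun f a) := f_smooth a.
  rewrite -deriveN; last first.
    apply: diff_derivable.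
    by apply: smooth_differentiable (smooth_derive w' sf) _; exists a.
  apply: near_eq_derive.
  have := near_chart hM aa openT I; apply: filterS => y [ay yK _].
  by rewrite -yK /= !fctE hamiltonian_loc // opprK.
rewrite /ext_d !E.
rewrite (@smooth_derive_comm _ _ (loc_fun f a) (chart a @` (cdom a `&` setT)) _ u v).
- by rewrite opprK addNr.
- exact: chart_image_open hM openT.
- by exists a.
- exact: f_smooth.
Qed.

(** Leibniz' rule for [J_3 = J_1 J_2]: by [lie_J1] only [J_1 (L_Z J_2) = - 2 J_1 J_3 = 2 J_2] is
    left. *)
Lemma lie_J3 a v : lie_end Z J3 a v = 2 *: (v *m J2 a).
Proof.
have [gm s1 s2 s3 htr p1 p2 p3] := hk.
have [sq1 _ _ J21 _ _ _ _] := htr a.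
have d1 := smooth_field_differentiable hM a s1.
have d2 := smooth_field_differentiable hM a s2.
have dZ := smooth_field_differentiable hM a Z_smooth.
have D3 w : 'D_w (loc_end J3 a) (chart a a)
    = 'D_w (loc_end J2 a) (chart a a) *m J1 a
      + J2 a *m 'D_w (loc_end J1 a) (chart a a).
  have := derive_mulmx w d2 d1; rewrite !loc_end_base // => <-.
  apply: near_eq_derive.
  apply: filterS (near_frame hM a) => y fu.
  by rewrite /loc_end -!mulmxA mulKmx // -(triple_12 (htr _)) !mulmxA.
have := lie_J1 a (v *m J2 a); have := Z_J2 a v; rewrite /lie_end.
rewrite !(deriveEjacobian _ dZ) D3 -J21 mulmxDr !mulmxA.
set N := 'J _ _; move: ('D_(Z a) _ _) ('D_(Z a) _ _) => D1 D2.
move=> /(congr1 (mulmx^~ (J1 a))) /=.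
rewrite !mulmxDl !mulNmx -!scalemxAl -[v *m J2 a *m J1 a *m J1 a]mulmxA sq1.
rewrite mulmxN mulmx1.
move: (v *m D2 *m J1 a) (v *m J2 a *m N *m J1 a) (v *m N *m J2 a *m J1 a).
move: (v *m J2 a *m D1) (v *m J2 a *m J1 a *m N) => x1 x2 x3 x4 x5.
move=> /rowP E2 /rowP E1; apply/rowP => j; move: (E1 j) (E2 j); rewrite !mxE.
by lra.
Qed.
End hamiltonian.

(** * The forms on the circle bundle *)

Section form_operations.
Context {R : realType} {n : nat} (M : charted R n) (a : M).
Implicit Types alpha beta : M -> 'rV[R]_n -> R.

(** Regularity at the single point [a] in its own chart, which is all that [ext_d] at [a] looks
    at. *)
Definition form_differentiable alpha :=
  forall v, differentiable (loc_form alpha v a) (chart a a).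

Lemma loc_formD alpha beta v :
  loc_form (fun x w => alpha x w + beta x w) v a
  = loc_form alpha v a + loc_form beta v a.
Proof. by []. Qed.

Lemma loc_formZ c alpha v :
  loc_form (fun x w => c * alpha x w) v a = c *: loc_form alpha v a.
Proof. by []. Qed.

Lemma form_differentiableD alpha beta :
  form_differentiable alpha -> form_differentiable beta ->
  form_differentiable (fun x w => alpha x w + beta x w).
Proof. by move=> da db v; rewrite loc_formD; exact: differentiableD. Qed.

Lemma form_differentiableZ c alpha :
  form_differentiable alpha -> form_differentiable (fun x w => c * alpha x w).
Proof. by move=> da v; rewrite loc_formZ; exact: differentiableZ. Qed.

Lemma ext_dD alpha beta u v :
  form_differentiable alpha -> form_differentiable beta ->
  ext_d (fun x w => alpha x w + beta x w) a u v
  = ext_d alpha a u v + ext_d beta a u v.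
Proof.
move=> da db; rewrite /ext_d !loc_formD.
have D w t := deriveD (@diff_derivable _ _ _ _ _ t (da w))
  (@diff_derivable _ _ _ _ _ t (db w)).
by rewrite !D opprD addrACA.
Qed.

Lemma ext_dZ c alpha u v : form_differentiable alpha ->
  ext_d (fun x w => c * alpha x w) a u v = c * ext_d alpha a u v.
Proof.
move=> da; rewrite /ext_d !loc_formZ.
have D w t := deriveZ c (@diff_derivable _ _ _ _ _ t (da w)).
by rewrite !D mulrBr.
Qed.

End form_operations.

Section connection_forms.
Context {R : realType} {n m : nat} (M : charted R n) (P : charted R m).
Variables (g J1 J2 J3 : M -> 'M[R]_n) (Z : M -> 'rV[R]_n) (f : M -> R).
Variables (proj : P -> M) (eta : P -> 'rV[R]_m -> R).
Hypotheses (hM : is_manifold M) (hP : is_manifold P)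
  (hk : pseudo_hyper_kahler g J1 J2 J3).
Hypothesis proj_smooth : smooth_map_on setT proj.
Hypothesis Z_smooth : smooth_field_on setT (loc_vec Z).
Hypothesis Z_killing : forall x u v, lie_bil Z g x u v = 0.
Hypothesis Z_J2 : forall x v, lie_end Z J2 x v = - 2 *: (v *m J3 x).
Hypothesis f_smooth : smooth_field_on setT (loc_fun f).
Hypothesis f_d : forall x u, fun_d f x u = - kahler_form g J1 x (Z x) u.
Hypothesis eta_form : one_form eta.
Hypothesis eta_curvature : forall p u v,
     ext_d eta p u v
     = kahler_form g J1 (proj p) (u *m tangent proj p) (v *m tangent proj p)
       - 2^-1 * ext_d (fun x w => bil (g x) (Z x) w) (proj p)
                  (u *m tangent proj p) (v *m tangent proj p).

(* The forms [f theta_1], [f theta_2], [f theta_3]. *)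
Definition thetaP1 (p : P) (v : 'rV[R]_m) : R :=
  eta p v + 2^-1 * bil (g (proj p)) (Z (proj p)) (v *m tangent proj p).
Definition thetaP2 (p : P) (v : 'rV[R]_m) : R :=
  2^-1 * kahler_form g J3 (proj p) (Z (proj p)) (v *m tangent proj p).
Definition thetaP3 (p : P) (v : 'rV[R]_m) : R :=
  - 2^-1 * kahler_form g J2 (proj p) (Z (proj p)) (v *m tangent proj p).

(** Written through [pull_row], the forms come within reach of [ext_d_pull], and their factors on
    [M] within reach of [ext_d_interior]. *)
Lemma thetaP1E : thetaP1 = (fun p v =>
  eta p v + 2^-1 * row_form (pull_row proj (fun x => Z x *m g x)) p v).
Proof. by apply/funext => p; apply/funext => v; rewrite row_form_pull. Qed.

Lemma thetaP2E : thetaP2 = (fun p v =>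
  2^-1 * row_form (pull_row proj (fun x => Z x *m J3 x *m g x)) p v).
Proof. by apply/funext => p; apply/funext => v; rewrite row_form_pull. Qed.

Lemma thetaP3E : thetaP3 = (fun p v =>
  - 2^-1 * row_form (pull_row proj (fun x => Z x *m J2 x *m g x)) p v).
Proof. by apply/funext => p; apply/funext => v; rewrite row_form_pull. Qed.

Let g_smooth := metric_smooth (hk_metric hk).

Let d_eta p : form_differentiable p eta.
Proof. by move=> v; apply: (smooth_field_differentiable hP p (eta_form.2 v)). Qed.

Let dZ p : form_differentiable p (row_form (pull_row proj (fun x => Z x *m g x))).
Proof.
move=> v; apply: loc_form_pull_differentiable => //.
exact: loc_row_vec_differentiable.
Qed.

Let dJ J p : smooth_field_on setT (loc_end J) ->
  form_differentiable p (row_form (pull_row proj (fun x => Z x *m J x *m g x))).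
Proof.
move=> sJ v; apply: loc_form_pull_differentiable => //.
exact: loc_row_differentiable.
Qed.

Let dJE J p u v : smooth_field_on setT (loc_end J) ->
  (forall a u, nabla_end g J a u = 0) ->
  (forall a u v, bil (g a) (u *m J a) v = - bil (g a) u (v *m J a)) ->
  ext_d (row_form (pull_row proj (fun x => Z x *m J x *m g x))) p u v
  = bil (g (proj p)) (lie_end Z J (proj p) (u *m tangent proj p))
      (v *m tangent proj p).
Proof.
move=> sJ pJ skJ; rewrite ext_d_pull //; last exact: loc_row_differentiable.
apply: ext_d_interior => //; exact: hk_metric hk.
Qed.

Lemma thetaP_differentiable p :
  [/\ form_differentiable p thetaP1, form_differentiable p thetaP2
    & form_differentiable p thetaP3].
Proof.
rewrite thetaP1E thetaP2E thetaP3E; split.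
- by apply: form_differentiableD (d_eta p) (form_differentiableZ _ (dZ p)).
- exact: form_differentiableZ (dJ p (hk_smooth3 hk)).
- exact: form_differentiableZ (dJ p (hk_smooth2 hk)).
Qed.

(** The summand [g (Z, .) / 2] cancels the exact term in the curvature of [eta]. *)
Lemma ext_d_thetaP1 p u v : ext_d thetaP1 p u v
  = kahler_form g J1 (proj p) (u *m tangent proj p) (v *m tangent proj p).
Proof.
rewrite thetaP1E ext_dD //; last exact: form_differentiableZ (dZ p).
rewrite ext_dZ // eta_curvature ext_d_pull //; first exact: subrK.
exact: loc_row_vec_differentiable.
Qed.

Lemma ext_d_thetaP2 p u v : ext_d thetaP2 p u v
  = kahler_form g J2 (proj p) (u *m tangent proj p) (v *m tangent proj p).
Proof.
rewrite thetaP2E ext_dZ; last exact: dJ (hk_smooth3 hk).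
rewrite dJE; last 3 first.
- exact: hk_smooth3 hk.
- exact: hk_parallel3 hk.
- by move=> a; exact: triple_skew3 (hk_triple hk a).
rewrite (lie_J3 hM hk Z_smooth Z_killing Z_J2 f_smooth f_d) bilZl.
by rewrite mulKf.
Qed.

Lemma ext_d_thetaP3 p u v : ext_d thetaP3 p u v
  = kahler_form g J3 (proj p) (u *m tangent proj p) (v *m tangent proj p).
Proof.
rewrite thetaP3E ext_dZ; last exact: dJ (hk_smooth2 hk).
rewrite dJE; last 3 first.
- exact: hk_smooth2 hk.
- exact: hk_parallel2 hk.
- by move=> a; exact: triple_skew2 (hk_triple hk a).
by rewrite Z_J2 bilZl mulNr mulNr mulrN opprK mulKf.
Qed.

Lemma loc_fun_proj_differentiable p :
  differentiable (loc_fun (f \o proj) p) (chart p p).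
Proof.
apply: (@loc_fun_comp_differentiable _ _ _ P M proj hP hM proj_smooth f p p (proj p)).
- exact: cdom_refl.
- exact: cdom_refl.
- exact: smooth_field_differentiable.
Qed.

Lemma derive_loc_fun_proj p u : 'D_u (loc_fun (f \o proj) p) (chart p p)
  = - kahler_form g J1 (proj p) (Z (proj p)) (u *m tangent proj p).
Proof.
rewrite fun_d_comp //; last 2 first.
- exact: cdom_refl.
- exact: smooth_field_differentiable.
by rewrite f_d frame_base // mulmx1.
Qed.

End connection_forms.

(** * Quaternions *)

Section quaternions.
Context {R : realType}.
Implicit Types x y z : 'rV[R]_4.

Lemma qc_quat0 (a b c d : R) : qc 0 (quat a b c d) = a.
Proof. by rewrite /qc mxE inordK. Qed.
Lemma qc_quat1 (a b c d : R) : qc 1 (quat a b c d) = b.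
Proof. by rewrite /qc mxE inordK. Qed.
Lemma qc_quat2 (a b c d : R) : qc 2 (quat a b c d) = c.
Proof. by rewrite /qc mxE inordK. Qed.
Lemma qc_quat3 (a b c d : R) : qc 3 (quat a b c d) = d.
Proof. by rewrite /qc mxE inordK. Qed.
Definition qcE := (qc_quat0, qc_quat1, qc_quat2, qc_quat3).

Lemma qcD k x y : qc k (x + y) = qc k x + qc k y.
Proof. by rewrite /qc mxE. Qed.
Lemma qcN k x : qc k (- x) = - qc k x.
Proof. by rewrite /qc mxE. Qed.
Lemma qcZ k a x : qc k (a *: x) = a * qc k x.
Proof. by rewrite /qc mxE. Qed.
Lemma qc0 k : qc k (0 : 'rV[R]_4) = 0.
Proof. by rewrite /qc mxE. Qed.

Lemma quat_ext x y : qc 0 x = qc 0 y -> qc 1 x = qc 1 y -> qc 2 x = qc 2 y ->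
  qc 3 x = qc 3 y -> x = y.
Proof.
move=> e0 e1 e2 e3; apply/rowP => i; rewrite -[i]inord_val.
by case: i => -[|[|[|[|//]]]] /= _; rewrite ?e0 ?e1 ?e2 ?e3.
Qed.

Definition qconj x := quat (qc 0 x) (- qc 1 x) (- qc 2 x) (- qc 3 x).

Lemma qnorm2_gt0 x : x != 0 -> 0 < qnorm2 x.
Proof.
move=> x0; rewrite lt_neqAle !addr_ge0 ?sqr_ge0 // andbT eq_sym.
apply: contra x0; rewrite /qnorm2 !paddr_eq0 ?addr_ge0 ?sqr_ge0 // !sqrf_eq0.
move=> /andP[/andP[/andP[/eqP e0 /eqP e1] /eqP e2] /eqP e3].
by apply/eqP/quat_ext; rewrite qc0.
Qed.

Lemma qinvE x : x != 0 -> qnorm2 x *: qinv x = qconj x.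
Proof.
by move=> /qnorm2_gt0/lt0r_neq0 x0; rewrite /qinv scalerA divff // scale1r.
Qed.

Lemma qmulDl x y z : qmul (x + y) z = qmul x z + qmul y z.
Proof. by apply: quat_ext; rewrite !(qcD, qcE); ring. Qed.
Lemma qmulDr x y z : qmul z (x + y) = qmul z x + qmul z y.
Proof. by apply: quat_ext; rewrite !(qcD, qcE); ring. Qed.
Lemma qmulZl a x y : qmul (a *: x) y = a *: qmul x y.
Proof. by apply: quat_ext; rewrite !(qcZ, qcE); ring. Qed.
Lemma qmulZr a x y : qmul x (a *: y) = a *: qmul x y.
Proof. by apply: quat_ext; rewrite !(qcZ, qcE); ring. Qed.
Lemma qmulA x y z : qmul x (qmul y z) = qmul (qmul x y) z.
Proof. by apply: quat_ext; rewrite !qcE; ring. Qed.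

End quaternions.

Section quaternion_derive.
Context {R : realType} {V : normedModType R}.
Implicit Types A B : V -> 'rV[R]_4.

Lemma qc_differentiable k A (x : V) :
  differentiable A x -> differentiable (fun y => qc k (A y) : R^o) x.
Proof. exact: differentiable_entry. Qed.

Lemma qc_derive k A (x v : V) : differentiable A x ->
  qc k ('D_v A x) = 'D_v (fun y => qc k (A y) : R^o) x.
Proof. exact: derive_entry. Qed.

Lemma differentiable_quat (a b c d : V -> R^o) (x : V) :
  differentiable a x -> differentiable b x -> differentiable c x ->
  differentiable d x ->
  differentiable (fun y => quat (a y) (b y) (c y) (d y)) x.
Proof.
move=> da db dc dd; apply: differentiable_mx => i j.
have -> : (fun y => quat (a y) (b y) (c y) (d y) i j : R^o)
    = [:: a; b; c; d]`_j.
  by apply/funext => y; rewrite mxE; case: j => -[|[|[|[|//]]]].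
by case: j => -[|[|[|[|//]]]].
Qed.

Lemma derive_quat (a b c d : V -> R^o) (x v : V) :
  differentiable a x -> differentiable b x -> differentiable c x ->
  differentiable d x ->
  'D_v (fun y => quat (a y) (b y) (c y) (d y)) x
  = quat ('D_v a x) ('D_v b x) ('D_v c x) ('D_v d x).
Proof.
move=> da db dc dd; have dq := differentiable_quat da db dc dd.
by apply: quat_ext; rewrite qc_derive // !qcE; congr ('D_v _ x);
  apply/funext => y; rewrite !qcE.
Qed.

Lemma qmul_differentiable A B (x : V) :
  differentiable A x -> differentiable B x ->
  differentiable (fun y => qmul (A y) (B y)) x.
Proof.
move=> dA dB; have a k := qc_differentiable k dA.
have b k := qc_differentiable k dB.
apply: differentiable_quat.
- by apply: differentiableB (differentiableM (a 3%N) (b 3%N));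
    apply: differentiableB (differentiableM (a 2%N) (b 2%N));
    apply: differentiableB; apply: differentiableM.
- by apply: differentiableB (differentiableM (a 3%N) (b 2%N));
    apply: differentiableD (differentiableM (a 2%N) (b 3%N));
    apply: differentiableD; apply: differentiableM.
- by apply: differentiableD (differentiableM (a 3%N) (b 1%N));
    apply: differentiableD (differentiableM (a 2%N) (b 0%N));
    apply: differentiableB; apply: differentiableM.
- by apply: differentiableD (differentiableM (a 3%N) (b 0%N));
    apply: differentiableB (differentiableM (a 2%N) (b 1%N));
    apply: differentiableD; apply: differentiableM.
Qed.

Lemma qmul_derive A B (x v : V) :
  differentiable A x -> differentiable B x ->
  'D_v (fun y => qmul (A y) (B y)) x
  = qmul ('D_v A x) (B x) + qmul (A x) ('D_v B x).
Proof.
move=> dA dB; have dAB := qmul_differentiable dA dB.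
have a k : is_derive x v (fun y => qc k (A y) : R^o) (qc k ('D_v A x)).
  by rewrite qc_derive //; apply: derivableP; apply: diff_derivable;
    exact: qc_differentiable.
have b k : is_derive x v (fun y => qc k (B y) : R^o) (qc k ('D_v B x)).
  by rewrite qc_derive //; apply: derivableP; apply: diff_derivable;
    exact: qc_differentiable.
have ab i j : is_derive x v (fun y => qc i (A y) * qc j (B y) : R^o)
  (qc i ('D_v A x) * qc j (B x) + qc i (A x) * qc j ('D_v B x)).
  by apply: is_derive_eq (is_deriveM (a i) (b j)) _; rewrite addrC mulrC.
(* Regroupings of the product rule, one for each sign pattern in the components of [qmul]. *)
have sum0 (a0 a1 b0 b1 c0 c1 d0 d1 : R) :
    a0 + a1 - (b0 + b1) - (c0 + c1) - (d0 + d1)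
    = a0 - b0 - c0 - d0 + (a1 - b1 - c1 - d1) by ring.
have sum1 (a0 a1 b0 b1 c0 c1 d0 d1 : R) :
    a0 + a1 + (b0 + b1) + (c0 + c1) - (d0 + d1)
    = a0 + b0 + c0 - d0 + (a1 + b1 + c1 - d1) by ring.
have sum2 (a0 a1 b0 b1 c0 c1 d0 d1 : R) :
    a0 + a1 - (b0 + b1) + (c0 + c1) + (d0 + d1)
    = a0 - b0 + c0 + d0 + (a1 - b1 + c1 + d1) by ring.
have sum3 (a0 a1 b0 b1 c0 c1 d0 d1 : R) :
    a0 + a1 + (b0 + b1) - (c0 + c1) + (d0 + d1)
    = a0 + b0 - c0 + d0 + (a1 + b1 - c1 + d1) by ring.
have E k (h : V -> R^o) d : is_derive x v h d ->
    (forall y, qc k (qmul (A y) (B y)) = h y) ->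
    'D_v (fun y => qc k (qmul (A y) (B y)) : R^o) x = d.
  by move=> H hE; rewrite -(@derive_val _ _ _ _ _ _ _ H); congr ('D_v _ x);
    apply/funext.
apply: quat_ext; rewrite qc_derive // qcD !qcE.
- have H := is_deriveB (is_deriveB (is_deriveB (ab 0%N 0%N) (ab 1%N 1%N)) (ab 2%N 2%N))
    (ab 3%N 3%N).
  rewrite (E _ _ _ H) => [|y]; last by rewrite !qcE.
  exact: sum0.
- have H := is_deriveB (is_deriveD (is_deriveD (ab 0%N 1%N) (ab 1%N 0%N)) (ab 2%N 3%N))
    (ab 3%N 2%N).
  rewrite (E _ _ _ H) => [|y]; last by rewrite !qcE.
  exact: sum1.
- have H := is_deriveD (is_deriveD (is_deriveB (ab 0%N 2%N) (ab 1%N 3%N)) (ab 2%N 0%N))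
    (ab 3%N 1%N).
  rewrite (E _ _ _ H) => [|y]; last by rewrite !qcE.
  exact: sum2.
- have H := is_deriveD (is_deriveB (is_deriveD (ab 0%N 3%N) (ab 1%N 2%N)) (ab 2%N 1%N))
    (ab 3%N 0%N).
  rewrite (E _ _ _ H) => [|y]; last by rewrite !qcE.
  exact: sum3.
Qed.

Lemma qconj_differentiable A (x : V) :
  differentiable A x -> differentiable (fun y => qconj (A y)) x.
Proof.
move=> dA; have a k := qc_differentiable k dA.
by apply: differentiable_quat => //; exact: differentiableN.
Qed.

Lemma qconj_derive A (x v : V) : differentiable A x ->
  'D_v (fun y => qconj (A y)) x = qconj ('D_v A x).
Proof.
move=> dA; have a k := qc_differentiable k dA.
rewrite derive_quat //; last 3 first.
- exact: differentiableN.
- exact: differentiableN.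
- exact: differentiableN.
by rewrite /qconj !deriveN ?qc_derive //; exact: diff_derivable.
Qed.

End quaternion_derive.

(** * The symplectic forms on [H^* x P] *)

Section block_derive.
Context {R : realType} {n1 n2 m : nat}.

Lemma row_mx_mul k (u : 'rV[R]_n1) (v : 'rV[R]_k) :
  row_mx u v = u *m row_mx 1%:M 0 + v *m row_mx 0 1%:M.
Proof. by rewrite !mul_mx_row !mulmx1 !mulmx0 add_row_mx addr0 add0r. Qed.

Lemma lsubmx_derive (x v : 'rV[R]_(n1 + n2)) :
  'D_v (fun y : 'rV[R]_(n1 + n2) => lsubmx y) x = lsubmx v.
Proof.
rewrite deriveE; last exact: differentiable_lsubmx.
rewrite diff_lin //; exact: continuous_lsubmx.
Qed.

Lemma rsubmx_derive (x v : 'rV[R]_(n1 + n2)) :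
  'D_v (fun y : 'rV[R]_(n1 + n2) => rsubmx y) x = rsubmx v.
Proof.
rewrite deriveE; last exact: differentiable_rsubmx.
rewrite diff_lin //; exact: continuous_rsubmx.
Qed.

Variables (G : 'rV[R]_n2 -> 'rV[R]_m) (y : 'rV[R]_(n1 + n2)).
Hypothesis dG : differentiable G (rsubmx y).

Let dGr : differentiable (fun z : 'rV[R]_(n1 + n2) => G (rsubmx z)) y.
Proof.
by apply: (@differentiable_comp _ _ _ _ (@rsubmx R 1 n1 n2) G) => //;
  exact: differentiable_rsubmx.
Qed.

Let block_mapE :
  (fun z : 'rV[R]_(n1 + n2) => row_mx (lsubmx z) (G (rsubmx z)))
  = (fun z => lsubmx z *m (row_mx 1%:M 0 : 'M[R]_(n1, n1 + m)))
    + (fun z => G (rsubmx z) *m (row_mx 0 1%:M : 'M[R]_(m, n1 + m))).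
Proof. by apply/funext => z; rewrite row_mx_mul. Qed.

(** Chart changes of [H^* x P] have this shape, because all charts of [H^*] are the inclusion into
    [R^4]. *)
Lemma block_map_differentiable :
  differentiable (fun z : 'rV[R]_(n1 + n2) => row_mx (lsubmx z) (G (rsubmx z))) y.
Proof.
rewrite block_mapE.
apply: differentiableD; apply: differentiable_mulmx => //.
exact: differentiable_lsubmx.
Qed.

Lemma block_map_derive v :
  'D_v (fun z : 'rV[R]_(n1 + n2) => row_mx (lsubmx z) (G (rsubmx z))) y
  = row_mx (lsubmx v) (rsubmx v *m 'J G (rsubmx y)).
Proof.
have dl : differentiable (fun z : 'rV[R]_(n1 + n2) => lsubmx z) y.
  exact: differentiable_lsubmx.
have dlc : differentiable (fun z : 'rV[R]_(n1 + n2) =>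
    lsubmx z *m (row_mx 1%:M 0 : 'M[R]_(n1, n1 + m))) y.
  exact: differentiable_mulmx.
have dGc : differentiable (fun z : 'rV[R]_(n1 + n2) =>
    G (rsubmx z) *m (row_mx 0 1%:M : 'M[R]_(m, n1 + m))) y.
  exact: differentiable_mulmx.
rewrite block_mapE.
rewrite (deriveD (diff_derivable dlc) (diff_derivable dGc)).
rewrite (derive_mulmx_cst _ v dl) (derive_mulmx_cst _ v dGr) lsubmx_derive.
rewrite [RHS]row_mx_mul; congr (_ + _ *m _).
rewrite (@derive_comp _ _ _ _ (@rsubmx R 1 n1 n2) G) //; last first.
  exact: differentiable_rsubmx.
by rewrite rsubmx_derive deriveEjacobian.
Qed.

End block_derive.

Section product_chart.
Context {R : realType} {m : nat} (P : charted R m).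
Hypothesis hP : is_manifold P.
Variable X : prod_charted (Hstar R) P.

Let q : 'rV[R]_4 := set_val X.1.
Let p : P := X.2.

Lemma quat_neq0 (z : Hstar R) : (set_val z : 'rV[R]_4) != 0.
Proof. exact: (set_mem (valP z)). Qed.

Lemma param_Hstar (a : Hstar R) (v : 'rV[R]_4) :
  v != 0 -> set_val (param a v) = v.
Proof. by rewrite /=; case: pselect => // ? ?. Qed.

Lemma near_quat_neq0 (v : 'rV[R]_4) : v != 0 -> \forall w \near v, w != 0.
Proof.
move=> v0; apply/nbhs_normP; exists `|v|; first by rewrite /= normr_gt0.
by move=> w /= vw; apply: contraTneq vw => ->; rewrite subr0 ltxx.
Qed.

(** Coordinates that come from actual points of the chart domain; elsewhere [param] takes arbitrary
    or default values. *)
Definition good_point (y : 'rV[R]_(4 + m)) : Prop :=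
  [/\ lsubmx y != 0, cdom p (param p (rsubmx y))
    & chart p (param p (rsubmx y)) = rsubmx y].

Lemma near_prod (y : 'rV[R]_(4 + m)) (A : set 'rV[R]_4) (B : set 'rV[R]_m) :
  (\forall z \near lsubmx y, A z) -> (\forall z \near rsubmx y, B z) ->
  \forall z \near y, A (lsubmx z) /\ B (rsubmx z).
Proof.
move=> nA nB; near=> z; split; near: z.
- by apply: (@continuous_lsubmx _ 1 4 m y).
- by apply: (@continuous_rsubmx _ 1 4 m y).
Unshelve. all: by end_near. Qed.

Lemma near_good_point : \forall y \near chart X X, good_point y.
Proof.
have pp := cdom_refl hP p.
have nq : \forall z \near lsubmx (chart X X), z != 0.
  by rewrite row_mxKl; apply: near_quat_neq0; exact: quat_neq0.
have np : \forall z \near rsubmx (chart X X),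
    cdom p (param p z) /\ chart p (param p z) = z.
  rewrite row_mxKr; have := near_chart hP pp openT I.
  by apply: filterS => z [].
by apply: filterS (near_prod nq np) => y [? []].
Qed.

Lemma frame_prod (y v : 'rV[R]_(4 + m)) : good_point y ->
  v *m frame X y = row_mx (lsubmx v) (rsubmx v *m frame p (rsubmx y)).
Proof.
move=> [y0 py yK].
have dG : differentiable (chart (param p (rsubmx y)) \o param p) (rsubmx y).
  have := transition_differentiable hP py (cdom_refl hP (param p (rsubmx y))).
  by rewrite yK.
have E : \forall z \near y,
    row_mx (lsubmx z) ((chart (param p (rsubmx y)) \o param p) (rsubmx z))
    = (chart (param X y) \o param X) z.
  have nT : \forall z \near rsubmx y, True by exact: filterT.
  have := near_prod (near_quat_neq0 y0) nT; apply: filterS => z [z0 _].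
  by rewrite /= [set_val _](param_Hstar _ z0).
rewrite /frame -(near_eq_jacobian E); last exact: block_map_differentiable dG.
by rewrite -deriveEjacobian ?block_map_derive //; exact: block_map_differentiable.
Qed.

End product_chart.

(** The factor [rho^2 f] clears both denominators, the norm in [qinv] and the [f^-1] in theta. *)
Lemma cone_rescale (R : realType) (c : R) (x w b : 'rV[R]_4) :
  c != 0 -> x != 0 ->
  (qnorm2 x * c) *: (qmul w (qinv x) + qmul (qmul x (c^-1 *: b)) (qinv x))
  = qmul (c *: w) (qconj x) + qmul (qmul x b) (qconj x).
Proof.
move=> c0 x0; rewrite -qinvE //; move: (qinv x) => z.
rewrite !(qmulZl, qmulZr) scalerDr !scalerA mulfK //.
by rewrite [qnorm2 x * c]mulrC.
Qed.

Lemma qmulNl (R : realType) (x y : 'rV[R]_4) : qmul (- x) y = - qmul x y.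
Proof. by rewrite -scaleN1r qmulZl scaleN1r. Qed.

Lemma qmulBr (R : realType) (x y z : 'rV[R]_4) :
  qmul z (x - y) = qmul z x - qmul z y.
Proof. by rewrite qmulDr -scaleN1r qmulZr scaleN1r. Qed.

(** The antisymmetrisation behind [omega_tildeE]: [s] and [t] stand for the derivatives of [f] along
    [u] and [v], [dv] for that of [bv] along [u], [du] for that of [bu] along [v], so that [dv - du]
    is an exterior derivative. *)
Lemma cone_antisym (R : realType) (q cq u v cu cv bu bv du dv : 'rV[R]_4)
    (s t c : R) :
  qmul (s *: v) cq + qmul (c *: v) cu
    + (qmul (qmul u bv + qmul q dv) cq + qmul (qmul q bv) cu)
    - (qmul (t *: u) cq + qmul (c *: u) cv
       + (qmul (qmul v bu + qmul q du) cq + qmul (qmul q bu) cv))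
  = qmul (s *: v - t *: u + qmul u bv - qmul v bu + qmul q (dv - du)) cq
    + qmul (c *: v + qmul q bv) cu - qmul (c *: u + qmul q bu) cv.
Proof.
rewrite qmulBr !(qmulDl, qmulNl).
do ?[move: (qmul _ _) => ?]; apply/rowP => i; rewrite !mxE; ring.
Qed.

Section cone_form.
Context {R : realType} {m : nat} (P : charted R m).
Hypothesis hP : is_manifold P.
Variables (fP : P -> R) (b1 b2 b3 : P -> 'rV[R]_m -> R).
Variable X : prod_charted (Hstar R) P.

Let q : 'rV[R]_4 := set_val X.1.
Let p : P := X.2.

Hypothesis fP_neq0 : forall p, fP p != 0.
Hypothesis dfP : differentiable (loc_fun fP p) (chart p p).
Hypotheses (db1 : form_differentiable p b1) (db2 : form_differentiable p b2)
  (db3 : form_differentiable p b3).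

Definition imag_form (x : P) (v : 'rV[R]_m) : 'rV[R]_4 :=
  quat 0 (b1 x v) (b2 x v) (b3 x v).

Let th (x : P) (v : 'rV[R]_m) : 'rV[R]_4 := (fP x)^-1 *: imag_form x v.

Definition loc_imag (v : 'rV[R]_m) (y : 'rV[R]_m) : 'rV[R]_4 :=
  quat 0 (loc_form b1 v p y) (loc_form b2 v p y) (loc_form b3 v p y).

(* [rho^2 f theta~ = f dq qbar + q (f theta) qbar] is polynomial in [q]. *)
Definition cone_form (v y : 'rV[R]_(4 + m)) : 'rV[R]_4 :=
  qmul (loc_fun fP p (rsubmx y) *: lsubmx v) (qconj (lsubmx y))
  + qmul (qmul (lsubmx y) (loc_imag (rsubmx v) (rsubmx y)))
      (qconj (lsubmx y)).

Lemma near_cone_form k v : \forall y \near chart X X,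
  (fun y => qc k (cone_form v y) : R^o) y
  = loc_form (fun (y : prod_charted (Hstar R) P) w =>
      qnorm2 (set_val y.1) * fP y.2 * qc k (theta_tilde th y w)) v X y.
Proof.
apply: filterS (near_good_point hP X) => y gy; have [y0 _ _] := gy.
rewrite /loc_form frame_prod // /theta_tilde row_mxKl row_mxKr.
have -> : set_val (param X y).1 = lsubmx y by exact: param_Hstar.
by rewrite -qcZ cone_rescale.
Qed.

Let y0 := chart X X.

Let dl : differentiable (fun y : 'rV[R]_(4 + m) => lsubmx y) y0.
Proof. exact: differentiable_lsubmx. Qed.

Let dr : differentiable (fun y : 'rV[R]_(4 + m) => rsubmx y) y0.
Proof. exact: differentiable_rsubmx. Qed.

Let ry0 : rsubmx y0 = chart p p. Proof. exact: row_mxKr. Qed.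
Let ly0 : lsubmx y0 = q. Proof. exact: row_mxKl. Qed.

Let drc (W : normedModType R) (h : 'rV[R]_m -> W) :
  differentiable h (chart p p) ->
  differentiable (fun y : 'rV[R]_(4 + m) => h (rsubmx y)) y0.
Proof.
move=> dh; apply: (@differentiable_comp _ _ _ _ (@rsubmx R 1 4 m) h) => //.
by rewrite ry0.
Qed.

Let rcE (W : normedModType R) (h : 'rV[R]_m -> W) u :
  differentiable h (chart p p) ->
  'D_u (fun y : 'rV[R]_(4 + m) => h (rsubmx y)) y0
  = 'D_(rsubmx u) h (chart p p).
Proof.
move=> dh; have := @derive_comp _ _ _ _ (@rsubmx R 1 4 m) h y0 u dr.
by rewrite ry0 => /(_ dh); rewrite rsubmx_derive.
Qed.

Let dimag v : differentiable (loc_imag v) (chart p p).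
Proof. exact: differentiable_quat. Qed.

Let df_scale v :
  differentiable (fun y : 'rV[R]_(4 + m) =>
    loc_fun fP p (rsubmx y) *: (v : 'rV[R]_4)) y0.
Proof. by apply: differentiableZl; exact: drc. Qed.

Lemma cone_form_differentiable v : differentiable (cone_form v) y0.
Proof.
apply: differentiableD; apply: qmul_differentiable.
- exact: df_scale.
- exact: qconj_differentiable.
- by apply: qmul_differentiable => //; exact: drc.
- exact: qconj_differentiable.
Qed.

Definition d_imag (u v : 'rV[R]_m) : 'rV[R]_4 :=
  quat 0 (ext_d b1 p u v) (ext_d b2 p u v) (ext_d b3 p u v).

Lemma loc_imag_base v : loc_imag v (chart p p) = imag_form p v.
Proof.
have pp := cdom_refl hP p.
by rewrite /loc_imag /loc_form frame_base // mulmx1 chartK.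
Qed.

Lemma cone_form_derive u v : 'D_u (cone_form v) y0 =
  qmul ('D_(rsubmx u) (loc_fun fP p) (chart p p) *: lsubmx v) (qconj q)
  + qmul (fP p *: lsubmx v) (qconj (lsubmx u))
  + (qmul (qmul (lsubmx u) (imag_form p (rsubmx v))
           + qmul q ('D_(rsubmx u) (loc_imag (rsubmx v)) (chart p p))) (qconj q)
     + qmul (qmul q (imag_form p (rsubmx v))) (qconj (lsubmx u))).
Proof.
have dc : differentiable (fun y : 'rV[R]_(4 + m) => qconj (lsubmx y)) y0.
  exact: qconj_differentiable.
have dqi := qmul_differentiable dl (drc (dimag (rsubmx v))).
have d1 := qmul_differentiable (df_scale (lsubmx v)) dc.
have d2 := qmul_differentiable dqi dc.
rewrite (deriveD (@diff_derivable _ _ _ _ _ u d1) (@diff_derivable _ _ _ _ _ u d2)).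
rewrite (qmul_derive u (df_scale (lsubmx v)) dc) (qmul_derive u dqi dc).
rewrite (qmul_derive u dl (drc (dimag (rsubmx v)))).
rewrite (rcE u (dimag (rsubmx v))) (qconj_derive u dl) lsubmx_derive.
rewrite ly0 ry0 loc_imag_base.
have -> : 'D_u (fun y : 'rV[R]_(4 + m) => loc_fun fP p (rsubmx y) *: lsubmx v) y0
    = 'D_(rsubmx u) (loc_fun fP p) (chart p p) *: lsubmx v.
  rewrite deriveE; last exact: df_scale.
  rewrite diffZl; last exact: drc.
  by rewrite -deriveE ?rcE //; exact: drc.
by rewrite /loc_fun chartK //; exact: cdom_refl.
Qed.

Lemma omega_tildeE k u v :
  let df w := 'D_w (loc_fun fP p) (chart p p) in
  let b := imag_form p in
  omega_tilde fP th k X u v = qc k (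
    qmul (df (rsubmx u) *: lsubmx v - df (rsubmx v) *: lsubmx u
          + qmul (lsubmx u) (b (rsubmx v)) - qmul (lsubmx v) (b (rsubmx u))
          + qmul q (d_imag (rsubmx u) (rsubmx v))) (qconj q)
    + qmul (fP p *: lsubmx v + qmul q (b (rsubmx v))) (qconj (lsubmx u))
    - qmul (fP p *: lsubmx u + qmul q (b (rsubmx u))) (qconj (lsubmx v))).
Proof.
move=> df b; rewrite /omega_tilde /ext_d.
rewrite -(near_eq_derive _ (near_cone_form k v)).
rewrite -(near_eq_derive _ (near_cone_form k u)).
have dcf := cone_form_differentiable.
rewrite -(qc_derive k u (dcf v)) -(qc_derive k v (dcf u)) -qcN -qcD.
rewrite !cone_form_derive -/(df _) -/(df _).
have -> : d_imag (rsubmx u) (rsubmx v)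
   = 'D_(rsubmx u) (loc_imag (rsubmx v)) (chart p p)
     - 'D_(rsubmx v) (loc_imag (rsubmx u)) (chart p p).
  have c0 : differentiable (fun _ : 'rV[R]_m => 0 : R^o) (chart p p) by [].
  rewrite !(derive_quat _ c0) // !derive_cst.
  by apply: quat_ext; rewrite !(qcD, qcN, qcE) ?subrr.
congr (qc k _); rewrite -/(b _) -/(b _).
exact: cone_antisym.
Qed.

End cone_form.

(** * Signatures under rank-one perturbations *)

Section signature.
Context {R : realType} {n : nat}.
Implicit Types (G B : 'M[R]_n) (u v w : 'rV[R]_n).

Definition sign_row (p : nat) : 'rV[R]_n :=
  \row_i (if (i < p)%N then 1 else -1).

Lemma diag_unitmx (d : 'rV[R]_n) :
  (forall i, d ord0 i != 0) -> diag_mx d \in unitmx.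
Proof.
move=> d0; rewrite unitmxE det_diag unitfE.
by apply/prodf_neq0 => i _; exact: d0.
Qed.

(** [B] is a factor of an invertible diagonal matrix, hence invertible itself. *)
Lemma has_signatureI G p q B : (p + q)%N = n ->
  B *m G *m B^T = diag_mx (sign_row p) -> has_signature G p q.
Proof.
move=> pq BG; split=> //; exists B => //.
have : diag_mx (sign_row p) \in unitmx.
  by apply: diag_unitmx => i; rewrite mxE; case: ifP; rewrite ?oppr_eq0 oner_neq0.
by rewrite -BG !unitmx_mul => /andP[/andP[]].
Qed.

Lemma has_signature_unit G p q : has_signature G p q -> G \in unitmx.
Proof.
case=> _ [B uB BG]; have : diag_mx (sign_row p) \in unitmx.
  by apply: diag_unitmx => i; rewrite mxE; case: ifP; rewrite ?oppr_eq0 oner_neq0.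
by rewrite -BG !unitmx_mul => /andP[/andP[]].
Qed.

Lemma bil_congr m (B : 'M[R]_(m, n)) G (u v : 'rV[R]_m) :
  bil (B *m G *m B^T) u v = bil G (u *m B) (v *m B).
Proof. by rewrite /bil trmx_mul !mulmxA. Qed.

Lemma bil_diag (d : 'rV[R]_n) u v :
  bil (diag_mx d) u v = \sum_i d ord0 i * (u ord0 i * v ord0 i).
Proof.
rewrite /bil mxE; apply: eq_bigr => i _.
by rewrite mul_mx_diag !mxE; ring.
Qed.

Lemma bil_rank1 (z : 'rV[R]_n) u v :
  bil (z^T *m z) u v = (u *m z^T) ord0 ord0 * (z *m v^T) ord0 ord0.
Proof. by rewrite /bil mulmxA -mulmxA mxE big_ord1. Qed.

Lemma bil_outer G v u w : G^T = G ->
  bil ((v *m G)^T *m (v *m G)) u w = bil G v u * bil G v w.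
Proof.
move=> sG; rewrite bil_rank1; congr (_ * _).
by rewrite trmx_mul sG mulmxA -bil_tr sG.
Qed.

Definition reflection G w : 'M[R]_n :=
  1%:M - (2 / bil G w w) *: (G *m w^T *m w).

Lemma reflectionE G w u : u *m reflection G w = u - (2 * bil G u w / bil G w w) *: w.
Proof.
rewrite mulmxBr mulmx1 -scalemxAr mulmxA mulmxA [_ *m w^T]mx11_scalar mul_scalar_mx.
by rewrite scalerA; congr (_ - _ *: _); rewrite /bil; ring.
Qed.

Lemma reflection_isometry G w u v : G^T = G -> bil G w w != 0 ->
  bil G (u *m reflection G w) (v *m reflection G w) = bil G u v.
Proof.
move=> sG w0; have sym x y : bil G x y = bil G y x by rewrite -bil_tr sG.
rewrite !reflectionE !(bilDl, bilDr, bilNl, bilNr, bilZl, bilZr) (sym w v).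
by field.
Qed.

(** A case of Witt's theorem: [G (v - e, v - e) + G (v + e, v + e) = 4 G (e, e)] is nonzero, so one
    of [v - e], [v + e] is not isotropic. The reflection along it sends [e] to [v] or to [- v],
    respectively. *)
Lemma reflection_transitive G (e v : 'rV[R]_n) :
  G^T = G -> bil G e e = bil G v v -> bil G e e != 0 ->
  exists2 s : 'M[R]_n, forall u w, bil G (u *m s) (w *m s) = bil G u w
    & e *m s = v \/ e *m s = - v.
Proof.
move=> sG ev e0; have sym x y : bil G x y = bil G y x by rewrite -bil_tr sG.
have [w0|w0] := eqVneq (bil G (v - e) (v - e)) 0; last first.
  exists (reflection G (v - e)); first by move=> u w; exact: reflection_isometry.
  left; rewrite reflectionE.
  have -> : 2 * bil G e (v - e) / bil G (v - e) (v - e) = -1.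
    move: w0; rewrite !(bilDl, bilDr, bilNl, bilNr) (sym v e) -ev => w0.
    by field.
  by rewrite scaleN1r opprK addrC subrK.
have w1 : bil G (v + e) (v + e) != 0.
  apply: contra e0 => /eqP w1; apply/eqP; move: w0 w1.
  rewrite !(bilDl, bilDr, bilNl, bilNr) (sym v e) -ev; lra.
exists (reflection G (v + e)); first by move=> u w; exact: reflection_isometry.
right; rewrite reflectionE.
have -> : 2 * bil G e (v + e) / bil G (v + e) (v + e) = 1.
  move: w1; rewrite !(bilDl, bilDr) (sym v e) -ev => w1.
  by field.
by rewrite scale1r opprD addrCA subrr addr0.
Qed.

(** * Adding a multiple of the square of a covector *)

Section perturbation.
Variables (G : 'M[R]_n) (p q : nat) (v : 'rV[R]_n) (l : R).
Hypotheses (sG : G^T = G) (hG : has_signature G p q).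
Let N := bil G v v.
Let G' := G + l *: ((v *m G)^T *m (v *m G)).

(** [G'] agrees with [G] on the orthogonal complement of [v] and multiplies the square of [v] by
    [1 + l N]; a positive factor is undone by rescaling [v]. *)
Lemma signature_perturb_same : N != 0 -> 0 < 1 + l * N -> has_signature G' p q.
Proof.
move=> N0 r0; have [pq [B uB BG]] := hG.
pose s := Num.sqrt (1 + l * N).
have s2 : s ^+ 2 = 1 + l * N by rewrite sqr_sqrtr // ltW.
have s0 : s != 0 by rewrite gt_eqF // sqrtr_gt0.
(* Chosen so that [C] sends [v] to [v / s], while fixing its orthogonal complement. *)
pose c := (s^-1 - 1) / N.
pose C : 'M[R]_n := 1%:M + c *: (G *m v^T *m v).
have CE u : u *m C = u + (c * bil G u v) *: v.
  rewrite mulmxDr mulmx1 -scalemxAr !mulmxA [_ *m v^T]mx11_scalar mul_scalar_mx.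
  by rewrite scalerA.
apply: (@has_signatureI _ _ _ (B *m C)) => //; rewrite -BG.
apply: bil_inj => x y; rewrite !bil_congr !mulmxA.
move: (x *m B) (y *m B) => {x y} x y; rewrite !CE.
have sym x' y' : bil G x' y' = bil G y' x' by rewrite -bil_tr sG.
rewrite /G' bilDm bilZm bil_outer // !(bilDl, bilDr, bilZl, bilZr).
rewrite -/N (sym v x) (sym v y).
have lE : l = (s ^+ 2 - 1) / N by rewrite s2; field.
by rewrite lE /c; field; rewrite N0.
Qed.

(** An isometry of [G] moves the [i]-th vector of the orthonormal basis to a multiple of [v]. In the
    new basis [G'] is still diagonal and only its [i]-th entry changes, to [eps (1 + l N)], of the
    opposite sign. *)
Lemma signature_perturb_flip (i : 'I_n) (eps nu : R) :
  eps = sign_row p ord0 i -> 0 < nu -> N = eps * nu ^+ 2 -> 1 + l * N < 0 ->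
  exists B, B *m G' *m B^T
    = diag_mx (\row_j (if j == i then - eps else sign_row p ord0 j)).
Proof.
move=> epsE nu0 NE r0; have [pq [B uB BG]] := hG.
have eps2 : eps * eps = 1 by rewrite epsE mxE; case: ifP => _; ring.
have eps0 : eps != 0 by apply: contra_eq_neq eps2 => ->; rewrite mul0r eq_sym oner_neq0.
have Ge : bil G (row i B) (row i B) = eps.
  rewrite rowE -bil_congr BG bil_diag (bigD1 i) //= big1 ?addr0; last first.
    by move=> j ji; rewrite [delta_mx _ _ _ _]mxE (negbTE ji) andbF mul0r mulr0.
  by rewrite [delta_mx _ _ _ _]mxE !eqxx !mulr1 epsE.
have Gv : bil G (row i B) (row i B) = bil G (nu^-1 *: v) (nu^-1 *: v).
  by rewrite Ge bilZl bilZr -/N NE; field; rewrite gt_eqF.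
have [s iso sv] := reflection_transitive sG Gv (eq_ind_r (fun x => x != 0) eps0 Ge).
(* Normalises the entry [eps (1 + l N)] to [- eps]. *)
pose t := (Num.sqrt (- (1 + l * N)))^-1.
have t2 : t ^+ 2 * (eps + l * nu ^+ 2) = - eps.
  have -> : eps + l * nu ^+ 2 = eps * (1 + l * N).
    by rewrite NE; ring: eps2.
  rewrite exprVn sqr_sqrtr ?oppr_ge0 ?ltW //.
  by field; rewrite lt_eqF // oppr_lt0 lt_eqF.
have Bs : B *m s *m G' *m (B *m s)^T = diag_mx (\row_j
    (if j == i then eps + l * nu ^+ 2 else sign_row p ord0 j)).
  apply: bil_inj => x y; rewrite bil_congr /G' bilDm bilZm bil_outer //.
  rewrite !mulmxA iso -bil_congr BG.
  (* The isometry reaches [v / nu] only up to sign, so [c] is [nu] or [- nu]; the rank-one term is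
     quadratic and sees only [nu ^+ 2]. *)
  have [c c2 cE] : exists2 c : R, c * c = nu ^+ 2 &
      forall z, bil G v (z *m B *m s) = c * (eps * z ord0 i).
    have vE : v = nu *: (nu^-1 *: v).
      by rewrite scalerA divff ?scale1r // gt_eqF.
    have ze z : bil G (row i B *m s) (z *m B *m s) = eps * z ord0 i.
      rewrite iso rowE -bil_congr BG bil_diag (bigD1 i) //= big1 ?addr0.
        by rewrite [delta_mx _ _ _ _]mxE !eqxx mul1r epsE.
      by move=> j ji; rewrite [delta_mx _ _ _ _]mxE (negbTE ji) andbF mul0r mulr0.
    case: sv => sv.
      by exists nu => // z; rewrite {1}vE -sv bilZl ze.
    exists (- nu) => [|z]; first by rewrite mulrNN.
    by rewrite {1}vE -[nu^-1 *: v]opprK -sv bilZl bilNl ze mulrN mulNr.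
  rewrite !cE !bil_diag !(bigD1 i (P := predT)) //= [in RHS]mxE eqxx -epsE.
  rewrite addrAC; congr (_ + _); last first.
    by apply: eq_bigr => j ji; rewrite [in RHS]mxE (negbTE ji).
  ring: eps2 c2.
pose T : 'M[R]_n := diag_mx (\row_j (if j == i then t else 1)).
have TE x j : (x *m T) ord0 j = x ord0 j * (if j == i then t else 1).
  by rewrite mul_mx_diag !mxE.
exists (T *m (B *m s)); apply: bil_inj => x y.
rewrite bil_congr [x *m _]mulmxA [y *m _]mulmxA -bil_congr Bs !bil_diag.
apply: eq_bigr => j _; rewrite !TE ![(\row__ _) _ _]mxE.
case: eqP => _; last by ring.
by rewrite -t2; ring.
Qed.

Lemma signature_perturb_down : 0 < N -> 1 + l * N < 0 ->
  (0 < p)%N /\ has_signature G' p.-1 q.+1.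
Proof.
move=> N0 r0; have [pq [B uB BG]] := hG.
have p0 : (0 < p)%N.
  rewrite lt0n; apply: contraTneq N0 => p0; rewrite -leNgt /N.
  have -> : v = v *m invmx B *m B by rewrite mulmxKV.
  rewrite -bil_congr BG p0 bil_diag; apply: sumr_le0 => i _.
  by rewrite mxE ltn0 mulN1r oppr_le0 -expr2 sqr_ge0.
split=> //.
(* The last positive vector is the one to flip: the signs then stay sorted, as [has_signature]
   demands. *)
have ip : (p.-1 < n)%N by rewrite prednK // -pq leq_addr.
have [B' B'G] : exists B', B' *m G' *m B'^T = diag_mx (\row_j
    (if j == Ordinal ip then - 1 else sign_row p ord0 j)).
  apply: (@signature_perturb_flip (Ordinal ip) 1 (Num.sqrt N)) => //.
  - by rewrite mxE /= prednK // leqnn.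
  - by rewrite sqrtr_gt0.
  - by rewrite mul1r sqr_sqrtr // ltW.
apply: (@has_signatureI _ _ _ B'); last first.
  rewrite B'G; congr diag_mx; apply/rowP => j; rewrite !mxE -val_eqE /=.
  have [->|jp] := eqVneq (j : nat) p.-1; first by rewrite ltnn.
  by rewrite -[in LHS](prednK p0) ltnS leq_eqVlt (negbTE jp).
by rewrite addnS -addSn prednK.
Qed.

Lemma signature_perturb_up : N < 0 -> 1 + l * N < 0 ->
  (0 < q)%N /\ has_signature G' p.+1 q.-1.
Proof.
move=> N0 r0; have [pq [B uB BG]] := hG.
have q0 : (0 < q)%N.
  rewrite lt0n; apply: contraTneq N0 => q0; rewrite -leNgt /N.
  have -> : v = v *m invmx B *m B by rewrite mulmxKV.
  rewrite -bil_congr BG bil_diag; apply: sumr_ge0 => i _.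
  have ip : (i < p)%N by move: (ltn_ord i); rewrite -{2}pq q0 addn0.
  by rewrite mxE ip mul1r -expr2 sqr_ge0.
split=> //.
(* Here the first negative vector is flipped, again to keep the signs sorted. *)
have ip : (p < n)%N by rewrite -pq -[X in (X < _)%N]addn0 ltn_add2l.
have [B' B'G] : exists B', B' *m G' *m B'^T = diag_mx (\row_j
    (if j == Ordinal ip then - -1 else sign_row p ord0 j)).
  apply: (@signature_perturb_flip (Ordinal ip) (-1) (Num.sqrt (- N))) => //.
  - by rewrite mxE /= ltnn.
  - by rewrite sqrtr_gt0 oppr_gt0.
  - by rewrite sqr_sqrtr ?oppr_ge0 ?ltW // mulN1r opprK.
apply: (@has_signatureI _ _ _ B'); last first.
  rewrite B'G; congr diag_mx; apply/rowP => j; rewrite !mxE -val_eqE /= opprK.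
  have [->|jp] := eqVneq (j : nat) p; first by rewrite leqnn.
  by rewrite ltnS [in RHS]leq_eqVlt (negbTE jp).
by rewrite addSn -addnS prednK.
Qed.

End perturbation.
End signature.

(** * The horizontal metric *)

Section triple.
Context {R : realType} {n : nat}.
Variable (G : 'M[R]_n).

(** Cyclic symmetry reduces each statement on the three structures to the first of them. *)
Lemma triple_cycle J K L : hermitian_triple G J K L -> hermitian_triple G K L J.
Proof.
case=> sq1 sq2 sq3 KJ JK sk1 sk2 sk3; split=> //.
- by rewrite -[L]opprK -JK mulNmx -mulmxA sq2 mulmxN mulmx1 opprK.
- by rewrite -KJ mulmxA sq2 mulNmx mul1mx.
Qed.

Lemma triple_skew0 J (Z : 'rV[R]_n) : G^T = G ->
  (forall u v, bil G (u *m J) v = - bil G u (v *m J)) ->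
  bil G Z (Z *m J) = 0.
Proof.
move=> sG sk; have := sk Z Z; rewrite -[bil G (_ *m J) Z]bil_tr sG; lra.
Qed.

End triple.

Section horizontal_model.
Context {R : realType} {n : nat}.
Variables (G : 'M[R]_n) (Z : 'rV[R]_n) (f : R).
Let N := bil G Z Z.
Let f1 := f - 2^-1 * N.
Hypotheses (sG : G^T = G) (N0 : N != 0) (f0 : f != 0) (f10 : f1 != 0).

Let sym u v : bil G u v = bil G v u. Proof. by rewrite -bil_tr sG. Qed.

Definition outer (v : 'rV[R]_n) : 'M[R]_n := (v *m G)^T *m (v *m G).

(** The coefficients come from [f = f1 + N / 2]: the rank-one terms give the factors
    [1 + N / (2 f1) = f / f1] on [Z] and [1 - N / (2 f) = f1 / f] on its three images. *)
Definition hor_metric (J K L : 'M[R]_n) : 'M[R]_n :=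
  G + (2 * f1)^-1 *: outer Z - (2 * f)^-1 *: outer (Z *m J)
  - (2 * f)^-1 *: outer (Z *m K) - (2 * f)^-1 *: outer (Z *m L).

(* Rescales [Z] by [f / f1] and fixes its orthogonal complement. *)
Definition stretch : 'M[R]_n := 1%:M + (2 * f1)^-1 *: (G *m Z^T *m Z).
Definition unstretch : 'M[R]_n := 1%:M - (2 * f)^-1 *: (G *m Z^T *m Z).

(** [J] need not preserve [hor_metric], which rescales [Z] and [Z *m J] by inverse factors.
    Conjugation by [stretch] compensates for this and keeps the quaternion relations. *)
Definition hor_structure (J : 'M[R]_n) : 'M[R]_n := stretch *m J *m unstretch.

Lemma stretchE u : u *m stretch = u + ((2 * f1)^-1 * bil G u Z) *: Z.
Proof.
rewrite mulmxDr mulmx1 -scalemxAr !mulmxA [_ *m Z^T]mx11_scalar mul_scalar_mx.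
by rewrite scalerA.
Qed.

Lemma unstretchE u : u *m unstretch = u - ((2 * f)^-1 * bil G u Z) *: Z.
Proof.
rewrite mulmxBr mulmx1 -scalemxAr !mulmxA [_ *m Z^T]mx11_scalar mul_scalar_mx.
by rewrite scalerA.
Qed.

Lemma unstretchK : unstretch *m stretch = 1%:M.
Proof.
apply: rV_mulmx_inj => u; rewrite mulmxA unstretchE stretchE mulmx1.
rewrite bilDl bilNl bilZl -/N -addrA -scaleNr -scalerDl.
rewrite [X in X *: Z](_ : _ = 0) ?scale0r ?addr0 //.
rewrite /f1; field; rewrite f0 /=; move: f10; rewrite /f1.
by apply: contraNN => /eqP E; apply/eqP; lra.
Qed.

Lemma hor_structure_sq J : J *m J = - 1%:M ->
  hor_structure J *m hor_structure J = - 1%:M.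
Proof.
move=> JJ; rewrite /hor_structure -!mulmxA [unstretch *m _]mulmxA unstretchK.
by rewrite mul1mx [J *m (J *m _)]mulmxA JJ mulNmx mul1mx mulmxN (mulmx1C unstretchK).
Qed.

Lemma hor_structureM J K L : K *m J = L ->
  hor_structure K *m hor_structure J = hor_structure L.
Proof.
move=> KJ; rewrite /hor_structure -!mulmxA [unstretch *m _]mulmxA unstretchK.
by rewrite mul1mx [K *m (J *m _)]mulmxA KJ.
Qed.

Lemma hor_metricE J K L u v : bil (hor_metric J K L) u v =
  bil G u v + (2 * f1)^-1 * (bil G Z u * bil G Z v)
  - (2 * f)^-1 * (bil G (Z *m J) u * bil G (Z *m J) v)
  - (2 * f)^-1 * (bil G (Z *m K) u * bil G (Z *m K) v)
  - (2 * f)^-1 * (bil G (Z *m L) u * bil G (Z *m L) v).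
Proof. by rewrite !(bilDm, bilNm) !bilZm !bil_outer. Qed.

Lemma hor_metric_cycle J K L : hor_metric K L J = hor_metric J K L.
Proof. by apply: bil_inj => u v; rewrite !hor_metricE; ring. Qed.

(** The Kähler form of [J] plus a multiple of the exterior product of [G (Z L, .)] and [G (Z K, .)]:
    the horizontal part of the forms in [cone_identity]. *)
Definition hor_form J K L u v : R := bil G (u *m J) v
  + (2 * f)^-1 * (bil G (Z *m L) u * bil G (Z *m K) v
                  - bil G (Z *m L) v * bil G (Z *m K) u).

Lemma hor_structure_metric J K L u v : hermitian_triple G J K L ->
  bil (hor_structure J *m hor_metric J K L) u v = hor_form J K L u v.
Proof.
move=> h; have [JJ KK LL KJ JK skJ skK skL] := h.
have [_ _ _ LK KL _ _ _] := triple_cycle h.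
have [_ _ _ JL LJ _ _ _] := triple_cycle (triple_cycle h).
have ZJ := triple_skew0 Z sG skJ.
have ZK := triple_skew0 Z sG skK.
have ZL := triple_skew0 Z sG skL.
have NJ : bil G (Z *m J) (Z *m J) = N.
  by rewrite skJ -mulmxA JJ mulmxN mulmx1 bilNr opprK.
have JKo : bil G (Z *m J) (Z *m K) = 0 by rewrite skJ -mulmxA KJ ZL oppr0.
have JLo : bil G (Z *m J) (Z *m L) = 0 by rewrite skJ -mulmxA LJ mulmxN bilNr ZK !oppr0.
rewrite bil_mulmx /hor_structure !mulmxA stretchE unstretchE mulmxDl -scalemxAl.
rewrite hor_metricE !(bilDl, bilDr, bilNl, bilNr, bilZl, bilZr).
rewrite !(sym _ (u *m J)) !skJ -!mulmxA JJ KJ LJ !mulmxN mulmx1 !bilNr.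
rewrite (sym (Z *m K) (Z *m J)) (sym (Z *m L) (Z *m J)) (sym (Z *m K) Z).
rewrite (sym (Z *m L) Z) ?ZJ ?ZK ?ZL ?JKo ?JLo /hor_form skJ.
rewrite !(sym u (Z *m _)) -/N /f1; field.
rewrite f0 /=; move: f10; rewrite /f1.
by apply: contraNN => /eqP E; apply/eqP; lra.
Qed.

(** The four rank-one terms are added one at a time. By orthogonality of [Z], [Z *m J], [Z *m K],
    [Z *m L], the vector treated next has the same pairings as under [G], in particular the same
    square [N], so the sign criterion is that of [f / f1] or [f1 / f] at each stage. *)
Lemma hor_metric_signature J K L p q : hermitian_triple G J K L ->
  has_signature G p q ->
  [/\ 0 < f1 * f -> has_signature (hor_metric J K L) p q,
      0 < f -> f1 < 0 -> has_signature (hor_metric J K L) (p - 4) (q + 4)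
    & f < 0 -> 0 < f1 -> has_signature (hor_metric J K L) (p + 4) (q - 4)].
Proof.
move=> h hG; have [JJ KK LL KJ JK skJ skK skL] := h.
have [_ _ _ LK KL _ _ _] := triple_cycle h.
have [_ _ _ JL LJ _ _ _] := triple_cycle (triple_cycle h).
have ZJ := triple_skew0 Z sG skJ.
have ZK := triple_skew0 Z sG skK.
have ZL := triple_skew0 Z sG skL.
have NJ : bil G (Z *m J) (Z *m J) = N.
  by rewrite skJ -mulmxA JJ mulmxN mulmx1 bilNr opprK.
have NK : bil G (Z *m K) (Z *m K) = N.
  by rewrite skK -mulmxA KK mulmxN mulmx1 bilNr opprK.
have NL : bil G (Z *m L) (Z *m L) = N.
  by rewrite skL -mulmxA LL mulmxN mulmx1 bilNr opprK.
have JKo : bil G (Z *m J) (Z *m K) = 0 by rewrite skJ -mulmxA KJ ZL oppr0.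
have JLo : bil G (Z *m J) (Z *m L) = 0 by rewrite skJ -mulmxA LJ mulmxN bilNr ZK !oppr0.
have KLo : bil G (Z *m K) (Z *m L) = 0 by rewrite skK -mulmxA LK ZJ oppr0.
pose l := (2 * f1)^-1; pose m := - (2 * f)^-1.
pose pert (H : 'M[R]_n) c (v : 'rV[R]_n) := H + c *: ((v *m H)^T *m (v *m H)).
have pertE H c v u w : H^T = H -> bil (pert H c v) u w
    = bil H u w + c * (bil H v u * bil H v w).
  by move=> sH; rewrite bilDm bilZm bil_outer.
have pert_sym H c v : H^T = H -> (pert H c v)^T = pert H c v.
  by move=> sH; rewrite /pert linearD linearZ /= trmx_mul trmxK sH.
pose G1 := pert G l Z; pose G2 := pert G1 m (Z *m J).
pose G3 := pert G2 m (Z *m K); pose G4 := pert G3 m (Z *m L).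
have s1 : G1^T = G1 by exact: pert_sym.
have s2 : G2^T = G2 by exact: pert_sym.
have s3 : G3^T = G3 by exact: pert_sym.
have E1 := fun u w => pertE G l Z u w sG.
have E2 := fun u w => pertE G1 m (Z *m J) u w s1.
have E3 := fun u w => pertE G2 m (Z *m K) u w s2.
have E4 := fun u w => pertE G3 m (Z *m L) u w s3.
rewrite -/G1 -/G2 -/G3 -/G4 in E1 E2 E3 E4.
have KJo : bil G (Z *m K) (Z *m J) = 0 by rewrite sym.
have LJo : bil G (Z *m L) (Z *m J) = 0 by rewrite sym.
have LKo : bil G (Z *m L) (Z *m K) = 0 by rewrite sym.
have e1 w : bil G1 (Z *m J) w = bil G (Z *m J) w by rewrite E1 ZJ; ring.
have e2 w : bil G2 (Z *m K) w = bil G (Z *m K) w.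
  by rewrite E2 !e1 E1 ZK JKo; ring.
have e3 w : bil G3 (Z *m L) w = bil G (Z *m L) w.
  by rewrite E3 !e2 E2 !e1 E1 ZL JLo KLo; ring.
have -> : hor_metric J K L = G4.
  apply: bil_inj => u w; rewrite E4 !e3 E3 !e2 E2 !e1 E1 hor_metricE /l /m; ring.
have r0 : 1 + l * N = f / f1.
  rewrite /l /f1; field; move: f10; rewrite /f1.
  by apply: contraNN => /eqP E; apply/eqP; lra.
have rJ : 1 + m * N = f1 / f by rewrite /m /f1; field.
have N1 : bil G1 (Z *m J) (Z *m J) = N by rewrite e1 NJ.
have N2 : bil G2 (Z *m K) (Z *m K) = N by rewrite e2 NK.
have N3 : bil G3 (Z *m L) (Z *m L) = N by rewrite e3 NL.
have fN : f = f1 + 2^-1 * N by rewrite /f1 subrK.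
have same H v c p' q' : H^T = H -> has_signature H p' q' -> bil H v v = N ->
    0 < 1 + c * N -> has_signature (pert H c v) p' q'.
  move=> sH hH HN cN; rewrite /pert.
  by apply: signature_perturb_same => //; rewrite HN.
have down H v c p' q' : H^T = H -> has_signature H p' q' -> bil H v v = N ->
    0 < N -> 1 + c * N < 0 -> has_signature (pert H c v) p'.-1 q'.+1.
  move=> sH hH HN N0' cN; rewrite -HN in N0' cN.
  by have [] := signature_perturb_down sH hH N0' cN.
have up H v c p' q' : H^T = H -> has_signature H p' q' -> bil H v v = N ->
    N < 0 -> 1 + c * N < 0 -> has_signature (pert H c v) p'.+1 q'.-1.
  move=> sH hH HN N0' cN; rewrite -HN in N0' cN.
  by have [] := signature_perturb_up sH hH N0' cN.
(* Truncation does no harm: [signature_perturb_down] and [signature_perturb_up] show each index to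
   be positive before it is lowered. *)
have sub4 x : (x - 4 = x.-1.-1.-1.-1)%N by rewrite -!subn1 -!subnDA.
split=> [ff|f_pos f1_neg|f_neg f1_pos].
- have [pos0 posJ] : 0 < 1 + l * N /\ 0 < 1 + m * N.
    rewrite r0 rJ; split.
      have -> : f / f1 = f1 * f * f1^-1 ^+ 2 by field.
      by rewrite mulr_gt0 // exprn_even_gt0 // invr_neq0.
    have -> : f1 / f = f1 * f * f^-1 ^+ 2 by field.
    by rewrite mulr_gt0 // exprn_even_gt0 // invr_neq0.
  exact: (same _ _ _ _ _ s3 (same _ _ _ _ _ s2 (same _ _ _ _ _ s1
    (same _ _ _ _ _ sG hG erefl pos0) N1 posJ) N2 posJ) N3 posJ).
- have N_pos : 0 < N by lra.
  have [neg0 negJ] : 1 + l * N < 0 /\ 1 + m * N < 0.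
    by rewrite r0 rJ pmulr_rlt0 // nmulr_rlt0 // invr_lt0 invr_gt0.
  have := down _ _ _ _ _ s3 (down _ _ _ _ _ s2 (down _ _ _ _ _ s1
    (down _ _ _ _ _ sG hG erefl N_pos neg0) N1 N_pos negJ) N2 N_pos negJ)
    N3 N_pos negJ.
  by rewrite sub4 addn4.
- have N_neg : N < 0 by lra.
  have [neg0 negJ] : 1 + l * N < 0 /\ 1 + m * N < 0.
    by rewrite r0 rJ nmulr_rlt0 // pmulr_rlt0 // invr_lt0 invr_gt0.
  have := up _ _ _ _ _ s3 (up _ _ _ _ _ s2 (up _ _ _ _ _ s1
    (up _ _ _ _ _ sG hG erefl N_neg neg0) N1 N_neg negJ) N2 N_neg negJ)
    N3 N_neg negJ.
  by rewrite sub4 addn4.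
Qed.

(** Invertibility is read off from the signature, which is known for every pattern of signs. *)
Lemma hor_metric_unit J K L p q : hermitian_triple G J K L ->
  has_signature G p q -> hor_metric J K L \in unitmx.
Proof.
move=> h hG; have [same down up] := hor_metric_signature h hG.
have [f_neg|f_pos|f_eq] := ltgtP f 0; last by move: f0; rewrite f_eq eqxx.
  have [f1_neg|f1_pos|f1_eq] := ltgtP f1 0; last by move: f10; rewrite f1_eq eqxx.
    by apply: has_signature_unit (same _); rewrite nmulr_rgt0.
  exact: has_signature_unit (up f_neg f1_pos).
have [f1_neg|f1_pos|f1_eq] := ltgtP f1 0; last by move: f10; rewrite f1_eq eqxx.
  exact: has_signature_unit (down f_pos f1_neg).
by apply: has_signature_unit (same _); rewrite mulr_gt0.
Qed.
End horizontal_model.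

(** * Splitting of the cone *)

Lemma linear_rV_mx (R : realType) m n (h : 'rV[R]_m -> 'rV[R]_n) :
  (forall a u v, h (a *: u + v) = a *: h u + h v) ->
  forall u, u *m (\matrix_i h (delta_mx ord0 i)) = h u.
Proof.
move=> lin u; have h0 : h 0 = 0.
  by have := lin (-1) 0 0; rewrite scaler0 addr0 scaleN1r addNr.
rewrite mulmx_sum_row [in RHS](row_sum_delta u).
rewrite (eq_bigr (fun i => u ord0 i *: h (delta_mx ord0 i))) => [|i _].
  by elim/big_rec2: _ => [//|i x y _ ->]; rewrite lin.
by rewrite rowK.
Qed.

Lemma bil_block (R : realType) n1 n2 (A : 'M[R]_n1) (D : 'M[R]_n2)
    (c c' : 'rV[R]_n1) (x x' : 'rV[R]_n2) :
  bil (block_mx A 0 0 D) (row_mx c x) (row_mx c' x') = bil A c c' + bil D x x'.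
Proof.
rewrite /bil mul_row_block !mulmx0 addr0 add0r tr_row_mx mul_row_col.
by rewrite mxE.
Qed.

Section cone_model.
Context {R : realType}.
Implicit Types x y z : 'rV[R]_4.

Definition qi : 'rV[R]_4 := quat 0 1 0 0.
Definition qj : 'rV[R]_4 := quat 0 0 1 0.
Definition qk : 'rV[R]_4 := quat 0 0 0 1.

Definition lmul x : 'M[R]_4 := \matrix_i qmul x (delta_mx ord0 i).

Lemma lmulE x y : y *m lmul x = qmul x y.
Proof.
by apply: (linear_rV_mx (h := qmul x)) => a u v; rewrite qmulDr qmulZr.
Qed.

(** Matrices act on rows from the right, which reverses the order of the factors. *)
Lemma lmulM x y : lmul y *m lmul x = lmul (qmul x y).
Proof. by apply: rV_mulmx_inj => z; rewrite mulmxA !lmulE qmulA. Qed.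

Lemma lmulN1 : lmul (quat (-1) 0 0 0) = - 1%:M.
Proof.
apply: rV_mulmx_inj => z; rewrite lmulE mulmxN mulmx1.
by apply: quat_ext; rewrite !(qcE, qcN); ring.
Qed.

Lemma qi_sq : qmul qi qi = quat (-1) 0 0 0.
Proof. by apply: quat_ext; rewrite !qcE; ring. Qed.
Lemma qj_sq : qmul qj qj = quat (-1) 0 0 0.
Proof. by apply: quat_ext; rewrite !qcE; ring. Qed.
Lemma qij : qmul qi qj = qk.
Proof. by apply: quat_ext; rewrite !qcE; ring. Qed.

Lemma bil_lmul c x y z :
  bil (lmul x *m c%:M) y z = c * qc 0 (qmul (qmul x y) (qconj z)).
Proof.
rewrite bil_mulmx lmulE /bil mul_mx_scalar -scalemxAl mxE; congr (_ * _).
move: (qmul x y) => w; rewrite mxE !big_ord_recr big_ord0 /= !mxE !qcE.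
have E (k : 'I_4) (u : 'rV[R]_4) : u ord0 k = qc k u by rewrite /qc inord_val.
by rewrite !E /=; ring.
Qed.

Lemma qconjM x y : qconj (qmul x y) = qmul (qconj y) (qconj x).
Proof. by apply: quat_ext; rewrite !qcE; ring. Qed.

(** This is [Ad_q] multiplied by [qnorm2 q], which makes it polynomial in [q]. *)
Definition qrot (q x : 'rV[R]_4) := qmul (qmul q x) (qconj q).

(** A real quaternion is only multiplied by [qnorm2 q], so the real part of [x] never reaches the
    imaginary components. *)
Lemma qrot_imag q x :
  let y := quat 0 (qc 1 x) (qc 2 x) (qc 3 x) in
  [/\ qc 1 (qrot q x) = qc 1 (qrot q y), qc 2 (qrot q x) = qc 2 (qrot q y)
    & qc 3 (qrot q x) = qc 3 (qrot q y)].
Proof. by split; rewrite /qrot !qcE; ring. Qed.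

(* The polynomial [omega~ / rho^2] written in the splitting of the tangent
   space into the fibre and its orthogonal complement. *)
Lemma cone_identity (c1 c2 : 'rV[R]_4) (f s1 s2 x1 y1 z1 x2 y2 z2 D1 D2 D3 : R) :
  let a1 := c1 + quat x1 (- s1) (- z1) y1 in
  let a2 := c2 + quat x2 (- s2) (- z2) y2 in
  let b1 := quat 0 (s1 * f) (f * z1) (- (f * y1)) in
  let b2 := quat 0 (s2 * f) (f * z2) (- (f * y2)) in
  let d := quat 0 (D1 + 2 * f * (s1 * x2 - s2 * x1))
    (D2 + 2 * f * (s1 * y2 - s2 * y1)) (D3 + 2 * f * (s1 * z2 - s2 * z1)) in
  let F := (- (2 * f * x1)) *: a2 - (- (2 * f * x2)) *: a1
    + qmul a1 b2 - qmul a2 b1 + d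
    + qmul (f *: a2 + b2) (qconj a1) - qmul (f *: a1 + b1) (qconj a2) in
  [/\ qc 1 F = 2 * f * qc 0 (qmul (qmul qi c1) (qconj c2))
        + (D1 + 2 * f * (z1 * y2 - z2 * y1)),
      qc 2 F = 2 * f * qc 0 (qmul (qmul qj c1) (qconj c2))
        + (D2 + 2 * f * (x1 * z2 - x2 * z1))
    & qc 3 F = 2 * f * qc 0 (qmul (qmul qk c1) (qconj c2))
        + (D3 + 2 * f * (y1 * x2 - y2 * x1))].
Proof. by split; rewrite !(qcD, qcN, qcZ, qcE); ring. Qed.

Lemma qmulNr x y : qmul x (- y) = - qmul x y.
Proof. by rewrite -scaleN1r qmulZr scaleN1r. Qed.

(** In the left trivialisation of [H^*], where tangent vectors are [q a], the whole dependence on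
    [q] is the outer rotation. *)
Lemma cone_left_factor (q a1 a2 b1 b2 d : 'rV[R]_4) (s t f : R) :
  qmul (s *: qmul q a2 - t *: qmul q a1 + qmul (qmul q a1) b2
        - qmul (qmul q a2) b1 + qmul q d) (qconj q)
  + qmul (f *: qmul q a2 + qmul q b2) (qconj (qmul q a1))
  - qmul (f *: qmul q a1 + qmul q b1) (qconj (qmul q a2))
  = qrot q (s *: a2 - t *: a1 + qmul a1 b2 - qmul a2 b1 + d
            + qmul (f *: a2 + b2) (qconj a1) - qmul (f *: a1 + b1) (qconj a2)).
Proof.
rewrite /qrot !(qconjM, qmulDl, qmulDr, qmulNl, qmulNr, qmulZl, qmulZr, qmulA).
do ?[move: (qmul _ _) => ?]; apply/rowP => i; rewrite !mxE; ring.
Qed.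

Context {n m : nat}.
Variables (G J1 J2 J3 : 'M[R]_n) (Z : 'rV[R]_n) (f : R).
Let N := bil G Z Z.
Let f1 := f - 2^-1 * N.
Hypotheses (sG : G^T = G) (N0 : N != 0) (f0 : f != 0) (f10 : f1 != 0).
Hypothesis hJ : hermitian_triple G J1 J2 J3.

(** Up to the factor [qnorm2 q] this will be [ghat], with [2 f] times the Euclidean metric on the
    quaternionic fibre. *)
Definition model_metric : 'M[R]_(4 + n) :=
  block_mx (2 * f)%:M 0 0 (hor_metric G Z f J1 J2 J3).
Definition model_structure (x : 'rV[R]_4) (J : 'M[R]_n) : 'M[R]_(4 + n) :=
  block_mx (lmul x) 0 0 (hor_structure G Z f J).

Lemma model_structureM x y J K L : K *m J = L ->
  model_structure y K *m model_structure x J = model_structure (qmul x y) L.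
Proof.
move=> KJ; rewrite mulmx_block !mulmx0 !mul0mx !addr0 !add0r lmulM.
by rewrite (hor_structureM f0 f10 KJ).
Qed.

Lemma model_structure_sq x J : qmul x x = quat (-1) 0 0 0 -> J *m J = - 1%:M ->
  model_structure x J *m model_structure x J = - 1%:M.
Proof.
move=> xx JJ; rewrite mulmx_block !mulmx0 !mul0mx !addr0 !add0r lmulM xx lmulN1.
by rewrite (hor_structure_sq f0 f10 JJ) scalar_mx_block opp_block_mx !oppr0.
Qed.

Definition model_form x J K L (w w' : 'rV[R]_(4 + n)) : R :=
  2 * f * qc 0 (qmul (qmul x (lsubmx w)) (qconj (lsubmx w')))
  + hor_form G Z f J K L (rsubmx w) (rsubmx w').

Lemma model_structure_metric x J K L w w' : hermitian_triple G J K L ->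
  hor_metric G Z f J K L = hor_metric G Z f J1 J2 J3 ->
  bil (model_structure x J *m model_metric) w w' = model_form x J K L w w'.
Proof.
move=> h hE; rewrite mulmx_block !mulmx0 !mul0mx !addr0 !add0r.
rewrite -{1}[w]hsubmxK -{1}[w']hsubmxK bil_block bil_lmul -hE.
by rewrite (hor_structure_metric sG f0 f10).
Qed.

(* The tangent vector [w] of [H^* x P] modulo [V_1], in the splitting into the
   fibre and its orthogonal complement. *)
Variables (q : 'rV[R]_4) (T : 'M[R]_(m, n)) (th1 : 'rV[R]_m -> R).
Hypothesis q0 : q != 0.
Hypothesis th1_lin : forall a u v, th1 (a *: u + v) = a * th1 u + th1 v.

Definition coeff (J : 'M[R]_n) (w : 'rV[R]_m) : R :=
  (2 * f)^-1 * bil G (Z *m J) (w *m T).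

(** The terms in [th1] send [V1] to 0, since [th1] takes the value [- (f1 + N / 2) = - f] on its [P]
    component. The terms in [coeff] remove the cross terms between the fibre and its complement. *)
Definition split_map (w : 'rV[R]_(4 + m)) : 'rV[R]_(4 + n) :=
  let v := rsubmx w in
  row_mx (qmul (qinv q) (lsubmx w)
          - quat (coeff J1 v) (- (th1 v / f)) (- coeff J3 v) (coeff J2 v))
    (v *m T - (th1 v / f) *: Z).

Lemma coeffP J a u v : coeff J (a *: u + v) = a * coeff J u + coeff J v.
Proof. by rewrite /coeff mulmxDl -scalemxAl bilDr bilZr; ring. Qed.

Lemma split_map_lin a u v :
  split_map (a *: u + v) = a *: split_map u + split_map v.
Proof.
rewrite /split_map scale_row_mx add_row_mx !linearP /=; congr row_mx.
  rewrite qmulDr qmulZr scalerBr addrACA -opprD; congr (_ - _).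
  by apply: quat_ext; rewrite !(qcD, qcZ, qcE) ?coeffP ?th1_lin //; ring.
rewrite th1_lin mulmxDl -scalemxAl scalerBr addrACA -opprD scalerA -scalerDl.
by rewrite mulrDl mulrA.
Qed.

Definition split_mx : 'M[R]_(4 + m, 4 + n) :=
  \matrix_i split_map (delta_mx ord0 i).

Lemma split_mxE w : w *m split_mx = split_map w.
Proof. exact: linear_rV_mx split_map_lin w. Qed.

Lemma qmul_qinv x : qmul q (qmul (qinv q) x) = x.
Proof.
have q20 := lt0r_neq0 (qnorm2_gt0 q0).
rewrite /qinv qmulA qmulZr.
have -> : (qnorm2 q)^-1 *: qmul q (quat (qc 0 q) (- qc 1 q) (- qc 2 q) (- qc 3 q))
   = quat 1 0 0 0.
  by apply: quat_ext; rewrite qcZ !qcE; rewrite /qnorm2 in q20 *; field.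
by apply: quat_ext; rewrite !qcE; ring.
Qed.

(** [W] is the quaternion of [omega_tildeE] with the values of [df], theta and its differential
    filled in. Writing [lsubmx w] as [q] times a quaternion and extracting [q] reduces it to
    [cone_identity]; by [qrot_imag] only the imaginary part of [F] matters. *)
Lemma split_form u v :
  let df w := - bil G (Z *m J1) (rsubmx w *m T) in
  let b w := quat 0 (th1 (rsubmx w)) (2^-1 * bil G (Z *m J3) (rsubmx w *m T))
     (- 2^-1 * bil G (Z *m J2) (rsubmx w *m T)) in
  let D J := bil G (rsubmx u *m T *m J) (rsubmx v *m T) in
  let W := qmul (df u *: lsubmx v - df v *: lsubmx u
          + qmul (lsubmx u) (b v) - qmul (lsubmx v) (b u)
          + qmul q (quat 0 (D J1) (D J2) (D J3))) (qconj q)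
    + qmul (f *: lsubmx v + qmul q (b v)) (qconj (lsubmx u))
    - qmul (f *: lsubmx u + qmul q (b u)) (qconj (lsubmx v)) in
  exists2 F, W = qrot q F &
    [/\ qc 1 F = model_form qi J1 J2 J3 (split_map u) (split_map v),
        qc 2 F = model_form qj J2 J3 J1 (split_map u) (split_map v)
      & qc 3 F = model_form qk J3 J1 J2 (split_map u) (split_map v)].
Proof.
move=> df b D W.
pose a (w : 'rV[R]_(4 + m)) := qmul (qinv q) (lsubmx w) : 'rV[R]_4.
have aE (w : 'rV[R]_(4 + m)) : lsubmx w = qmul q (a w) by rewrite qmul_qinv.
rewrite /W !aE cone_left_factor; eexists; first by [].
have [JJ KK LL KJ JK skJ skK skL] := hJ.
have ZJ := triple_skew0 Z sG skJ.
have ZK := triple_skew0 Z sG skK.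
have ZL := triple_skew0 Z sG skL.
have sym (x y : 'rV[R]_n) : bil G x y = bil G y x by rewrite -bil_tr sG.
pose s (w : 'rV[R]_(4 + m)) := th1 (rsubmx w) / f.
pose c (w : 'rV[R]_(4 + m)) := lsubmx (split_map w).
pose X (w : 'rV[R]_(4 + m)) := rsubmx (split_map w).
have XE (w : 'rV[R]_(4 + m)) : X w = rsubmx w *m T - s w *: Z by exact: row_mxKr.
have cE (w : 'rV[R]_(4 + m)) : a w = c w + quat (coeff J1 (rsubmx w)) (- s w)
    (- coeff J3 (rsubmx w)) (coeff J2 (rsubmx w)).
  by rewrite /c /split_map row_mxKl subrK.
have bE (w : 'rV[R]_(4 + m)) : b w = quat 0 (s w * f) (f * coeff J3 (rsubmx w))
    (- (f * coeff J2 (rsubmx w))).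
  by rewrite /b /s /coeff; apply: quat_ext; rewrite !qcE //; field.
have dfE (w : 'rV[R]_(4 + m)) : df w = - (2 * f * coeff J1 (rsubmx w)).
  by rewrite /df /coeff; field.
have coE J (w : 'rV[R]_(4 + m)) : bil G Z (Z *m J) = 0 ->
    bil G (Z *m J) (X w) = 2 * f * coeff J (rsubmx w).
  move=> Z0; rewrite XE bilDr bilNr bilZr (sym _ Z) Z0 /coeff.
  by field.
have DE J : (forall x y : 'rV[R]_n, bil G (x *m J) y = - bil G x (y *m J)) ->
    D J = bil G (X u *m J) (X v) + 2 * f * (s u * coeff J (rsubmx v)
       - s v * coeff J (rsubmx u)).
  move=> sk; have Z0 := triple_skew0 Z sG sk.
  have uE (w : 'rV[R]_(4 + m)) : rsubmx w *m T = X w + s w *: Z by rewrite XE subrK.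
  rewrite /D !uE mulmxDl -scalemxAl !(bilDl, bilDr, bilZl, bilZr).
  rewrite (sym (Z *m J) Z) Z0 (sk (X u) Z) (sym (X u)) !coE //.
  by ring.
rewrite !bE !cE !dfE !DE //.
have [E1 E2 E3] := cone_identity (c u) (c v) f (s u) (s v)
  (coeff J1 (rsubmx u)) (coeff J2 (rsubmx u)) (coeff J3 (rsubmx u))
  (coeff J1 (rsubmx v)) (coeff J2 (rsubmx v)) (coeff J3 (rsubmx v))
  (bil G (X u *m J1) (X v)) (bil G (X u *m J2) (X v)) (bil G (X u *m J3) (X v)).
rewrite /model_form -/(c u) -/(c v) -/(X u) -/(X v) /hor_form !coE //.
have cl (A B x y z w : R) : A + (B + 2 * f * (x * y - z * w))
    = A + (B + (2 * f)^-1 * (2 * f * x * (2 * f * y) - 2 * f * z * (2 * f * w))).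
  by field.
by split; [apply: etrans E1 _|apply: etrans E2 _|apply: etrans E3 _]; exact: cl.
Qed.

End cone_model.

(** * Reconstruction of the metric from its Kähler forms *)

Section rigidity.
Context {R : realType}.

(* The metric is determined by its three Kähler forms:
   [G = W2 *m invmx W1 *m W3]. *)
Lemma triple_unique n (G G' J1 J2 J3 A1 A2 A3 : 'M[R]_n) :
  J1 *m J1 = - 1%:M -> J3 *m J3 = - 1%:M -> J2 *m J1 = J3 ->
  A1 *m A1 = - 1%:M -> A3 *m A3 = - 1%:M -> A2 *m A1 = A3 ->
  A1 *m G' \in unitmx ->
  J1 *m G = A1 *m G' -> J2 *m G = A2 *m G' -> J3 *m G = A3 *m G' -> G = G'.
Proof.
move=> J11 J33 J21 A11 A33 A21 uW E1 E2 E3.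
have key (H K1 K2 K3 : 'M[R]_n) : K1 *m K1 = - 1%:M -> K3 *m K3 = - 1%:M ->
    K2 *m K1 = K3 -> K1 *m H \in unitmx ->
    H = K2 *m H *m invmx (K1 *m H) *m (K3 *m H).
  move=> K11 K33 K21 uH.
  have -> : K2 *m H = - K3 *m (K1 *m H).
    by rewrite mulNmx mulmxA -K21 -[K2 *m K1 *m K1]mulmxA K11 mulmxN mulmx1
      mulNmx opprK.
  by rewrite mulmxK // mulNmx mulmxA K33 mulNmx mul1mx opprK.
rewrite (key G J1 J2 J3) ?E1 // E2 E3 -key //.
Qed.

Definition rot_coeff (q : 'rV[R]_4) (k : nat) (x : 'rV[R]_4) : R := qc k (qrot q x).

(** The forms at [q] are combinations of the model forms with the coefficients of [qrot q]; this is
    the same combination of the structures. *)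
Definition rot_mx n (q : 'rV[R]_4) k (A1 A2 A3 : 'M[R]_n) : 'M[R]_n :=
  rot_coeff q k qi *: A1 + rot_coeff q k qj *: A2 + rot_coeff q k qk *: A3.

(** On imaginary quaternions [qrot q] is [qnorm2 q] times a rotation, and rotations preserve both
    the scalar and the vector product. *)
Lemma rot_mxP n (q : 'rV[R]_4) (A1 A2 A3 : 'M[R]_n) :
  A1 *m A1 = - 1%:M -> A2 *m A2 = - 1%:M -> A3 *m A3 = - 1%:M ->
  A2 *m A1 = A3 ->
  let C k := rot_mx q k A1 A2 A3 in
  [/\ C 1%N *m C 1%N = - (qnorm2 q ^+ 2)%:M,
      C 3%N *m C 3%N = - (qnorm2 q ^+ 2)%:M
    & C 2%N *m C 1%N = qnorm2 q *: C 3%N].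
Proof.
move=> s1 s2 s3 m21.
have m13 : A1 *m A3 = A2.
  apply: oppr_inj; rewrite -[A1 *m A3]mul1mx -mulNmx -s2 -!mulmxA.
  by rewrite [A2 *m (A1 *m A3)]mulmxA m21 s3 mulmxN mulmx1.
have m12 : A1 *m A2 = - A3.
  by rewrite -m21 -[in RHS]m13 -m21 -!mulmxA s1 !mulmxN mulmx1 opprK.
have m32 : A3 *m A2 = A1.
  by rewrite -[A3]opprK -m12 mulNmx -mulmxA s2 mulmxN mulmx1 opprK.
have m23 : A2 *m A3 = - A1 by rewrite -m21 mulmxA s2 mulNmx mul1mx.
have m31 : A3 *m A1 = - A2 by rewrite -m21 -mulmxA s1 mulmxN mulmx1.
have mul a b c a' b' c' : (a *: A1 + b *: A2 + c *: A3) *m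
    (a' *: A1 + b' *: A2 + c' *: A3)
    = - (a * a' + b * b' + c * c')%:M + (b * c' - c * b') *: - A1
      + (c * a' - a * c') *: - A2 + (a * b' - b * a') *: - A3.
  rewrite !(mulmxDl, mulmxDr) -!(scalemxAl, scalemxAr) s1 s2 s3 m21 m12 m32 m23 m13 m31.
  apply/matrixP => i j; rewrite !mxE.
  by case: (i == j); rewrite /= ?mulr1n ?mulr0n; ring.
split; rewrite /rot_mx mul /rot_coeff; apply/matrixP => i j;
  rewrite !mxE /qrot /qnorm2 !qcE;
  case: (i == j); rewrite /= ?mulr1n ?mulr0n; ring.
Qed.

Lemma rot_imag (q x : 'rV[R]_4) k : rot_coeff q k (quat 0 (qc 1 x) (qc 2 x) (qc 3 x))
  = rot_coeff q k qi * qc 1 x + rot_coeff q k qj * qc 2 x + rot_coeff q k qk * qc 3 x.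
Proof.
have -> : quat 0 (qc 1 x) (qc 2 x) (qc 3 x)
    = qc 1 x *: qi + qc 2 x *: qj + qc 3 x *: qk.
  by apply: quat_ext; rewrite !(qcD, qcZ, qcE); ring.
rewrite /rot_coeff /qrot !(qmulDr, qmulDl, qmulZr, qmulZl) !(qcD, qcZ); ring.
Qed.

(** * Transport of the model to a quotient *)

Section quotient_metric.
Variables (r d e : nat) (q : 'rV[R]_4).
Variables (tau : 'M[R]_(r, d)) (L : 'M[R]_(r, e)).
Variables (G J1 J2 J3 : 'M[R]_d) (S A1 A2 A3 : 'M[R]_e).
Hypotheses (de : d = e) (q0 : q != 0) (full : row_full tau).
Hypotheses (uG : G \in unitmx) (uS : S \in unitmx).
Hypotheses (J11 : J1 *m J1 = - 1%:M) (J33 : J3 *m J3 = - 1%:M)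
  (J21 : J2 *m J1 = J3).
Hypotheses (A11 : A1 *m A1 = - 1%:M) (A22 : A2 *m A2 = - 1%:M)
  (A33 : A3 *m A3 = - 1%:M) (A21 : A2 *m A1 = A3).
Let C k := rot_mx q k A1 A2 A3.
Hypotheses
  (E1 : forall u v, bil G (u *m tau *m J1) (v *m tau)
     = bil (C 1%N *m S) (u *m L) (v *m L))
  (E2 : forall u v, bil G (u *m tau *m J2) (v *m tau)
     = bil (C 2%N *m S) (u *m L) (v *m L))
  (E3 : forall u v, bil G (u *m tau *m J3) (v *m tau)
     = bil (C 3%N *m S) (u *m L) (v *m L)).

(** A section [s] of [tau] turns [L] into a matrix [E] through which the nondegenerate form
    [J1 *m G] factors. As [d = e], [E] is invertible; its inverse [B] carries the model forms to
    those of the quotient, and [triple_unique] yields the metric. *)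
Lemma quotient_metric : exists B : 'M[R]_(e, d),
  [/\ B *m G *m B^T = qnorm2 q *: S, tau = L *m B
    & [/\ B *m (J1 *m G) *m B^T = C 1%N *m S,
          B *m (J2 *m G) *m B^T = C 2%N *m S
        & B *m (J3 *m G) *m B^T = C 3%N *m S]].
Proof.
have q2 := qnorm2_gt0 q0; have q20 := lt0r_neq0 q2.
have [C11 C33 C21] := rot_mxP q A11 A22 A33 A21.
rewrite -!/(C _) in C11 C33 C21.
have bil_rect (H : 'M[R]_d) (H' : 'M[R]_e) a (X : 'M[R]_(a, d)) (Y : 'M[R]_(a, e)) :
    (forall u v, bil H (u *m X) (v *m X) = bil H' (u *m Y) (v *m Y)) ->
    X *m H *m X^T = Y *m H' *m Y^T.
  move=> XY; apply: bil_inj => u v; move: (XY u v).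
  by rewrite /bil !trmx_mul !mulmxA.
have T1 : tau *m (J1 *m G) *m tau^T = L *m (C 1%N *m S) *m L^T.
  by apply: bil_rect => u v; rewrite bil_mulmx E1.
have T2 : tau *m (J2 *m G) *m tau^T = L *m (C 2%N *m S) *m L^T.
  by apply: bil_rect => u v; rewrite bil_mulmx E2.
have T3 : tau *m (J3 *m G) *m tau^T = L *m (C 3%N *m S) *m L^T.
  by apply: bil_rect => u v; rewrite bil_mulmx E3.
have [s st] := row_fullP full.
have [E EE] : exists E, E = s *m L by exists (s *m L).
have TE H H' : tau *m H *m tau^T = L *m H' *m L^T -> H = E *m H' *m E^T.
  move=> TT; rewrite EE.
  have -> : s *m L *m H' *m (s *m L)^T = s *m (L *m H' *m L^T) *m s^T.
    by rewrite trmx_mul !mulmxA.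
  by rewrite -TT !mulmxA st mul1mx -mulmxA -trmx_mul st trmx1 mulmx1.
have uC : C 1%N \in unitmx.
  suff /mulmx1_unit[] : C 1%N *m (- (qnorm2 q ^+ 2)^-1 *: C 1%N) = 1%:M by [].
  rewrite -scalemxAr C11 scalerN scaleNr opprK scale_scalar_mx mulVf //.
  by rewrite expf_neq0.
have uJ1 : J1 \in unitmx.
  suff /mulmx1_unit[] : J1 *m - J1 = 1%:M by [].
  by rewrite mulmxN J11 opprK.
have uW1 : J1 *m G \in unitmx by rewrite unitmx_mul uJ1.
have fE : row_free E.
  apply/row_freeP; exists (C 1%N *m S *m E^T *m invmx (J1 *m G)).
  by rewrite !mulmxA -[E *m C 1%N *m S]mulmxA -(TE _ _ T1) mulmxV.
have [B BE] : exists B, B *m E = 1%:M.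
  by apply/row_fullP; rewrite /row_full (eqP fE) de.
have EB : E *m B = 1%:M.
  have [Y EY] := row_freeP fE.
  by rewrite -[B]mulmx1 -EY [B *m _]mulmxA BE mul1mx.
have BTE H H' : tau *m H *m tau^T = L *m H' *m L^T -> B *m H *m B^T = H'.
  move=> /TE ->; rewrite !mulmxA BE mul1mx -mulmxA -trmx_mul BE.
  by rewrite trmx1 mulmx1.
have tauE : tau = L *m B.
  have uM : C 1%N *m S \in unitmx by rewrite unitmx_mul uC.
  (* Up to sign [D] projects onto the kernel of [tau], so [D *m L = 0] says that [L] kills this
     kernel. *)
  pose D := tau *m s - 1%:M.
  have Dt : D *m tau = 0 by rewrite mulmxBl -mulmxA st mulmx1 mul1mx subrr.
  have DL : D *m L *m (C 1%N *m S) *m E^T = 0.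
    have -> : D *m L *m (C 1%N *m S) *m E^T
        = D *m (L *m (C 1%N *m S) *m L^T) *m s^T.
      by rewrite EE trmx_mul !mulmxA.
    by rewrite -T1 !mulmxA Dt !mul0mx.
  have {}DL : D *m L = 0.
    have : D *m L *m (C 1%N *m S) *m E^T *m B^T = 0 by rewrite DL mul0mx.
    rewrite -[_ *m E^T *m B^T]mulmxA -trmx_mul BE trmx1 mulmx1 => DM.
    by rewrite -[D *m L](mulmxK uM) DM mul0mx.
  have -> : L = tau *m E.
    apply/eqP; rewrite eq_sym -subr_eq0 EE mulmxA -[X in _ - X]mul1mx -mulmxBl.
    by rewrite -/D DL.
  by rewrite -mulmxA EB mulmx1.
exists B; split => //; last by split; [apply: BTE T1|apply: BTE T2|apply: BTE T3].
have BB (H K : 'M[R]_d) : B *m H *m E *m (B *m K *m E) = B *m (H *m K) *m E.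
  by rewrite !mulmxA -[B *m H *m E *m B]mulmxA EB mulmx1.
have BG H : B *m H *m E *m (B *m G *m B^T) = B *m (H *m G) *m B^T.
  by rewrite !mulmxA -[B *m H *m E *m B]mulmxA EB mulmx1.
have sc k : (qnorm2 q)^-1 *: C k *m (qnorm2 q *: S) = C k *m S.
  by rewrite -scalemxAl -scalemxAr scalerA mulVf // scale1r.
(* The structures of the quotient, transported by [B], are compared with the rotated triple divided
   by [qnorm2 q], which again satisfies the quaternion relations. *)
apply: (@triple_unique _ _ _ (B *m J1 *m E) (B *m J2 *m E) (B *m J3 *m E)
  ((qnorm2 q)^-1 *: C 1%N) ((qnorm2 q)^-1 *: C 2%N) ((qnorm2 q)^-1 *: C 3%N)).
- by rewrite BB J11 mulmxN mulmx1 mulNmx BE.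
- by rewrite BB J33 mulmxN mulmx1 mulNmx BE.
- by rewrite BB J21.
- rewrite -scalemxAl -scalemxAr C11 !scalerN scalerA scale_scalar_mx.
  by congr (- _%:M); field.
- rewrite -scalemxAl -scalemxAr C33 !scalerN scalerA scale_scalar_mx.
  by congr (- _%:M); field.
- by rewrite -scalemxAl -scalemxAr C21 !scalerA -mulrA mulVf // mulr1.
- by rewrite sc unitmx_mul uC.
- by rewrite BG sc (BTE _ _ T1).
- by rewrite BG sc (BTE _ _ T2).
- by rewrite BG sc (BTE _ _ T3).
Qed.

End quotient_metric.
End rigidity.

(** * Signature of the quotient *)

(** A basis normalised for [S] is carried over by [P] and divided by the square root of [s]; it is a
    basis because the resulting Gram matrix is invertible. *)
Lemma has_signature_scale (R : realType) n (G S P : 'M[R]_n) (s : R) p q :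
  0 < s -> (forall u v, bil G (u *m P) (v *m P) = s * bil S u v) ->
  has_signature S p q -> has_signature G p q.
Proof.
move=> s0 GS [pq [B uB BS]].
apply: (@has_signatureI _ _ _ _ _ ((Num.sqrt s)^-1 *: (B *m P))) => //.
rewrite -BS; apply: bil_inj => u v.
rewrite !bil_congr -!scalemxAr bilZl bilZr !mulmxA GS.
have r2 : Num.sqrt s ^+ 2 = s by rewrite sqr_sqrtr // ltW.
have r0 : Num.sqrt s != 0 by rewrite gt_eqF // sqrtr_gt0.
by move: r2 r0; move: (Num.sqrt s) => r <- r0; field.
Qed.

Lemma continuous_loc_fun (R : realType) n (M : charted R n) (h : M -> R) :
  is_manifold M ->
  (forall a, differentiable (loc_fun h a) (chart a a)) -> continuous (h : M -> R^o).
Proof.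
move=> hM dh a; have aa := cdom_refl hM a.
have ch : {for a, continuous (loc_fun h a \o chart a)}.
  apply: continuous_comp; first exact: chart_continuous hM _ _ aa.
  exact: differentiable_continuous.
rewrite /prop_for /continuous_at /= /loc_fun chartK // in ch.
apply: cvg_trans ch; apply: near_eq_cvg.
have : nbhs a (cdom a) by apply: open_nbhs_nbhs; split => //; exact: cdom_open.
by apply: filterS => x ax /=; rewrite chartK.
Qed.

(** As [h] has no zero, the conditions [0 < h] and [0 <= h] define the same set, which is therefore
    both open and closed. *)
Lemma positive_everywhere (R : realType) n (M : charted R n) (h : M -> R) :
  is_manifold M -> continuous (h : M -> R^o) -> (forall x, h x != 0) ->
  forall x y, 0 < h x -> 0 < h y.
Proof.
move=> hM ch h0 x y hx.
have := manifold_connected hM; move=> /(_ [set z | 0 < h z]) H.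
have E : [set z | 0 < h z] = [set: M].
  apply: H; first by exists x.
  - exists [set z | 0 < h z]; last by rewrite setTI.
    by apply: (@open_comp _ _ (h : M -> R^o) [set t | 0 < t]);
      [move=> ? _; exact: ch | exact: open_gt].
  - exists [set z | 0 <= h z]; last first.
      by rewrite setTI; apply/seteqP; split => z /=; [exact: ltW | rewrite lt_def h0].
    by apply: (@closed_comp _ _ (h : M -> R^o) [set t | 0 <= t]);
      [move=> ? _; exact: ch | exact: closed_ge].
by have : [set: M] y by []; rewrite -E.
Qed.

Lemma sign_constant (R : realType) n (M : charted R n) (h : M -> R) :
  is_manifold M -> continuous (h : M -> R^o) -> (forall x, h x != 0) ->
  forall x y, (0 < h x) = (0 < h y) /\ (h x < 0) = (h y < 0).
Proof.
move=> hM ch h0 x y; have pos := positive_everywhere hM ch h0.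
have xy : (0 < h x) = (0 < h y) by apply/idP/idP; exact: pos.
by split=> //; rewrite !lt_neqAle !h0 /= !leNgt xy.
Qed.

Lemma model_metric_unit (R : realType) n (G J1 J2 J3 : 'M[R]_n) (Z : 'rV[R]_n) f :
  f != 0 -> hor_metric G Z f J1 J2 J3 \in unitmx ->
  model_metric G J1 J2 J3 Z f \in unitmx.
Proof.
move=> f0 uS; rewrite unitmxE det_ublock unitrM -!unitmxE uS andbT.
by rewrite unitmxE det_scalar unitrX // unitfE mulf_neq0.
Qed.

Section fibre.
Context {R : realType} {n m : nat}.
Context (P : charted R m) (M : charted R n).
Variables (g J1 J2 J3 : M -> 'M[R]_n) (Z : M -> 'rV[R]_n) (f : M -> R).
Variables (proj : P -> M) (eta : P -> 'rV[R]_m -> R).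

Lemma thetaE : theta g J2 J3 Z f proj eta = fun p v =>
  ((f \o proj) p)^-1 *: imag_form (thetaP1 g Z proj eta) (thetaP2 g J3 Z proj)
    (thetaP3 g J2 Z proj) p v.
Proof.
by apply/funext => p; apply/funext => v; rewrite /theta /imag_form /thetaP3 mulNr.
Qed.

End fibre.

(** * The cone metric at a point, split into fibre and complement *)

Section conical_metric.
Context {R : realType} {n m d : nat} (M : charted R n) (P : charted R m)
  (Mhat : charted R d).
Variables (g J1 J2 J3 : M -> 'M[R]_n) (Z : M -> 'rV[R]_n) (f : M -> R).
Variables (proj : P -> M) (eta : P -> 'rV[R]_m -> R).
Hypotheses (M_manifold : is_manifold M) (P_manifold : is_manifold P)
  (M_hk : pseudo_hyper_kahler g J1 J2 J3).
Hypothesis proj_smooth : smooth_map_on setT proj.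
Hypothesis Z_smooth : smooth_field_on setT (loc_vec Z).
Hypothesis Z_killing : forall x u v, lie_bil Z g x u v = 0.
Hypothesis Z_neq0 : forall x, bil (g x) (Z x) (Z x) != 0.
Hypothesis Z_J2 : forall x v, lie_end Z J2 x v = - 2 *: (v *m J3 x).
Hypothesis f_smooth : smooth_field_on setT (loc_fun f).
Hypothesis f_neq0 : forall x, f x != 0.
Hypothesis f_d : forall x u, fun_d f x u = - kahler_form g J1 x (Z x) u.
Hypothesis f1_neq0 : forall x, f x - 2^-1 * bil (g x) (Z x) (Z x) != 0.
Hypothesis eta_form : one_form eta.
Hypothesis eta_curvature : forall p u v,
     ext_d eta p u v
     = kahler_form g J1 (proj p) (u *m tangent proj p) (v *m tangent proj p)
       - 2^-1 * ext_d (fun x w => bil (g x) (Z x) w) (proj p)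
                  (u *m tangent proj p) (v *m tangent proj p).
Variable X : prod_charted (Hstar R) P.
Let q : 'rV[R]_4 := set_val X.1.
Let p : P := X.2.
Let x := proj p.
Let q0 : q != 0 := quat_neq0 X.1.
Let th1 := thetaP1 g Z proj eta p.
Let th1_lin a u v : th1 (a *: u + v) = a * th1 u + th1 v.
Proof.
rewrite /th1 /thetaP1 eta_form.1 mulmxDl -scalemxAl bilDr bilZr; ring.
Qed.

Let sG : (g x)^T = g x := Defs.metric_sym (hk_metric M_hk) x.
Let hJ := hk_triple M_hk x.

Definition point_split : 'M[R]_(4 + m, 4 + n) :=
  split_mx (g x) (J1 x) (J2 x) (J3 x) (Z x) (f x) q (tangent proj p) th1.
Definition point_metric : 'M[R]_(4 + n) :=
  model_metric (g x) (J1 x) (J2 x) (J3 x) (Z x) (f x).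
Definition point_structure (c : 'rV[R]_4) (J : M -> 'M[R]_n) : 'M[R]_(4 + n) :=
  model_structure (g x) (Z x) (f x) c (J x).

Let A1 := point_structure qi J1.
Let A2 := point_structure qj J2.
Let A3 := point_structure qk J3.
Let omega := omega_tilde (f \o proj) (theta g J2 J3 Z f proj eta).

Lemma point_structure_metric (w w' : 'rV[R]_(4 + n)) :
  [/\ bil (A1 *m point_metric) w w'
        = model_form (g x) (Z x) (f x) qi (J1 x) (J2 x) (J3 x) w w',
      bil (A2 *m point_metric) w w'
        = model_form (g x) (Z x) (f x) qj (J2 x) (J3 x) (J1 x) w w'
    & bil (A3 *m point_metric) w w'
        = model_form (g x) (Z x) (f x) qk (J3 x) (J1 x) (J2 x) w w'].
Proof.
split; apply: model_structure_metric => //.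
- exact: triple_cycle.
- exact: hor_metric_cycle.
- exact: triple_cycle (triple_cycle hJ).
- by apply: etrans (hor_metric_cycle _ _ _ _ _ _) (hor_metric_cycle _ _ _ _ _ _).
Qed.

(** Here the differential geometry ends: [omega_tildeE] and the formulas for [df] and the
    differentials of the three forms feed [split_form], and what remains is linear algebra at one
    point. *)
Lemma omega_split u v :
  let W k := bil (rot_mx q k A1 A2 A3 *m point_metric)
    (u *m point_split) (v *m point_split) in
  [/\ omega 1 X u v = W 1%N, omega 2 X u v = W 2%N & omega 3 X u v = W 3%N].
Proof.
move=> W.
have [F WF [F1 F2 F3]] :=
  split_form (Z x) sG (f_neq0 x) hJ (tangent proj p) th1 q0 u v.
have [d1 d2 d3] := thetaP_differentiable M_manifold P_manifold M_hk
  proj_smooth Z_smooth eta_form p.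
have om k : omega k X u v = qc k (qrot q F).
  rewrite /omega thetaE omega_tildeE //; last 2 first.
  - by move=> p'; exact: f_neq0.
  - exact: loc_fun_proj_differentiable.
  rewrite -WF; congr (qc k _).
  rewrite /d_imag !(derive_loc_fun_proj M_manifold P_manifold proj_smooth f_smooth f_d).
  rewrite (ext_d_thetaP1 M_manifold P_manifold M_hk proj_smooth
    Z_smooth eta_form eta_curvature).
  rewrite (ext_d_thetaP2 M_manifold P_manifold M_hk proj_smooth
    Z_smooth Z_killing Z_J2 f_smooth f_d).
  by rewrite (ext_d_thetaP3 M_manifold P_manifold M_hk proj_smooth
    Z_smooth Z_killing Z_J2).
(* The real part of [F] is dropped, since [split_form] gives only the imaginary components. *)
pose F0 := quat 0 (qc 1 F) (qc 2 F) (qc 3 F).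
have WE k : W k = rot_coeff q k F0.
  rewrite rot_imag F1 F2 F3 -!(split_mxE _ _ _ _ _ _ _ _ th1_lin) -/point_split.
  have [<- <- <-] := point_structure_metric (u *m point_split) (v *m point_split).
  by rewrite /W /rot_mx !mulmxDl -!scalemxAl !bilDm !bilZm.
have [R1 R2 R3] := qrot_imag q F.
by rewrite !om !WE R1 R2 R3.
Qed.

Variables (ghat Jhat1 Jhat2 Jhat3 : Mhat -> 'M[R]_d) (xi : Mhat -> 'rV[R]_d)
  (pitilde : prod_charted (Hstar R) P -> Mhat).
Hypothesis d_eq : d = (4 + n)%N.
Hypothesis pitilde_full : row_full (tangent pitilde X).
Hypothesis Mhat_metric : ghat (pitilde X) \in unitmx.
Hypothesis Mhat_triple : hermitian_triple (ghat (pitilde X))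
  (Jhat1 (pitilde X)) (Jhat2 (pitilde X)) (Jhat3 (pitilde X)).
Hypothesis omega_hat1 : forall u v,
  kahler_form ghat Jhat1 (pitilde X)
    (u *m tangent pitilde X) (v *m tangent pitilde X) = omega 1 X u v.
Hypothesis omega_hat2 : forall u v,
  kahler_form ghat Jhat2 (pitilde X)
    (u *m tangent pitilde X) (v *m tangent pitilde X) = omega 2 X u v.
Hypothesis omega_hat3 : forall u v,
  kahler_form ghat Jhat3 (pitilde X)
    (u *m tangent pitilde X) (v *m tangent pitilde X) = omega 3 X u v.
Hypothesis xi_projection : xi (pitilde X) = radial X *m tangent pitilde X.
Variables a b : nat.
Hypothesis M_signature : has_signature (g x) a b.

Let z := pitilde X.

(** [H] is the restriction to the second block of the isomorphism [B] from [quotient_metric]. As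
    [xi] lies in the image of the first block, block-diagonality of the metric and of the three
    forms gives the orthogonality. *)
Lemma horizontal_frame : exists H : 'M[R]_(n, d),
  (forall u v, bil (ghat z) (u *m H) (v *m H) = qnorm2 q *
     bil (hor_metric (g x) (Z x) (f x) (J1 x) (J2 x) (J3 x)) u v)
  /\ forall u, orthogonal_to (ghat z)
       (quat_distribution Jhat1 Jhat2 Jhat3 xi z) (u *m H).
Proof.
have [JJ KK LL KJ JK skJ skK skL] := hJ.
have [JJh KKh LLh KJh JKh skJh skKh skLh] := Mhat_triple.
have f10 := f1_neq0 x; have f0 := f_neq0 x.
have uS : point_metric \in unitmx.
  apply: model_metric_unit => //.
  exact: (hor_metric_unit sG (Z_neq0 x) f0 f10 hJ M_signature).
have [B [BG tauB [B1 B2 B3]]] : exists B : 'M[R]_(4 + n, d),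
  [/\ B *m ghat z *m B^T = qnorm2 q *: point_metric,
      tangent pitilde X = point_split *m B
    & [/\ B *m (Jhat1 z *m ghat z) *m B^T = rot_mx q 1 A1 A2 A3 *m point_metric,
          B *m (Jhat2 z *m ghat z) *m B^T = rot_mx q 2 A1 A2 A3 *m point_metric
        & B *m (Jhat3 z *m ghat z) *m B^T = rot_mx q 3 A1 A2 A3 *m point_metric]].
  apply: (quotient_metric d_eq q0 pitilde_full Mhat_metric uS JJh LLh KJh).
  - exact (model_structure_sq f0 f10 qi_sq JJ).
  - exact (model_structure_sq f0 f10 qj_sq KK).
  - have qk_sq : qmul qk qk = quat (-1) 0 0 0 :> 'rV[R]_4.
      by apply: quat_ext; rewrite !qcE; ring.
    exact (model_structure_sq f0 f10 qk_sq LL).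
  - rewrite /A1 /A2 /A3 /point_structure -qij.
    exact (model_structureM f0 f10 _ _ KJ).
  - by move=> u v; have [W1 _ _] := omega_split u v; rewrite -W1 -omega_hat1.
  - by move=> u v; have [_ W2 _] := omega_split u v; rewrite -W2 -omega_hat2.
  - by move=> u v; have [_ _ W3] := omega_split u v; rewrite -W3 -omega_hat3.
pose I : 'M[R]_(n, 4 + n) := row_mx 0 1%:M.
have IE u : u *m I = row_mx 0 u by rewrite mul_mx_row mulmx0 mulmx1.
have BGE w w' : bil (ghat z) (w *m B) (w' *m B) = qnorm2 q * bil point_metric w w'.
  by rewrite -bil_congr BG bilZm.
(* The radial field has no component along [P], so its splitting has none along the complement. *)
have [c xiE] : exists c : 'rV[R]_4, xi z = row_mx c 0 *m B.
  exists (lsubmx (radial X *m point_split)).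
  rewrite /z xi_projection tauB mulmxA; congr (_ *m B).
  rewrite -[LHS]hsubmxK; congr row_mx; rewrite split_mxE // row_mxKr.
  have th10 : th1 0 = 0.
    by have := th1_lin (-1) 0 0; rewrite scaler0 addr0 mulN1r addNr.
  by rewrite /radial row_mxKr th10 mul0r scale0r mul0mx subr0.
have hor0 J K L u : hor_form (g x) (Z x) (f x) J K L u 0 = 0.
  by rewrite /hor_form /bil trmx0 !mulmx0 mxE; ring.
have qc00 w : qc 0 (qmul (qmul w (0 : 'rV[R]_4)) (qconj c)) = 0.
  by rewrite !qcE !qc0; ring.
have orth k u : bil (rot_mx q k A1 A2 A3 *m point_metric) (row_mx 0 u) (row_mx c 0) = 0.
  rewrite /rot_mx !mulmxDl -!scalemxAl !bilDm !bilZm.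
  have [-> -> ->] := point_structure_metric (row_mx 0 u) (row_mx c 0).
  by rewrite /model_form !row_mxKl !row_mxKr !hor0 !qc00; ring.
exists (I *m B); split=> [u v|u w [c0 [c1 [c2 [c3 ->]]]]].
  rewrite !mulmxA !IE BGE; congr (_ * _); rewrite bil_block.
  by rewrite {1}/bil !mul0mx mxE add0r.
rewrite !mulmxA IE !bilDr !bilZr.
have O0 : bil (ghat z) (row_mx 0 u *m B) (xi z) = 0.
  rewrite xiE BGE bil_block /bil !mul0mx trmx0 mulmx0 !mxE; ring.
(* Skew-symmetry turns orthogonality to [xi z *m Jh] into the vanishing of a Kähler form against
   [xi z], which the model gives without locating [xi z *m Jh] in the fibre. *)
have OJ Jh k : (forall u v, bil (ghat z) (u *m Jh) v = - bil (ghat z) u (v *m Jh)) ->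
    B *m (Jh *m ghat z) *m B^T = rot_mx q k A1 A2 A3 *m point_metric ->
    bil (ghat z) (row_mx 0 u *m B) (xi z *m Jh) = 0.
  move=> sk BJ; apply: oppr_inj; rewrite -sk oppr0 xiE -bil_mulmx -bil_congr BJ.
  exact: orth.
rewrite O0 (OJ _ _ skJh B1) (OJ _ _ skKh B2) (OJ _ _ skLh B3); ring.
Qed.

End conical_metric.

Theorem corollary1 (R : realType) (k l n : nat)
  (* the pseudo-hyper-Kähler manifold M, with Z and f *)
  (M : charted R n) (g J1 J2 J3 : M -> 'M[R]_n)
  (Z : M -> 'rV[R]_n) (f f1 : M -> R)
  (M_manifold : is_manifold M)
  (M_hk : pseudo_hyper_kahler g J1 J2 J3)
  (M_signature : forall x, has_signature (g x) (4 * k) (4 * l))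
  (Z_smooth : smooth_field_on setT (loc_vec Z))
  (Z_killing : forall x u v, lie_bil Z g x u v = 0)
  (Z_neq0 : forall x, bil (g x) (Z x) (Z x) != 0)
  (Z_J2 : forall x v, lie_end Z J2 x v = - 2 *: (v *m J3 x))
  (f_smooth : smooth_field_on setT (loc_fun f))
  (f_neq0 : forall x, f x != 0)
  (f_d : forall x u, fun_d f x u = - kahler_form g J1 x (Z x) u)
  (f1_def : forall x, f1 x = f x - 2^-1 * bil (g x) (Z x) (Z x))
  (f1_neq0 : forall x, f1 x != 0)
  (* the circle bundle P, its connection eta, the horizontal lift of Z *)
  (P : charted R n.+1) (proj : P -> M) (act : R -> P -> P)
  (eta : P -> 'rV[R]_n.+1 -> R) (Ztilde : P -> 'rV[R]_n.+1)
  (P_manifold : is_manifold P)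
  (P_bundle : circle_bundle proj act)
  (eta_connection : principal_connection act eta)
  (eta_curvature : forall p u v,
     ext_d eta p u v
     = kahler_form g J1 (proj p) (u *m tangent proj p) (v *m tangent proj p)
       - 2^-1 * ext_d (fun x w => bil (g x) (Z x) w) (proj p)
                  (u *m tangent proj p) (v *m tangent proj p))
  (Ztilde_horizontal : forall p, eta p (Ztilde p) = 0)
  (Ztilde_lift : forall p, Ztilde p *m tangent proj p = Z (proj p))
  (* the conical pseudo-hyper-Kähler manifold, quotient of H^* x P *)
  (Mhat : charted R (n + 4)) (ghat Jhat1 Jhat2 Jhat3 : Mhat -> 'M[R]_(n + 4))
  (xi : Mhat -> 'rV[R]_(n + 4)) (pitilde : prod_charted (Hstar R) P -> Mhat)
  (Mhat_manifold : is_manifold Mhat)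
  (Mhat_quotient : is_quotient_map setT
     (joined setT (fun x => [set V1 act Ztilde (f1 \o proj) x])) pitilde)
  (Mhat_conical : conical_pseudo_hyper_kahler ghat Jhat1 Jhat2 Jhat3 xi)
  (omega_hat1 : forall x u v,
     kahler_form ghat Jhat1 (pitilde x)
       (u *m tangent pitilde x) (v *m tangent pitilde x)
     = omega_tilde (f \o proj) (theta g J2 J3 Z f proj eta) 1 x u v)
  (omega_hat2 : forall x u v,
     kahler_form ghat Jhat2 (pitilde x)
       (u *m tangent pitilde x) (v *m tangent pitilde x)
     = omega_tilde (f \o proj) (theta g J2 J3 Z f proj eta) 2 x u v)
  (omega_hat3 : forall x u v,
     kahler_form ghat Jhat3 (pitilde x)
       (u *m tangent pitilde x) (v *m tangent pitilde x)
     = omega_tilde (f \o proj) (theta g J2 J3 Z f proj eta) 3 x u v)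
  (xi_projection : forall x,
     xi (pitilde x) = radial x *m tangent pitilde x)
  (* the associated quaternionic pseudo-Kähler manifold *)
  (Mbar : charted R n) (gbar : Mbar -> 'M[R]_n) (Q : Mbar -> set 'M[R]_n)
  (U : set Mhat) (pibar : Mhat -> Mbar)
  (Mbar_manifold : is_manifold Mbar)
  (Mbar_quotient :
     quaternionic_quotient ghat Jhat1 Jhat2 Jhat3 xi gbar Q U pibar) :
  (* The signs of f and f1 are constant, and may be read at any point x. The
     truncated subtractions are exact: a signature has p + q = n. *)
  forall (x : M) (y : Mbar),
    [/\ 0 < f1 x * f x -> has_signature (gbar y) (4 * k) (4 * l),
        0 < f x -> f1 x < 0 ->
          has_signature (gbar y) (4 * k - 4) (4 * l + 4)
      & f x < 0 -> 0 < f1 x ->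
          has_signature (gbar y) (4 * k + 4) (4 * l - 4)].
Proof.
move=> x y.
have [_ _ pibar_onto _] := qq_leaves Mbar_quotient.
have [z Uz zy] := pibar_onto y.
have [_ pitilde_full pitilde_onto _] := Mhat_quotient.
have [X _ Xz] := pitilde_onto z.
have f1_neq0' a : f a - 2^-1 * bil (g a) (Z a) (Z a) != 0 by rewrite -f1_def.
have hk_hat := conical_hk Mhat_conical.
(* The point over which the chosen preimage of [y] lies; it is unrelated to [x]. *)
set x0 := proj X.2.
have [H [HG HD]] := horizontal_frame M_manifold P_manifold M_hk
  (proj_smooth P_bundle) Z_smooth Z_killing Z_neq0 Z_J2 f_smooth f_neq0 f_d
  f1_neq0' (connection_form eta_connection) eta_curvature (addnC n 4)
  (pitilde_full X I) (metric_nondeg (hk_metric hk_hat) _) (hk_triple hk_hat _)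
  (omega_hat1 X) (omega_hat2 X) (omega_hat3 X) (xi_projection X)
  (M_signature x0).
(* On horizontal vectors [gbar] is the horizontal model times a product of positive factors, so the
   signature passes unchanged. *)
have transfer p q : has_signature
    (hor_metric (g x0) (Z x0) (f x0) (J1 x0) (J2 x0) (J3 x0)) p q ->
    has_signature (gbar y) p q.
  have [c c0 cE] := qq_metric Mbar_quotient.
  have q0 := qnorm2_gt0 (quat_neq0 X.1).
  have xi0 : 0 < `|bil (ghat z) (xi z) (xi z)|.
    by rewrite normr_gt0; exact: conical_neq0 Mhat_conical _.
  apply: (@has_signature_scale _ _ _ _ (H *m tangent pibar z)
    (c * (`|bil (ghat z) (xi z) (xi z)|^-1 * qnorm2 (set_val X.1)))).
    by rewrite !mulr_gt0 // invr_gt0.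
  move=> u v; rewrite !mulmxA -zy -Xz cE; last 3 first.
  - by rewrite Xz.
  - exact: HD.
  - exact: HD.
  by rewrite HG !mulrA.
have cf : continuous (f : M -> R^o).
  apply: continuous_loc_fun => // a; exact: smooth_field_differentiable.
have cf1 : continuous (f1 : M -> R^o).
  apply: continuous_loc_fun => // a.
  have df := smooth_field_differentiable M_manifold a f_smooth.
  have dZ := smooth_field_differentiable M_manifold a Z_smooth.
  have dG := smooth_field_differentiable M_manifold a
    (metric_smooth (hk_metric M_hk)).
  (* The frame factors of [loc_vec] and [loc_bil] cancel, which expresses [f1] through
     differentiable coordinate data. *)
  apply: (@near_eq_differentiable _ _ _ (fun t => loc_fun f a t - 2^-1 *:
    ((loc_vec Z a t *m loc_bil g a t *m (loc_vec Z a t)^T) ord0 ord0 : R^o))).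
    apply: filterS (near_frame M_manifold a) => t ft.
    rewrite /loc_fun f1_def /bil /loc_vec /loc_bil; congr (_ - _ *: _).
    by rewrite trmx_mul trmx_inv !mulmxA mulmxKV // mulmxK // unitmx_tr.
  apply: differentiableB => //; apply: differentiableZ.
  apply: differentiable_entry; apply: differentiable_mulmx.
    exact: differentiable_mulmx.
  exact: differentiable_trmx.
have [fp fn] := sign_constant M_manifold cf f_neq0 x x0.
have [f1p f1n] := sign_constant M_manifold cf1 f1_neq0 x x0.
have [same down up] := hor_metric_signature
  (Defs.metric_sym (hk_metric M_hk) x0) (Z_neq0 x0) (f_neq0 x0) (f1_neq0' x0)
  (hk_triple M_hk x0) (M_signature x0).
rewrite -f1_def in same down up.
split=> [ff|f_pos f1_neg|f_neg f1_pos]; apply: transfer.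
(* The sign of the product does not tell the common sign of [f x] and [f1 x], and the two signs are
   carried to [x0] separately, hence the case distinction. *)
- apply: same; have [f_pos|f_neg|f_eq] := ltgtP 0 (f x).
  + by rewrite mulr_gt0 -?f1p -?fp // -(pmulr_lgt0 _ f_pos).
  + by rewrite nmulr_lgt0 -?f1n -?fn // -(nmulr_lgt0 _ f_neg).
  + by have := f_neq0 x; rewrite -f_eq eqxx.
- by apply: down; rewrite -?fp -?f1n.
- by apply: up; rewrite -?fn -?f1p.
Qed.
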